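(* Let $\alpha\in(0,1)$ and let $B=\mathrm{diag}(B^s,B^u)\in\mathbb{C}^{d\times d}$ be a matrix in Jordan normal form, where $B^s\in\mathbb{C}^{d_s\times d_s}$ consists of the Jordan blocks whose eigenvalues lie in $\Lambda_\alpha^s$ and $B^u\in\mathbb{C}^{d_u\times d_u}$ of those whose eigenvalues lie in $\Lambda_\alpha^u$, with $\sigma(B)\subset\Lambda_\alpha^u\cup\Lambda_\alpha^s$. Let $g=(g^s,g^u)^{\mathrm T}$ be a continuous function on $[0,\infty)$ with bounded components ($g^s$ with $d_s$ components, $g^u$ with $d_u$ components). Then: (1) the equation ${}^{C}D^\alpha_{0+}y^u=B^uy^u+g^u(t)$ has a unique solution $\bar\varphi$ bounded on $\mathbb{R}_{\ge0}$; (2) for every $y^s_0\in\mathbb{C}^{d_s}$ the solution $\varphi(\cdot;0,y^s_0)$ of ${}^{C}D^\alpha_{0+}y^s=B^sy^s+g^s(t)$, $y^s(0)=y^s_0$, is bounded on $\mathbb{R}_{\ge0}$; (3) the set of all bounded solutions of ${}^{C}D^\alpha_{0+}y(t)=By(t)+g(t)$ is exactly $\{(\varphi(\cdot;0,y^s_0),\bar\varphi(\cdot))^{\mathrm T}: y^s_0\in\mathbb{C}^{d_s}\}$. If moreover all components of $g$ tend to $0$ as $t\to\infty$, then every bounded solution of ${}^{C}D^\alpha_{0+}y=By+g$ tends to $0$ as $t\to\infty$.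
   Context: For $\alpha\in(0,1)$ the Caputo derivative is ${}^{C}D^\alpha_{0+}x(t)=\frac{1}{\Gamma(1-\alpha)}\int_0^t(t-\tau)^{-\alpha}x'(\tau)\,d\tau$, applied componentwise. Arguments of nonzero complex numbers are in $(-\pi,\pi]$; $\Lambda_\alpha^u:=\{\lambda\in\mathbb{C}\setminus\{0\}:|\arg\lambda|<\alpha\pi/2\}$ and $\Lambda_\alpha^s:=\{\lambda\in\mathbb{C}\setminus\{0\}:|\arg\lambda|>\alpha\pi/2\}$; $\sigma(B)$ is the set of eigenvalues of $B$. Solutions with initial value $y_0$ are given by $y(t)=E_\alpha(t^\alpha B)y_0+\int_0^t(t-\tau)^{\alpha-1}E_{\alpha,\alpha}((t-\tau)^\alpha B)g(\tau)\,d\tau$, where $E_{\alpha,\beta}(z)=\sum_{k\ge0}z^k/\Gamma(\alpha k+\beta)$, $E_\alpha=E_{\alpha,1}$. *)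

(* Defs.v *)
From Stdlib Require Export Reals Lra ClassicalEpsilon Ratan.
Open Scope R_scope.

Definition C := (R * R)%type.
Definition C0 : C := (0, 0).
Definition C1 : C := (1, 0).
Definition Cadd (z w : C) : C := (fst z + fst w, snd z + snd w).
Definition Cmul (z w : C) : C :=
  (fst z * fst w - snd z * snd w, fst z * snd w + snd z * fst w).
Definition Cscal (r : R) (z : C) : C := (r * fst z, r * snd z).
Definition Cnorm (z : C) : R := sqrt (fst z ^ 2 + snd z ^ 2).

(* principal argument in (-pi, pi] (atan2); Carg C0 = 0 is irrelevant *)
Definition Carg (z : C) : R :=
  let x := fst z in let y := snd z in
  if Rlt_dec 0 x then atan (y / x)
  else if Rlt_dec x 0 then
    (if Rle_dec 0 y then atan (y / x) + PI else atan (y / x) - PI)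
  else if Rlt_dec 0 y then PI / 2
  else if Rlt_dec y 0 then - (PI / 2) else 0.

Definition Lambda_u (al : R) (z : C) : Prop :=
  z <> C0 /\ Rabs (Carg z) < al * PI / 2.
Definition Lambda_s (al : R) (z : C) : Prop :=
  z <> C0 /\ Rabs (Carg z) > al * PI / 2.

(* ---------- vectors and matrices (entries with index < dimension matter) ---------- *)
Definition vec := nat -> C.
Definition Mat := nat -> nat -> C.

Fixpoint Csum (n : nat) (f : nat -> C) : C :=
  match n with O => C0 | S m => Cadd (Csum m f) (f m) end.

Definition mat_mul (n : nat) (A B : Mat) : Mat :=
  fun i j => Csum n (fun k => Cmul (A i k) (B k j)).
Definition mat_vec (n : nat) (A : Mat) (v : vec) : vec :=
  fun i => Csum n (fun k => Cmul (A i k) (v k)).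
Definition mat_id : Mat := fun i j => if Nat.eqb i j then C1 else C0.
Fixpoint mat_pow (n : nat) (A : Mat) (k : nat) : Mat :=
  match k with O => mat_id | S m => mat_mul n (mat_pow n A m) A end.
Definition Mscal (r : R) (A : Mat) : Mat := fun i j => Cscal r (A i j).

Definition eigenvalue (n : nat) (A : Mat) (lam : C) : Prop :=
  exists v : vec, (exists i, (i < n)%nat /\ v i <> C0) /\
    forall i, (i < n)%nat -> mat_vec n A v i = Cmul lam (v i).

Definition is_jordan (n : nat) (A : Mat) : Prop :=
  (forall i j, (i < n)%nat -> (j < n)%nat -> j <> i -> j <> S i -> A i j = C0) /\
  (forall i, (S i < n)%nat ->
     A i (S i) = C0 \/ (A i (S i) = C1 /\ A i i = A (S i) (S i))).

Definition rpow (t a : R) : R := if Rlt_dec 0 t then Rpower t a else 0.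

Definition RInt_eq (f : R -> R) (a b l : R) : Prop :=
  exists pr : Riemann_integrable f a b, RiemannInt pr = l.

Definition is_Gamma (x l : R) : Prop :=
  forall eps, 0 < eps -> exists del, 0 < del /\ exists M,
    forall u v, 0 < u < del -> M < v ->
      exists I, RInt_eq (fun t => Rpower t (x - 1) * exp (- t)) u v I /\
                Rabs (I - l) < eps.
Definition Gamma (x : R) : R := epsilon (inhabits 0) (is_Gamma x).

Definition is_impint (f : R -> R) (a b l : R) : Prop :=
  forall eps, 0 < eps -> exists del, 0 < del /\
    forall v, b - del < v < b ->
      exists I, RInt_eq f a v I /\ Rabs (I - l) < eps.
Definition impint (f : R -> R) (a b : R) : R := epsilon (inhabits 0) (is_impint f a b).
Definition Cimpint (f : R -> C) (a b : R) : C :=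
  (impint (fun s => fst (f s)) a b, impint (fun s => snd (f s)) a b).

Definition Clim (u : nat -> C) (l : C) : Prop :=
  Un_cv (fun N => fst (u N)) (fst l) /\ Un_cv (fun N => snd (u N)) (snd l).

Definition MLmat (al be : R) (n : nat) (A : Mat) : Mat := fun i j =>
  epsilon (inhabits C0)
    (Clim (fun N => Csum N (fun k =>
       Cscal (/ Gamma (al * INR k + be)) (mat_pow n A k i j)))).

(* ---------- the solution phi(.; 0, y0) of  ^C D^al y = A y + g(t),  y(0) = y0 ----------
   y(t) = E_al(t^al A) y0 + int_0^t (t-s)^(al-1) E_{al,al}((t-s)^al A) g(s) ds *)
Definition sol (n : nat) (al : R) (A : Mat) (g : R -> vec) (y0 : vec) : R -> vec :=
  fun t i =>
    Cadd (mat_vec n (MLmat al 1 n (Mscal (rpow t al) A)) y0 i)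
         (Cimpint (fun s => Cscal (rpow (t - s) (al - 1))
                     (mat_vec n (MLmat al al n (Mscal (rpow (t - s) al) A)) (g s) i))
                  0 t).

Definition bounded_on (n : nat) (y : R -> vec) : Prop :=
  exists M, forall t i, 0 <= t -> (i < n)%nat -> Cnorm (y t i) <= M.

Definition continuous_on (n : nat) (y : R -> vec) : Prop :=
  forall i t, (i < n)%nat -> 0 <= t -> forall eps, 0 < eps -> exists del, 0 < del /\
    forall s, 0 <= s -> Rabs (s - t) < del ->
      Cnorm (Cadd (y s i) (Cscal (-1) (y t i))) < eps.

Definition tends_to_0 (n : nat) (y : R -> vec) : Prop :=
  forall eps, 0 < eps -> exists T, forall t i, T <= t -> (i < n)%nat -> Cnorm (y t i) < eps.

Definition blk_u (ds : nat) (B : Mat) : Mat := fun i j => B (ds + i)%nat (ds + j)%nat.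
Definition vec_u (ds : nat) (g : R -> vec) : R -> vec := fun t i => g t (ds + i)%nat.
(* B^s = B restricted to indices < ds, g^s = g restricted to indices < ds *)

(* Main.v *)
(** For a Jordan block with eigenvalue lam, the matrix functions in the solution formula have the entries
    S_j(t) = sum_k binomial(k,j) lam^(k-j) t^(al k) / Gamma(al k + 1) and R_j(t), with t R_j = al (j+1) S_(j+1).
    Hankel's integral for 1/Gamma turns S_j into (1 / 2 pi i) times the integral of e^(tp) p^(al-1) (p^al - lam)^(-j-1)
    over an arc |p| = X, |arg p| <= Th with pi/2 < Th <= pi. Deforming the arc onto the rays arg p = -Th, Th
    leaves O(t^(-al)), plus the residue at p = lam^(1/al) exactly when |arg lam| < al pi/2. Hence R_j is integrable
    at infinity up to an exponentially growing pole part.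

    Without pole part (stable blocks) every solution is bounded, and decays with g. With it, the pole part of R at
    time t - s is the product of the pole part of S at time t and that of R at time -s, so the growth cancels
    precisely for one initial value, an integral of g over [0, oo) against the pole part of R at -s; any other
    initial value differs by a multiple of S_0, which grows exponentially.

    Contour integrals are written in the coordinate w = log p, where all integrands are elementary and single-valued
    and the contours are sides of rectangles. *)

From Coquelicot Require Import Coquelicot.
Require Import Defs.
From Stdlib Require Import Lia Psatz FunctionalExtensionality.

Local Notation CC := Complex.C.
Local Open Scope C_scope.
Local Open Scope R_scope.
(** * Complex-valued functions of a real variable *)

(** The kernel R_j is never estimated on the rays directly: that would give only O(1/t), which is
    not integrable. Through S_(j+1) the factor 1/t improves O(t^(-al)) to O(t^(-al-1)), and every
    Gamma parameter al k + 1 is at least 1, the range in which Hankel's formula is proved. That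
    formula has to be derived, since [Gamma] is given only as a limit of integrals. The Laplace
    transform at 1 of the arc integral is computed in two ways, once as a multiple of Gamma and once
    by the residue at p = 1. The series and the arc integral are compared at a finite radius, where
    the expansion in lam / p^al converges geometrically. The errors of 1/Gamma then sum to a small
    quantity, and no infinite contour occurs. The angle is Th = pi when the pole is kept. For a
    stable eigenvalue it lies strictly between pi/2 and min(pi, |arg lam| / al), so that the sector
    contains no pole. In both cases al Th + |arg lam| < 2 pi keeps the other branches of p^al = lam
    away. *)

Definition Cexp (z : CC) : CC := (exp (fst z) * cos (snd z), exp (fst z) * sin (snd z)).

Lemma C_ext (z w : CC) : fst z = fst w -> snd z = snd w -> z = w.
Proof. destruct z, w; simpl; intros -> ->; reflexivity. Qed.

Lemma Cexp_plus (z w : CC) : Cexp (z + w)%C = (Cexp z * Cexp w)%C.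
Proof.
  apply C_ext; unfold Cexp, Cplus, Cmult; simpl; rewrite exp_plus.
  - rewrite cos_plus; ring.
  - rewrite sin_plus; ring.
Qed.

Lemma Cexp_0 : Cexp 0 = 1.
Proof. apply C_ext; unfold Cexp; simpl; rewrite exp_0, ?cos_0, ?sin_0; ring. Qed.

Lemma Cexp_RtoC (x : R) : Cexp (RtoC x) = RtoC (exp x).
Proof. apply C_ext; unfold Cexp; simpl; rewrite ?cos_0, ?sin_0; ring. Qed.

Lemma Cmod_sqr (z : CC) : (Cmod z)^2 = (fst z)^2 + (snd z)^2.
Proof. unfold Cmod. rewrite pow2_sqrt; [reflexivity | nra]. Qed.

Lemma Cmod_Cexp (z : CC) : Cmod (Cexp z) = exp (fst z).
Proof.
  unfold Cmod, Cexp; simpl fst; simpl snd.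
  replace ((exp (fst z) * cos (snd z)) ^ 2 + (exp (fst z) * sin (snd z)) ^ 2)
    with ((exp (fst z))^2).
  - rewrite sqrt_pow2; [reflexivity | left; apply exp_pos].
  - pose proof (sin2_cos2 (snd z)) as H; unfold Rsqr in H. 
    transitivity (exp (fst z) ^ 2 * (sin (snd z) * sin (snd z) + cos (snd z) * cos (snd z))).
    + rewrite H; ring.
    + ring.
Qed.

Lemma Cexp_neq_0 (z : CC) : Cexp z <> 0.
Proof. apply Cmod_gt_0. rewrite Cmod_Cexp. apply exp_pos. Qed.

Lemma Cexp_opp (z : CC) : Cexp (- z) = (/ Cexp z)%C.
Proof.
  assert (H : (Cexp (- z) * Cexp z)%C = 1).
  { rewrite <- Cexp_plus. replace (- z + z)%C with (RtoC 0) by ring. apply Cexp_0. }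
  replace (Cexp (- z)) with (Cexp (- z) * Cexp z * / Cexp z)%C.
  - rewrite H. ring.
  - field. apply Cexp_neq_0.
Qed.

Lemma Cexp_pow (z : CC) (n : nat) : (Cexp z ^ n)%C = Cexp (RtoC (INR n) * z)%C.
Proof.
  induction n as [|n IH].
  - simpl. rewrite Cmult_0_l, Cexp_0; reflexivity.
  - rewrite Cpow_S, IH, <- Cexp_plus, S_INR, RtoC_plus. f_equal; ring.
Qed.

Lemma abs_fst_le_Cmod (z : CC) : Rabs (fst z) <= Cmod z.
Proof. apply Rle_trans with (2 := Rmax_Cmod z). apply Rmax_l. Qed.

Lemma abs_snd_le_Cmod (z : CC) : Rabs (snd z) <= Cmod z.
Proof. apply Rle_trans with (2 := Rmax_Cmod z). apply Rmax_r. Qed.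

Lemma Cmod_le_sum (z : CC) : Cmod z <= Rabs (fst z) + Rabs (snd z).
Proof.
  replace z with (RtoC (fst z) + Ci * RtoC (snd z))%C at 1.
  - eapply Rle_trans; [apply Cmod_triangle|].
    rewrite Cmod_mult, Cmod_Ci, !Cmod_R; lra.
  - apply C_ext; simpl; ring.
Qed.

Definition cd (f : R -> CC) (x : R) (l : CC) : Prop :=
  is_derive (fun y => fst (f y)) x (fst l) /\ is_derive (fun y => snd (f y)) x (snd l).

(** The domain is an arbitrary uniform space because differentiation under the integral sign needs
    joint continuity on pairs, see [ccont2]. *)
Definition ccont {U : UniformSpace} (f : U -> CC) (x : U) : Prop :=
  continuous (fun y => fst (f y)) x /\ continuous (fun y => snd (f y)) x.

Lemma cd_ccont (f : R -> CC) x l : cd f x l -> ccont f x.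
Proof.
  intros [H1 H2]; split; apply (ex_derive_continuous (V:=R_NormedModule)); eexists; eassumption.
Qed.

Lemma cd_eq (f : R -> CC) x l l' : l = l' -> cd f x l -> cd f x l'.
Proof. intros ->; auto. Qed.

Lemma cd_ext (f g : R -> CC) x l : (forall y, f y = g y) -> cd f x l -> cd g x l.
Proof.
  intros E [H1 H2]; split; (eapply is_derive_ext; [|eassumption]);
    intros; simpl; rewrite E; reflexivity.
Qed.

Lemma cd_const c x : cd (fun _ => c) x 0.
Proof. split; simpl; apply (is_derive_const (V:=R_NormedModule)). Qed.

Lemma cd_plus (f g : R -> CC) x l m : cd f x l -> cd g x m -> cd (fun y => f y + g y)%C x (l + m)%C.
Proof.
  intros [H1 H2] [H3 H4]; split; simpl; apply (is_derive_plus (V:=R_NormedModule)); assumption.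
Qed.

Lemma is_derive_mult_R (f g : R -> R) x l m :
  is_derive f x l -> is_derive g x m -> is_derive (fun y => f y * g y) x (l * g x + f x * m).
Proof. intros H1 H2. apply (is_derive_mult f g x l m H1 H2). intros; apply Rmult_comm. Qed.

Lemma cd_mult (f g : R -> CC) x l m :
  cd f x l -> cd g x m -> cd (fun y => f y * g y)%C x (l * g x + f x * m)%C.
Proof.
  intros [H1 H2] [H3 H4]; split; simpl.
  - eapply eq_rect; [apply (is_derive_minus (V:=R_NormedModule)); apply is_derive_mult_R; eassumption|].
    unfold minus, plus, opp; simpl; ring.
  - eapply eq_rect; [apply (is_derive_plus (V:=R_NormedModule)); apply is_derive_mult_R; eassumption|].
    unfold minus, plus, opp; simpl; ring.
Qed.

Lemma cd_cmult c (f : R -> CC) x l : cd f x l -> cd (fun y => c * f y)%C x (c * l)%C.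
Proof.
  intros H. eapply cd_eq; [|apply (cd_mult (fun _ => c) f x 0 l (cd_const c x) H)]. ring.
Qed.

Lemma cd_exp (f : R -> CC) x l : cd f x l -> cd (fun y => Cexp (f y)) x (l * Cexp (f x))%C.
Proof.
  intros [H1 H2]. unfold Cexp. split; simpl.
  - eapply eq_rect.
    + apply is_derive_mult_R.
      * apply (is_derive_comp exp). apply is_derive_exp. exact H1.
      * apply (is_derive_comp cos). apply is_derive_cos. exact H2.
    + unfold scal; simpl; unfold mult; simpl. ring.
  - eapply eq_rect.
    + apply is_derive_mult_R.
      * apply (is_derive_comp exp). apply is_derive_exp. exact H1.
      * apply (is_derive_comp sin). apply is_derive_sin. exact H2.
    + unfold scal; simpl; unfold mult; simpl. ring.
Qed.

Lemma sum_sqr_neq_0 (z : CC) : z <> 0 -> fst z ^ 2 + snd z ^ 2 <> 0.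
Proof.
  intros H E. apply H. apply Cmod_eq_0. pose proof (Cmod_sqr z) as E2. rewrite E in E2.
  pose proof (Cmod_ge_0 z). nra.
Qed.

Lemma cd_inv (f : R -> CC) x l : f x <> 0 -> cd f x l -> cd (fun y => / f y)%C x (- (l * / f x * / f x))%C.
Proof.
  intros N [H1 H2]. pose proof (sum_sqr_neq_0 _ N) as N2.
  assert (HD : is_derive (fun y => fst (f y) ^ 2 + snd (f y) ^ 2) x
                 (2 * fst (f x) * fst l + 2 * snd (f x) * snd l)).
  { eapply eq_rect.
    - apply (is_derive_plus (V:=R_NormedModule)); (eapply is_derive_pow; eassumption).
    - unfold plus; simpl. ring. }
  split; simpl.
  - eapply eq_rect.
    + apply (is_derive_div (fun y => fst (f y)) (fun y => fst (f y) ^ 2 + snd (f y) ^ 2)); eassumption.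
    + simpl. field. simpl in N2. rewrite !Rmult_1_r in N2. exact N2.
  - eapply eq_rect.
    + apply (is_derive_div (fun y => - snd (f y)) (fun y => fst (f y) ^ 2 + snd (f y) ^ 2)); 
        try eassumption. apply (is_derive_opp (V:=R_NormedModule)); eassumption.
    + unfold opp; simpl. field. simpl in N2. rewrite !Rmult_1_r in N2. exact N2.
Qed.

Lemma cd_pow (f : R -> CC) x l (n : nat) :
  cd f x l -> cd (fun y => f y ^ n)%C x (RtoC (INR n) * f x ^ (n - 1) * l)%C.
Proof.
  intros H. induction n as [|n IH].
  - simpl. eapply cd_eq; [|apply cd_const]. ring.
  - eapply cd_eq; [|apply (cd_mult _ _ _ _ _ H IH)].
    rewrite S_INR, RtoC_plus. simpl Nat.sub. rewrite Nat.sub_0_r.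
    destruct n as [|n]; [simpl; ring|].
    simpl Nat.sub. rewrite Nat.sub_0_r. rewrite Cpow_S. ring.
Qed.

(** * Integrals of complex-valued functions and differentiation under the integral sign *)

Definition CI (f : R -> CC) (a b : R) : CC :=
  (RInt (fun x => fst (f x)) a b, RInt (fun x => snd (f x)) a b).

Lemma ccont_ex_RInt_fst (f : R -> CC) a b :
  (forall x, Rmin a b <= x <= Rmax a b -> ccont f x) -> ex_RInt (fun x => fst (f x)) a b.
Proof. intros H. apply (ex_RInt_continuous (V:=R_CompleteNormedModule)). intros x Hx. apply (H x Hx). Qed.

Lemma ccont_ex_RInt_snd (f : R -> CC) a b :
  (forall x, Rmin a b <= x <= Rmax a b -> ccont f x) -> ex_RInt (fun x => snd (f x)) a b.
Proof. intros H. apply (ex_RInt_continuous (V:=R_CompleteNormedModule)). intros x Hx. apply (H x Hx). Qed.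

Lemma CI_ext (f g : R -> CC) a b :
  (forall x, Rmin a b < x < Rmax a b -> f x = g x) -> CI f a b = CI g a b.
Proof.
  intros H; unfold CI; f_equal; apply RInt_ext; intros x Hx; rewrite H; auto.
Qed.

Lemma CI_plus (f g : R -> CC) a b :
  (forall x, Rmin a b <= x <= Rmax a b -> ccont f x) ->
  (forall x, Rmin a b <= x <= Rmax a b -> ccont g x) ->
  CI (fun x => f x + g x)%C a b = (CI f a b + CI g a b)%C.
Proof.
  intros Hf Hg; unfold CI; apply C_ext; simpl.
  - apply (RInt_plus (V:=R_CompleteNormedModule) (fun x => fst (f x)) (fun x => fst (g x)));
      apply ccont_ex_RInt_fst; assumption.
  - apply (RInt_plus (V:=R_CompleteNormedModule) (fun x => snd (f x)) (fun x => snd (g x)));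
      apply ccont_ex_RInt_snd; assumption.
Qed.

Lemma CI_scal (c : CC) (f : R -> CC) a b :
  (forall x, Rmin a b <= x <= Rmax a b -> ccont f x) ->
  CI (fun x => c * f x)%C a b = (c * CI f a b)%C.
Proof.
  intros Hf.
  assert (H1 := ccont_ex_RInt_fst f a b Hf). assert (H2 := ccont_ex_RInt_snd f a b Hf).
  unfold CI; apply C_ext; simpl.
  - rewrite (RInt_minus (V:=R_CompleteNormedModule) (fun x => scal (fst c) (fst (f x))) (fun x => scal (snd c) (snd (f x)))).
    + rewrite !(RInt_scal (V:=R_CompleteNormedModule)) by assumption. reflexivity.
    + apply (ex_RInt_scal (V:=R_NormedModule)); assumption.
    + apply (ex_RInt_scal (V:=R_NormedModule)); assumption.
  - rewrite (RInt_plus (V:=R_CompleteNormedModule) (fun x => scal (fst c) (snd (f x))) (fun x => scal (snd c) (fst (f x)))).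
    + rewrite !(RInt_scal (V:=R_CompleteNormedModule)) by assumption. reflexivity.
    + apply (ex_RInt_scal (V:=R_NormedModule)); assumption.
    + apply (ex_RInt_scal (V:=R_NormedModule)); assumption.
Qed.

Lemma ccont_const {U : UniformSpace} (c : CC) (x : U) : ccont (fun _ => c) x.
Proof. split; apply continuous_const. Qed.

Lemma ccont_plus {U : UniformSpace} (f g : U -> CC) x : ccont f x -> ccont g x -> ccont (fun y => f y + g y)%C x.
Proof. intros [H1 H2] [H3 H4]; split; simpl; apply (continuous_plus (V:=R_NormedModule)); auto. Qed.

Lemma ccont_mult {U : UniformSpace} (f g : U -> CC) x : ccont f x -> ccont g x -> ccont (fun y => f y * g y)%C x.
Proof.
  intros [H1 H2] [H3 H4]; split; simpl.
  - apply (continuous_minus (V:=R_NormedModule)); apply (continuous_mult (K:=R_AbsRing)); auto.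
  - apply (continuous_plus (V:=R_NormedModule)); apply (continuous_mult (K:=R_AbsRing)); auto.
Qed.

Lemma ccont_cmult {U : UniformSpace} (c : CC) (f : U -> CC) x : ccont f x -> ccont (fun y => c * f y)%C x.
Proof. intros H. apply ccont_mult; [apply ccont_const | exact H]. Qed.

Lemma ccont_RtoC {U : UniformSpace} (f : U -> R) x : continuous f x -> ccont (fun y => RtoC (f y)) x.
Proof. intros H; split; simpl; [exact H | apply continuous_const]. Qed.

Lemma ccont_ext_loc {U : UniformSpace} (f g : U -> CC) x : locally x (fun y => f y = g y) -> ccont f x -> ccont g x.
Proof.
  intros E [H1 H2]; split.
  - apply continuous_ext_loc with (2 := H1). eapply filter_imp; [|exact E].
    intros y Hy; simpl in *; rewrite Hy; reflexivity.
  - apply continuous_ext_loc with (2 := H2). eapply filter_imp; [|exact E].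
    intros y Hy; simpl in *; rewrite Hy; reflexivity.
Qed.

Lemma continuous_comp_derive {U : UniformSpace} (f : U -> R) (g : R -> R) x :
  ex_derive g (f x) -> continuous f x -> continuous (fun y => g (f y)) x.
Proof.
  intros Hg Hf. apply (continuous_comp f g); [exact Hf|].
  apply (ex_derive_continuous (V:=R_NormedModule)); exact Hg.
Qed.

Lemma ccont_exp {U : UniformSpace} (f : U -> CC) x : ccont f x -> ccont (fun y => Cexp (f y)) x.
Proof.
  intros [H1 H2]; split; simpl; apply (continuous_mult (K:=R_AbsRing));
    apply (continuous_comp_derive _ _ x); auto; auto_derive; exact I.
Qed.

Lemma ccont_inv {U : UniformSpace} (f : U -> CC) x :
  f x <> 0 -> ccont f x -> ccont (fun y => / f y)%C x.
Proof.
  intros N [H1 H2]. pose proof (sum_sqr_neq_0 _ N) as N2.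
  assert (D : continuous (fun y => / (fst (f y) ^ 2 + snd (f y) ^ 2)) x).
  { apply (continuous_comp_derive (fun y => fst (f y) ^ 2 + snd (f y) ^ 2) Rinv).
    - auto_derive; exact N2.
    - apply (continuous_plus (V:=R_NormedModule) (fun y => fst (f y) ^ 2) (fun y => snd (f y) ^ 2));
        apply (continuous_comp_derive _ (fun u => u ^ 2)); auto; auto_derive; exact I. }
  split; simpl.
  - apply (continuous_mult (K:=R_AbsRing) (fun y => fst (f y))); auto.
  - apply (continuous_mult (K:=R_AbsRing) (fun y => - snd (f y))); auto.
    apply (continuous_opp (V:=R_NormedModule)); auto.
Qed.

Lemma ccont_pow {U : UniformSpace} (f : U -> CC) x (n : nat) :
  ccont f x -> ccont (fun y => f y ^ n)%C x.
Proof.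
  intros H; induction n as [|n IH]; [apply ccont_const | apply (ccont_mult f); assumption].
Qed.

Lemma ccont_comp {U V : UniformSpace} (f : U -> V) (g : V -> CC) x :
  continuous f x -> ccont g (f x) -> ccont (fun y => g (f y)) x.
Proof.
  intros H [H1 H2]; split.
  - apply (continuous_comp f (fun y => fst (g y))); assumption.
  - apply (continuous_comp f (fun y => snd (g y))); assumption.
Qed.

Lemma continuous_Cmod {U : UniformSpace} (f : U -> CC) x : ccont f x -> continuous (fun y => Cmod (f y)) x.
Proof.
  intros [H1 H2]. unfold Cmod.
  apply (continuous_comp (fun y => fst (f y) ^ 2 + snd (f y) ^ 2) sqrt).
  - assert (P : forall h : U -> R, continuous h x -> continuous (fun y => h y ^ 2) x).
    { intros h Hh. apply (continuous_comp h (fun u => u ^ 2)); [exact Hh|].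
      apply (ex_derive_continuous (V:=R_NormedModule)). auto_derive; exact I. }
    exact (continuous_plus (V:=R_NormedModule) (fun y => fst (f y) ^ 2) (fun y => snd (f y) ^ 2) x
             (P _ H1) (P _ H2)).
  - apply continuity_pt_filterlim, continuity_pt_sqrt. nra.
Qed.

Lemma CI_Chasles (f : R -> CC) a b c :
  (forall x, Rmin a b <= x <= Rmax a b -> ccont f x) ->
  (forall x, Rmin b c <= x <= Rmax b c -> ccont f x) ->
  (CI f a b + CI f b c)%C = CI f a c.
Proof.
  intros H1 H2; unfold CI; apply C_ext; simpl; apply (RInt_Chasles (V:=R_CompleteNormedModule)).
  all: first [apply (ccont_ex_RInt_fst f); assumption | apply (ccont_ex_RInt_snd f); assumption].
Qed.


Lemma CI_derive (F f : R -> CC) a b :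
  (forall x, Rmin a b <= x <= Rmax a b -> cd F x (f x)) ->
  (forall x, Rmin a b <= x <= Rmax a b -> ccont f x) ->
  CI f a b = (F b - F a)%C.
Proof.
  intros HF Hf; unfold CI; apply C_ext; simpl; apply is_RInt_unique.
  - apply (is_RInt_derive (V:=R_CompleteNormedModule) (fun x => fst (F x)));
      intros x Hx; [apply HF | apply Hf]; exact Hx.
  - apply (is_RInt_derive (V:=R_CompleteNormedModule) (fun x => snd (F x)));
      intros x Hx; [apply HF | apply Hf]; exact Hx.
Qed.

(* Rotating the integral onto the real axis reduces the bound to the real case. *)
Lemma CI_bound (f : R -> CC) k a b :
  a <= b ->
  (forall x, a <= x <= b -> ccont f x) ->
  ex_RInt k a b ->
  (forall x, a < x < b -> Cmod (f x) <= k x) ->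
  Cmod (CI f a b) <= RInt k a b.
Proof.
  intros Hab Hf Hk Hle.
  assert (Hf' : forall x, Rmin a b <= x <= Rmax a b -> ccont f x).
  { intros x; rewrite Rmin_left, Rmax_right by assumption; auto. }
  set (I := CI f a b).
  assert (Hk0 : 0 <= RInt k a b).
  { apply RInt_ge_0; auto. intros x Hx. eapply Rle_trans; [apply Cmod_ge_0 | apply Hle; auto]. }
  destruct (Rle_lt_dec (Cmod I) 0) as [H0|H0]; [lra|].
  assert (HE : (Cmod I)^2 = RInt (fun x => fst (Cconj I * f x)%C) a b).
  { transitivity (fst (CI (fun x => Cconj I * f x)%C a b)); [|reflexivity].
    rewrite CI_scal by assumption. fold I. rewrite Cmod_sqr. simpl. ring. }
  assert (H2 : (Cmod I)^2 <= Cmod I * RInt k a b).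
  { rewrite HE.
    replace (Cmod I * RInt k a b) with (RInt (fun x => Cmod I * k x) a b).
    2:{ apply (RInt_scal (V:=R_CompleteNormedModule)); auto. }
    apply RInt_le; auto.
    - apply (ccont_ex_RInt_fst (fun x => Cconj I * f x)%C).
      intros x Hx. apply ccont_mult; [apply ccont_const | auto].
    - apply (ex_RInt_scal (V:=R_NormedModule)); auto.
    - intros x Hx. eapply Rle_trans; [apply Rle_abs|].
      eapply Rle_trans; [apply abs_fst_le_Cmod|].
      rewrite Cmod_mult. rewrite Cmod_conj. apply Rmult_le_compat_l; [lra|]. auto. }
  nra.
Qed.

Lemma CI_bound_const (f : R -> CC) M a b :
  a <= b ->
  (forall x, a <= x <= b -> ccont f x) ->
  (forall x, a < x < b -> Cmod (f x) <= M) ->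
  Cmod (CI f a b) <= M * (b - a).
Proof.
  intros Hab Hf HM.
  eapply Rle_trans; [apply (CI_bound f (fun _ => M)); auto|].
  - apply ex_RInt_const.
  - rewrite RInt_const. unfold scal; simpl; unfold mult; simpl. lra.
Qed.

Definition ccont2 (F : R -> R -> CC) (x y : R) : Prop :=
  ccont (U := prod_UniformSpace R_UniformSpace R_UniformSpace) (fun p => F (fst p) (snd p)) (x, y).

Lemma ccont2_fst (F : R -> R -> CC) x y : ccont2 F x y -> continuity_2d_pt (fun u v => fst (F u v)) x y.
Proof. intros [H _]. apply continuity_2d_pt_filterlim. exact H. Qed.

Lemma ccont2_snd (F : R -> R -> CC) x y : ccont2 F x y -> continuity_2d_pt (fun u v => snd (F u v)) x y.
Proof. intros [_ H]. apply continuity_2d_pt_filterlim. exact H. Qed.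

Lemma CI_param_derive (F F' : R -> R -> CC) (a b x d : R) :
  0 < d ->
  (forall y t, Rabs (y - x) < d -> Rmin a b <= t <= Rmax a b -> cd (fun u => F u t) y (F' y t)) ->
  (forall y t, Rabs (y - x) < d -> Rmin a b <= t <= Rmax a b -> ccont (F y) t) ->
  (forall t, Rmin a b <= t <= Rmax a b -> ccont2 F' x t) ->
  (forall t, Rmin a b <= t <= Rmax a b ->
     locally_2d (fun u v => cd (fun z => F z v) u (F' u v)) x t) ->
  cd (fun y => CI (F y) a b) x (CI (F' x) a b).
Proof.
  intros Hd HD HC H2 HL.
  assert (HLx : locally x (fun y => Rabs (y - x) < d)).
  { exists (mkposreal d Hd). intros y Hy. exact Hy. }
  assert (Hx : Rabs (x - x) < d) by (rewrite Rminus_diag, Rabs_R0; exact Hd).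
  split; simpl.
  - replace (RInt (fun t => fst (F' x t)) a b)
      with (RInt (fun t => Derive (fun u => fst (F u t)) x) a b).
    2:{ apply RInt_ext. intros t Ht. apply is_derive_unique. apply (HD x t); [exact Hx | lra]. }
    apply (is_derive_RInt_param (fun y t => fst (F y t))).
    + eapply filter_imp; [|exact HLx]. intros y Hy t Ht. eexists. exact (proj1 (HD y t Hy Ht)).
    + intros t Ht. eapply continuity_2d_pt_ext_loc; [|exact (ccont2_fst _ _ _ (H2 t Ht))].
      generalize (HL t Ht). apply locally_2d_impl. apply locally_2d_forall.
      intros u v Huv. symmetry. apply is_derive_unique. exact (proj1 Huv).
    + eapply filter_imp; [|exact HLx]. intros y Hy. apply (ccont_ex_RInt_fst (F y)). intros t Ht; apply (HC y t Hy Ht).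
  - replace (RInt (fun t => snd (F' x t)) a b)
      with (RInt (fun t => Derive (fun u => snd (F u t)) x) a b).
    2:{ apply RInt_ext. intros t Ht. apply is_derive_unique. apply (HD x t); [exact Hx | lra]. }
    apply (is_derive_RInt_param (fun y t => snd (F y t))).
    + eapply filter_imp; [|exact HLx]. intros y Hy t Ht. eexists. exact (proj2 (HD y t Hy Ht)).
    + intros t Ht. eapply continuity_2d_pt_ext_loc; [|exact (ccont2_snd _ _ _ (H2 t Ht))].
      generalize (HL t Ht). apply locally_2d_impl. apply locally_2d_forall.
      intros u v Huv. symmetry. apply is_derive_unique. exact (proj2 Huv).
    + eapply filter_imp; [|exact HLx]. intros y Hy. apply (ccont_ex_RInt_snd (F y)). intros t Ht; apply (HC y t Hy Ht).
Qed.
(** * Cauchy's theorem and residues in the logarithmic coordinate *)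

(** The counterclockwise integral of G(w) dw around the rectangle [a, b] x [c, d]; on vertical sides
    dw = i dv. *)
Definition RB (G : CC -> CC) (a b c d : R) : CC :=
  (CI (fun u => G (u, c)) a b + Ci * CI (fun v => G (b, v)) c d
   - CI (fun u => G (u, d)) a b - Ci * CI (fun v => G (a, v)) c d)%C.

(** By the Cauchy-Riemann equations the derivative in y of the integral of G(u + iy) over u in
    [a, b] is i (G(b + iy) - G(a + iy)). Integrating this over y in [c, d] gives the claim. The
    margin [eta] provides the neighbourhoods that differentiation under the integral requires. *)
Lemma Cauchy_rectangle (G G' : CC -> CC) (a b c d eta : R) :
  a <= b -> c <= d -> 0 < eta ->
  (forall u v, a - eta < u < b + eta -> c - eta < v < d + eta ->
     cd (fun y => G (y, v)) u (G' (u, v)) /\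
     cd (fun y => G (u, y)) v (Ci * G' (u, v))%C /\
     ccont (fun y => G' (y, v)) u /\
     ccont2 (fun y x => (Ci * G' (x, y))%C) v u) ->
  RB G a b c d = 0.
Proof.
  intros Hab Hcd He H.
  assert (D : forall v, c <= v <= d ->
     cd (fun y => CI (fun u => G (u, y)) a b) v (Ci * (G (b, v) - G (a, v)))%C).
  { intros v Hv.
    apply cd_eq with (CI (fun u => Ci * G' (u, v))%C a b).
    { rewrite CI_scal.
      - f_equal. apply (CI_derive (fun u => G (u, v))); intros u Hu;
          rewrite Rmin_left, Rmax_right in Hu by lra; apply (H u v); lra.
      - intros u Hu; rewrite Rmin_left, Rmax_right in Hu by lra. apply (H u v); lra. }
    apply (CI_param_derive (fun y u => G (u, y)) (fun y u => Ci * G' (u, y))%C) with eta; auto.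
    - intros y u Hy Hu; rewrite Rmin_left, Rmax_right in Hu by lra. apply Rabs_def2 in Hy.
      apply (H u y); lra.
    - intros y u Hy Hu; rewrite Rmin_left, Rmax_right in Hu by lra. apply Rabs_def2 in Hy.
      eapply cd_ccont. apply (H u y); lra.
    - intros u Hu; rewrite Rmin_left, Rmax_right in Hu by lra. apply (H u v); lra.
    - intros u Hu; rewrite Rmin_left, Rmax_right in Hu by lra.
      exists (mkposreal eta He). intros y x Hy Hx; simpl in Hy, Hx.
      apply Rabs_def2 in Hy; apply Rabs_def2 in Hx. apply (H x y); lra. }
  assert (Cb : forall v, Rmin c d <= v <= Rmax c d -> ccont (fun v => G (b, v)) v).
  { intros v Hv; rewrite Rmin_left, Rmax_right in Hv by lra. eapply cd_ccont. apply (H b v); lra. }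
  assert (Ca : forall v, Rmin c d <= v <= Rmax c d -> ccont (fun v => (- (1)) * G (a, v))%C v).
  { intros v Hv; rewrite Rmin_left, Rmax_right in Hv by lra.
    apply ccont_cmult. eapply cd_ccont. apply (H a v); lra. }
  assert (E : CI (fun v => Ci * (G (b, v) + (- (1)) * G (a, v)))%C c d =
    (CI (fun u => G (u, d)) a b - CI (fun u => G (u, c)) a b)%C).
  { apply (CI_derive (fun y => CI (fun u => G (u, y)) a b)).
    - intros v Hv; rewrite Rmin_left, Rmax_right in Hv by lra.
      eapply cd_eq; [|apply D; lra]. ring.
    - intros v Hv. apply ccont_cmult.
      apply ccont_plus; auto. }
  rewrite CI_scal in E by (intros; apply ccont_plus; auto).
  rewrite CI_plus in E by auto.
  rewrite CI_scal in E.
  2:{ intros v Hv; rewrite Rmin_left, Rmax_right in Hv by lra. eapply cd_ccont. apply (H a v); lra. }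
  unfold RB.
  replace (CI (fun u => G (u, d)) a b) with
    ((CI (fun u => G (u, d)) a b - CI (fun u => G (u, c)) a b) + CI (fun u => G (u, c)) a b)%C by ring.
  rewrite <- E. ring.
Qed.

(** The primitive is needed on the four sides only, so G may have poles inside. This is what makes
    the residue recursion for multiple poles possible. *)
Lemma RB_derive (G G' : CC -> CC) (a b c d : R) :
  a <= b -> c <= d ->
  (forall u v, a <= u <= b -> c <= v <= d -> (u = a \/ u = b \/ v = c \/ v = d) ->
     cd (fun y => G (y, v)) u (G' (u, v)) /\
     cd (fun y => G (u, y)) v (Ci * G' (u, v))%C /\
     ccont (fun y => G' (y, v)) u /\
     ccont (fun y => G' (u, y)) v) ->
  RB G' a b c d = 0.
Proof.
  intros Hab Hcd H. unfold RB.
  assert (Hu : forall v, v = c \/ v = d ->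
     CI (fun u => G' (u, v)) a b = (G (b, v) - G (a, v))%C).
  { intros v Hv. apply (CI_derive (fun u => G (u, v))); intros u Hu;
      rewrite Rmin_left, Rmax_right in Hu by lra; apply (H u v); lra. }
  assert (Hv : forall u, u = a \/ u = b ->
     (Ci * CI (fun v => G' (u, v)) c d = G (u, d) - G (u, c))%C).
  { intros u Hu'. rewrite <- CI_scal.
    - apply (CI_derive (fun v => G (u, v))); intros v Hv;
        rewrite Rmin_left, Rmax_right in Hv by lra.
      + apply (H u v); lra.
      + apply ccont_cmult. apply (H u v); lra.
    - intros v Hv; rewrite Rmin_left, Rmax_right in Hv by lra. apply (H u v); lra. }
  rewrite !Hu, !Hv by auto. ring.
Qed.

(* With p = exp w this is exp (t p) p^gam / (p^al - lam)^m, read in the logarithmic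
   coordinate w, where p^al is entire and sectors become rectangles. *)
Definition Phi (al : R) (lam : CC) (t gam : R) (m : nat) (w : CC) : CC :=
  (Cexp (RtoC t * Cexp w + RtoC gam * w) * (/ (Cexp (RtoC al * w) - lam)) ^ m)%C.

(** The derivative of [Phi] in w, written with shifted [Phi] again: each factor p or p^al is
    absorbed into the exponent [gam]. *)
Definition dPhi (al : R) (lam : CC) (t gam : R) (m : nat) (w : CC) : CC :=
  (RtoC t * Phi al lam t (gam + 1) m w + RtoC gam * Phi al lam t gam m w
   - RtoC (INR m * al) * Phi al lam t (gam + al) (S m) w)%C.

(** For m = 0 the denominator is absent and no point is excluded; Hankel's integrand is this entire
    case. *)
Definition Reg (al : R) (lam : CC) (m : nat) (w : CC) : Prop :=
  m = 0%nat \/ Cexp (RtoC al * w)%C <> lam.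

Lemma Phi_shift al lam t gam be m w :
  (Cexp (RtoC be * w) * Phi al lam t gam m w)%C = Phi al lam t (gam + be) m w.
Proof.
  unfold Phi. rewrite RtoC_plus.
  replace (RtoC t * Cexp w + (RtoC gam + RtoC be) * w)%C
    with (RtoC be * w + (RtoC t * Cexp w + RtoC gam * w))%C by ring.
  rewrite (Cexp_plus (RtoC be * w)). ring.
Qed.

Lemma cd_Phi al lam t gam m (p : R -> CC) x del :
  Reg al lam m (p x) -> cd p x del ->
  cd (fun y => Phi al lam t gam m (p y)) x (del * dPhi al lam t gam m (p x))%C.
Proof.
  intros HR Hp.
  assert (D1 := cd_exp _ _ _ Hp).
  assert (D2 := cd_exp _ _ _ (cd_plus _ _ _ _ _ (cd_cmult (RtoC t) _ _ _ D1) (cd_cmult (RtoC gam) _ _ _ Hp))).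
  assert (E1 : forall m, (Cexp (p x) * Phi al lam t gam m (p x))%C = Phi al lam t (gam + 1) m (p x)).
  { intros k. rewrite <- Phi_shift. f_equal. f_equal. ring. }
  unfold dPhi. rewrite <- E1, <- (Phi_shift _ _ _ _ al).
  destruct HR as [->|HR].
  - unfold Phi. simpl.
    eapply cd_ext; [intros y; symmetry; apply Cmult_1_r|].
    eapply cd_eq; [|exact D2]. rewrite Rmult_0_l. ring.
  - apply Cminus_eq_contra in HR.
    assert (D3 := cd_plus _ _ _ _ _ (cd_exp _ _ _ (cd_cmult (RtoC al) _ _ _ Hp)) (cd_const (- lam)%C x)).
    assert (D4 := cd_pow _ _ _ m (cd_inv _ _ _ HR D3)).
    assert (D5 := cd_mult _ _ _ _ _ D2 D4).
    eapply cd_eq; [|exact D5].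
    unfold Phi. cbv beta.
    change (Cexp (RtoC al * p x) + - lam)%C with (Cexp (RtoC al * p x) - lam)%C.
    set (A := Cexp (RtoC t * Cexp (p x) + RtoC gam * p x)%C).
    set (Q := Cexp (RtoC al * p x)%C) in *.
    rewrite RtoC_mult. destruct m as [|m]; [simpl; ring|].
    simpl (S m - 1)%nat. rewrite Nat.sub_0_r, !Cpow_S. ring.
Qed.

Lemma ccont_Phi_t {U : UniformSpace} al lam (tt : U -> R) gam m (p : U -> CC) x :
  continuous tt x -> Reg al lam m (p x) -> ccont p x ->
  ccont (fun y => Phi al lam (tt y) gam m (p y)) x.
Proof.
  intros Ht HR Hp. unfold Phi. apply ccont_mult.
  - apply ccont_exp, ccont_plus.
    + apply ccont_mult; [apply ccont_RtoC; exact Ht | apply ccont_exp; exact Hp].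
    + apply ccont_mult; [apply ccont_const | exact Hp].
  - destruct HR as [->|HR]; [apply ccont_const|].
    apply ccont_pow. apply ccont_inv; [apply Cminus_eq_contra; exact HR|].
    apply ccont_plus; [|apply ccont_const].
    apply ccont_exp. apply ccont_mult; [apply ccont_const|exact Hp].
Qed.

Lemma ccont_Phi {U : UniformSpace} al lam t gam m (p : U -> CC) x :
  Reg al lam m (p x) -> ccont p x -> ccont (fun y => Phi al lam t gam m (p y)) x.
Proof. intros. apply (ccont_Phi_t al lam (fun _ => t)); auto. apply continuous_const. Qed.

Lemma Reg_S al lam m w : Reg al lam m w -> m <> 0%nat -> Reg al lam (S m) w.
Proof. intros [->|H] N; [congruence | right; exact H]. Qed.

Lemma ccont_dPhi {U : UniformSpace} al lam t gam m (p : U -> CC) x :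
  Reg al lam m (p x) -> ccont p x -> ccont (fun y => dPhi al lam t gam m (p y)) x.
Proof.
  intros HR Hp. unfold dPhi.
  apply ccont_plus; [apply ccont_plus|].
  - apply ccont_cmult; apply ccont_Phi; auto.
  - apply ccont_cmult; apply ccont_Phi; auto.
  - destruct m as [|m].
    + apply ccont_ext_loc with (fun _ => RtoC 0); [|apply ccont_const].
      apply filter_forall. intros y. simpl INR. rewrite Rmult_0_l. ring.
    + apply ccont_ext_loc with
        (fun y => RtoC (- (INR (S m) * al)) * Phi al lam t (gam + al) (S (S m)) (p y))%C.
      * apply filter_forall. intros y. rewrite RtoC_opp. ring.
      * apply ccont_cmult; apply ccont_Phi; auto. apply Reg_S; auto.
Qed.

Lemma cd_line_u v u : cd (fun y => (y, v)) u 1.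
Proof. split; simpl; [apply (is_derive_id u) | apply (is_derive_const (V:=R_NormedModule))]. Qed.

Lemma cd_line_v u v : cd (fun y => (u, y)) v Ci.
Proof. split; simpl; [apply (is_derive_const (V:=R_NormedModule)) | apply (is_derive_id v)]. Qed.

Lemma Phi_Cauchy al lam t gam m a b c d eta :
  a <= b -> c <= d -> 0 < eta ->
  (forall u v, a - eta < u < b + eta -> c - eta < v < d + eta -> Reg al lam m (u, v)) ->
  RB (Phi al lam t gam m) a b c d = 0.
Proof.
  intros Hab Hcd He HR.
  apply Cauchy_rectangle with (dPhi al lam t gam m) eta; auto.
  intros u v Hu Hv. specialize (HR u v Hu Hv).
  split; [|split; [|split]].
  - pose proof (cd_Phi al lam t gam m (fun y => (y, v)) u 1 HR (cd_line_u v u)) as H.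
    rewrite Cmult_1_l in H; apply H.
  - apply (cd_Phi al lam t gam m (fun y => (u, y)) v Ci HR (cd_line_v u v)).
  - apply (ccont_dPhi al lam t gam m (fun y => (y, v)) u HR (cd_ccont _ _ _ (cd_line_u v u))).
  - unfold ccont2.
    apply (ccont_mult (U := prod_UniformSpace R_UniformSpace R_UniformSpace));
       [apply ccont_const|].
    apply (ccont_dPhi (U := prod_UniformSpace R_UniformSpace R_UniformSpace) al lam t gam m
          (fun p => (snd p, fst p))); [exact HR|].
    split; simpl; [apply (@continuous_snd R_UniformSpace R_UniformSpace)
                  |apply (@continuous_fst R_UniformSpace R_UniformSpace)].
Qed.

Lemma RB_dPhi al lam t gam m a b c d :
  a <= b -> c <= d ->
  (forall u v, a <= u <= b -> c <= v <= d -> (u = a \/ u = b \/ v = c \/ v = d) ->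
     Reg al lam m (u, v)) ->
  RB (dPhi al lam t gam m) a b c d = 0.
Proof.
  intros Hab Hcd HR.
  apply RB_derive with (Phi al lam t gam m); auto.
  intros u v Hu Hv Hb. specialize (HR u v Hu Hv Hb).
  split; [|split; [|split]].
  - pose proof (cd_Phi al lam t gam m (fun y => (y, v)) u 1 HR (cd_line_u v u)) as H.
    rewrite Cmult_1_l in H; apply H.
  - apply (cd_Phi al lam t gam m (fun y => (u, y)) v Ci HR (cd_line_v u v)).
  - apply (ccont_dPhi al lam t gam m (fun y => (y, v)) u HR (cd_ccont _ _ _ (cd_line_u v u))).
  - apply (ccont_dPhi al lam t gam m (fun y => (u, y)) v HR (cd_ccont _ _ _ (cd_line_v u v))).
Qed.

Lemma ccont_Phi_u al lam t gam m u v :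
  Reg al lam m (u, v) -> ccont (fun y => Phi al lam t gam m (y, v)) u.
Proof. intros H. apply (ccont_Phi al lam t gam m (fun y => (y, v)) u H (cd_ccont _ _ _ (cd_line_u v u))). Qed.

Lemma ccont_Phi_v al lam t gam m u v :
  Reg al lam m (u, v) -> ccont (fun y => Phi al lam t gam m (u, y)) v.
Proof. intros H. apply (ccont_Phi al lam t gam m (fun y => (u, y)) v H (cd_ccont _ _ _ (cd_line_v u v))). Qed.

(** * Residues of [Phi] at simple and multiple poles *)

Lemma Cexp_sub_1_bound (z : CC) : Cmod (Cexp z - 1)%C <= Cmod z * exp (Cmod z).
Proof.
  assert (D : forall s, cd (fun s => Cexp (RtoC s * z)%C) s (z * Cexp (RtoC s * z))%C).
  { intros s. apply (cd_exp (fun s => RtoC s * z)%C).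
    eapply cd_ext; [intros y; apply Cmult_comm|].
    eapply cd_eq; [|apply (cd_cmult z RtoC s 1)]; [ring|].
    split; simpl; [apply (is_derive_id s) | apply (is_derive_const (V:=R_NormedModule))]. }
  assert (Cc : forall s, ccont (fun s => z * Cexp (RtoC s * z))%C s).
  { intros s. apply ccont_mult; [apply ccont_const | eapply cd_ccont; apply D]. }
  replace (Cexp z - 1)%C with (CI (fun s => z * Cexp (RtoC s * z))%C 0 1).
  - replace (Cmod z * exp (Cmod z)) with (Cmod z * exp (Cmod z) * (1 - 0)) by ring.
    apply CI_bound_const; [lra | auto |].
    intros s Hs. rewrite Cmod_mult, Cmod_Cexp.
    apply Rmult_le_compat_l; [apply Cmod_ge_0|].
    assert (fst (RtoC s * z)%C <= Cmod z).
    { simpl. pose proof (abs_fst_le_Cmod z). pose proof (Cmod_ge_0 z).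
      pose proof (Rle_abs (fst z)). nra. }
    destruct H as [H|H]; [left; apply exp_increasing; exact H | rewrite H; lra].
  - rewrite (CI_derive (fun s => Cexp (RtoC s * z)%C)) by (intros; auto).
    rewrite Cmult_1_l, Cmult_0_l, Cexp_0. reflexivity.
Qed.

Lemma exp_le (x y : R) : x <= y -> exp x <= exp y.
Proof. intros [H|H]; [left; apply exp_increasing; exact H | rewrite H; lra]. Qed.

Lemma Cexp_sub_1_sub_bound (z : CC) :
  Cmod z <= 1 -> Cmod (Cexp z - 1 - z)%C <= 3 * Cmod z ^ 2.
Proof.
  intros Hz.
  assert (D : forall s, cd (fun s => Cexp (RtoC s * z) - RtoC s * z)%C s (z * (Cexp (RtoC s * z) - 1))%C).
  { intros s.
    assert (D0 : cd (fun s => RtoC s * z)%C s z).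
    { eapply cd_ext; [intros y; apply Cmult_comm|].
      eapply cd_eq; [|apply (cd_cmult z RtoC s 1)]; [ring|].
      split; simpl; [apply (is_derive_id s) | apply (is_derive_const (V:=R_NormedModule))]. }
    eapply cd_ext with (fun s => Cexp (RtoC s * z) + (- (1)) * (RtoC s * z))%C; [intros; ring|].
    eapply cd_eq; [|apply cd_plus; [apply cd_exp; exact D0 | apply cd_cmult; exact D0]]. cbv beta. ring. }
  assert (Cc : forall s, ccont (fun s => z * (Cexp (RtoC s * z) - 1))%C s).
  { intros s. apply ccont_cmult. apply ccont_plus; [|apply ccont_const].
    apply ccont_exp. apply ccont_mult; [|apply ccont_const]. apply ccont_RtoC. apply continuous_id. }
  replace (Cexp z - 1 - z)%C with (CI (fun s => z * (Cexp (RtoC s * z) - 1))%C 0 1).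
  - replace (3 * Cmod z ^ 2) with (3 * Cmod z ^ 2 * (1 - 0)) by ring.
    apply CI_bound_const; [lra | auto |].
    intros s Hs. rewrite Cmod_mult.
    pose proof (Cexp_sub_1_bound (RtoC s * z)) as HB.
    rewrite Cmod_mult, Cmod_R, Rabs_right in HB by lra.
    pose proof (Cmod_ge_0 z).
    assert (exp (s * Cmod z) <= 3) by (eapply Rle_trans; [apply exp_le with (y := 1); nra | apply exp_le_3]).
    pose proof (exp_pos (s * Cmod z)).
    assert (s * Cmod z <= Cmod z) by nra.
    assert (s * Cmod z * exp (s * Cmod z) <= Cmod z * 3) by (apply Rmult_le_compat; nra).
    nra.
  - rewrite (CI_derive (fun s => Cexp (RtoC s * z) - RtoC s * z)%C) by (intros; auto).
    rewrite Cmult_1_l, Cmult_0_l, Cexp_0. ring.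
Qed.

Lemma cos_eq_1 (x : R) : Rabs x < 2 * PI -> cos x = 1 -> x = 0.
Proof.
  intros Hx Hc. apply Rabs_def2 in Hx.
  assert (Hs : sin (x / 2) = 0).
  { replace x with (2 * (x / 2)) in Hc by field. rewrite cos_2a_sin in Hc. nra. }
  destruct (Rtotal_order x 0) as [H|[H|H]]; [|exact H|].
  - pose proof (sin_gt_0 (- (x / 2))) as P. rewrite sin_neg in P. lra.
  - pose proof (sin_gt_0 (x / 2)). lra.
Qed.

(** In the coordinate w the solutions of p^al = lam are w0 + 2 pi i k / al, and the open strip of
    half-width 2 pi / al around w0 contains only k = 0. *)
Lemma Reg_strip al (u0 v0 u v : R) m :
  0 < al -> Rabs (al * (v - v0)) < 2 * PI -> (u <> u0 \/ v <> v0) ->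
  Reg al (Cexp (RtoC al * (u0, v0))%C) m (u, v).
Proof.
  intros Ha Hv Hne. right. intros E.
  assert (E1 : Cexp (RtoC al * (u - u0, v - v0)%R)%C = 1).
  { replace (RtoC al * (u - u0, v - v0)%R)%C with (RtoC al * (u, v) + - (RtoC al * (u0, v0)))%C
      by (apply C_ext; simpl; ring).
    rewrite Cexp_plus, Cexp_opp, E. field. apply Cexp_neq_0. }
  assert (E2 : exp (al * (u - u0)) = 1).
  { replace (al * (u - u0)) with (fst (RtoC al * (u - u0, v - v0)%R)%C) by (simpl; ring).
    rewrite <- Cmod_Cexp, E1, Cmod_1. reflexivity. }
  assert (Hu : al * (u - u0) = 0) by (apply exp_inv; rewrite E2, exp_0; reflexivity).
  assert (Hc : cos (al * (v - v0)) = 1).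
  { apply (f_equal fst) in E1. unfold Cexp in E1; simpl in E1.
    replace (al * (u - u0) - 0 * (v - v0)) with (al * (u - u0)) in E1 by ring.
    replace (al * (v - v0) + 0 * (u - u0)) with (al * (v - v0)) in E1 by ring.
    rewrite E2 in E1. lra. }
  apply cos_eq_1 in Hc; [|exact Hv]. destruct Hne as [N|N]; apply N; nra.
Qed.

Lemma RB_split_u (G : CC -> CC) a e b c d :
  a <= e <= b ->
  (forall u, a <= u <= b -> ccont (fun y => G (y, c)) u) ->
  (forall u, a <= u <= b -> ccont (fun y => G (y, d)) u) ->
  RB G a b c d = (RB G a e c d + RB G e b c d)%C.
Proof.
  intros He H1 H2. unfold RB.
  rewrite <- (CI_Chasles (fun u => G (u, c)) a e b);
    try (intros u Hu; apply H1; rewrite Rmin_left, Rmax_right in Hu; lra).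
  rewrite <- (CI_Chasles (fun u => G (u, d)) a e b);
    try (intros u Hu; apply H2; rewrite Rmin_left, Rmax_right in Hu; lra).
  ring.
Qed.

Lemma RB_split_v (G : CC -> CC) a b c e d :
  c <= e <= d ->
  (forall v, c <= v <= d -> ccont (fun y => G (a, y)) v) ->
  (forall v, c <= v <= d -> ccont (fun y => G (b, y)) v) ->
  RB G a b c d = (RB G a b c e + RB G a b e d)%C.
Proof.
  intros He H1 H2. unfold RB.
  rewrite <- (CI_Chasles (fun v => G (a, v)) c e d);
    try (intros u Hu; apply H1; rewrite Rmin_left, Rmax_right in Hu; lra).
  rewrite <- (CI_Chasles (fun v => G (b, v)) c e d);
    try (intros u Hu; apply H2; rewrite Rmin_left, Rmax_right in Hu; lra).
  ring.
Qed.

Lemma RB_plus (G H : CC -> CC) a b c d :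
  a <= b -> c <= d ->
  (forall u v, a <= u <= b -> (v = c \/ v = d) ->
     ccont (fun y => G (y, v)) u /\ ccont (fun y => H (y, v)) u) ->
  (forall u v, c <= v <= d -> (u = a \/ u = b) ->
     ccont (fun y => G (u, y)) v /\ ccont (fun y => H (u, y)) v) ->
  RB (fun w => G w + H w)%C a b c d = (RB G a b c d + RB H a b c d)%C.
Proof.
  intros Hab Hcd Hu Hv. unfold RB.
  rewrite !(CI_plus (fun u => G (u, _)) (fun u => H (u, _)) a b);
    try (intros u Hx; rewrite Rmin_left, Rmax_right in Hx by lra; apply Hu; auto).
  rewrite !(CI_plus (fun v => G (_, v)) (fun v => H (_, v)) c d);
    try (intros u Hx; rewrite Rmin_left, Rmax_right in Hx by lra; apply Hv; auto).
  ring.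
Qed.

Lemma RB_scal (k : CC) (G : CC -> CC) a b c d :
  a <= b -> c <= d ->
  (forall u v, a <= u <= b -> (v = c \/ v = d) -> ccont (fun y => G (y, v)) u) ->
  (forall u v, c <= v <= d -> (u = a \/ u = b) -> ccont (fun y => G (u, y)) v) ->
  RB (fun w => k * G w)%C a b c d = (k * RB G a b c d)%C.
Proof.
  intros Hab Hcd Hu Hv. unfold RB.
  rewrite !(CI_scal k (fun u => G (u, _)) a b);
    try (intros u Hx; rewrite Rmin_left, Rmax_right in Hx by lra; apply Hu; auto).
  rewrite !(CI_scal k (fun v => G (_, v)) c d);
    try (intros u Hx; rewrite Rmin_left, Rmax_right in Hx by lra; apply Hv; auto).
  ring.
Qed.

Lemma RB_bound (G : CC -> CC) M a b c d :
  a <= b -> c <= d ->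
  (forall u v, a <= u <= b -> (v = c \/ v = d) -> ccont (fun y => G (y, v)) u) ->
  (forall u v, c <= v <= d -> (u = a \/ u = b) -> ccont (fun y => G (u, y)) v) ->
  (forall u v, a <= u <= b -> c <= v <= d -> (u = a \/ u = b \/ v = c \/ v = d) -> Cmod (G (u, v)) <= M) ->
  Cmod (RB G a b c d) <= M * (2 * (b - a) + 2 * (d - c)).
Proof.
  intros Hab Hcd Hu Hv HM. unfold RB.
  assert (B1 : Cmod (CI (fun u => G (u, c)) a b) <= M * (b - a)).
  { apply CI_bound_const; auto. intros; apply HM; try lra; auto. }
  assert (B2 : Cmod (CI (fun u => G (u, d)) a b) <= M * (b - a)).
  { apply CI_bound_const; auto. intros; apply HM; try lra; auto. }
  assert (B3 : Cmod (CI (fun u => G (a, u)) c d) <= M * (d - c)).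
  { apply CI_bound_const; auto. intros; apply HM; try lra; auto. }
  assert (B4 : Cmod (CI (fun u => G (b, u)) c d) <= M * (d - c)).
  { apply CI_bound_const; auto. intros; apply HM; try lra; auto. }
  eapply Rle_trans; [apply Cmod_triangle|].
  eapply Rle_trans; [apply Rplus_le_compat_r, Cmod_triangle|].
  eapply Rle_trans; [apply Rplus_le_compat_r, Rplus_le_compat_r, Cmod_triangle|].
  rewrite !Cmod_opp, !Cmod_mult, Cmod_Ci. lra.
Qed.

Lemma sum_sqr_pos_neq (x e : R) : 0 < e -> x ^ 2 + e ^ 2 <> 0.
Proof. intros H. apply Rgt_not_eq. pose proof (pow2_ge_0 x). pose proof (pow_lt e 2 H). lra. Qed.

(** Opposite sides are added: one component cancels and the other becomes 2 eps / (x^2 + eps^2),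
    with primitive 2 atan (x / eps). Each pair contributes pi i in the end. *)
Lemma RB_inv_square u0 v0 eps : 0 < eps ->
  RB (fun w => / (w - (u0, v0)))%C (u0 - eps) (u0 + eps) (v0 - eps) (v0 + eps)
  = (RtoC (2 * PI) * Ci)%C.
Proof.
  intros He.
  assert (NZ : forall u v, (u <> u0 \/ v <> v0) -> ((u, v) - (u0, v0))%C <> 0).
  { intros u v N. apply Cminus_eq_contra. intros E. inversion E; subst. destruct N; auto. }
  assert (Cu : forall u v, v <> v0 -> ccont (fun y => / ((y, v) - (u0, v0)))%C u).
  { intros u v N. apply (ccont_inv (fun y => (y, v) - (u0, v0))%C); [apply NZ; auto|].
    apply (ccont_plus (fun y => (y, v))); [|apply ccont_const]. eapply cd_ccont, cd_line_u. }
  assert (Cv : forall u v, u <> u0 -> ccont (fun y => / ((u, y) - (u0, v0)))%C v).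
  { intros u v N. apply (ccont_inv (fun y => (u, y) - (u0, v0))%C); [apply NZ; auto|].
    apply (ccont_plus (fun y => (u, y))); [|apply ccont_const]. eapply cd_ccont, cd_line_v. }
  assert (DA : forall x0 y : R, is_derive (fun x => 2 * atan ((x - x0) / eps)) y
                 (2 * eps / ((y - x0)^2 + eps^2))).
  { intros x0 y. assert ((y - x0)^2 + eps^2 <> 0) by (apply sum_sqr_pos_neq; exact He).
    auto_derive; [exact I|]. field. split; [exact H | lra]. }
  assert (DC : forall x0 y : R, continuous (fun y => 2 * eps / ((y - x0)^2 + eps^2)) y).
  { intros x0 y. apply (ex_derive_continuous (V:=R_NormedModule)).
    assert ((y - x0)^2 + eps^2 <> 0) by (apply sum_sqr_pos_neq; exact He). auto_derive. exact H. }
  assert (A1 : 2 * atan ((u0 + eps - u0) / eps) = PI / 2).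
  { replace ((u0 + eps - u0) / eps) with 1 by (field; lra). rewrite atan_1. field. }
  assert (A2 : 2 * atan ((u0 - eps - u0) / eps) = - (PI / 2)).
  { replace ((u0 - eps - u0) / eps) with (- (1)) by (field; lra). rewrite atan_opp, atan_1. field. }
  assert (A3 : 2 * atan ((v0 + eps - v0) / eps) = PI / 2).
  { replace ((v0 + eps - v0) / eps) with 1 by (field; lra). rewrite atan_1. field. }
  assert (A4 : 2 * atan ((v0 - eps - v0) / eps) = - (PI / 2)).
  { replace ((v0 - eps - v0) / eps) with (- (1)) by (field; lra). rewrite atan_opp, atan_1. field. }
  assert (H1 : (CI (fun u => / ((u, v0 - eps)%R - (u0, v0))) (u0 - eps) (u0 + eps)
     + CI (fun u => (- (1)) * / ((u, v0 + eps)%R - (u0, v0))) (u0 - eps) (u0 + eps))%C = (RtoC PI * Ci)%C).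
  { rewrite <- CI_plus.
    - rewrite CI_ext with (g := fun x => (0, 2 * eps / ((x - u0)^2 + eps^2))).
      2:{ intros x _. assert ((x - u0)^2 + eps^2 <> 0) by (apply sum_sqr_pos_neq; exact He).
          apply C_ext; simpl; field; repeat split; intros E; apply H; (eapply eq_trans; [|exact E]); ring. }
      rewrite (CI_derive (fun x => (0, 2 * atan ((x - u0) / eps)))).
      + rewrite A1, A2. apply C_ext; simpl; field.
      + intros x _. split; [apply (is_derive_const (V:=R_NormedModule) 0) | apply DA].
      + intros x _. split; [apply continuous_const | apply DC].
    - intros. apply Cu. lra.
    - intros. apply ccont_cmult; apply Cu; lra. }
  assert (H2 : (CI (fun v => / ((u0 + eps, v)%R - (u0, v0))) (v0 - eps) (v0 + eps)
     + CI (fun v => (- (1)) * / ((u0 - eps, v)%R - (u0, v0))) (v0 - eps) (v0 + eps))%C = RtoC PI).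
  { rewrite <- CI_plus.
    - rewrite CI_ext with (g := fun x => (2 * eps / ((x - v0)^2 + eps^2), 0)).
      2:{ intros x _. assert ((x - v0)^2 + eps^2 <> 0) by (apply sum_sqr_pos_neq; exact He).
          apply C_ext; simpl; field; repeat split; intros E; apply H; (eapply eq_trans; [|exact E]); ring. }
      rewrite (CI_derive (fun x => (2 * atan ((x - v0) / eps), 0))).
      + rewrite A3, A4. apply C_ext; simpl; field.
      + intros x _. split; [apply DA | apply (is_derive_const (V:=R_NormedModule) 0)].
      + intros x _. split; [apply DC | apply continuous_const].
    - intros. apply Cv. lra.
    - intros. apply ccont_cmult; apply Cv; lra. }
  rewrite CI_scal in H1 by (intros; apply Cu; lra).
  rewrite CI_scal in H2 by (intros; apply Cv; lra).
  unfold RB. rewrite RtoC_mult.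
  transitivity (RtoC PI * Ci + Ci * RtoC PI)%C; [rewrite <- H1, <- H2 at 1|]; ring.
Qed.
Lemma RtoC_neq (x : R) : x <> 0 -> RtoC x <> 0.
Proof. intros H E. apply H, RtoC_inj, E. Qed.

Lemma Phi_near_pole al (w0 : CC) t gam :
  0 < al -> forall del, 0 < del -> exists e0, 0 < e0 /\ forall u v,
    (u, v) <> w0 -> Rabs (u - fst w0) < e0 -> Rabs (v - snd w0) < e0 ->
    Cmod (((u, v) - w0) * Phi al (Cexp (RtoC al * w0)) t gam 1 (u, v)
          - Cexp (RtoC t * Cexp w0 + RtoC gam * w0) / (RtoC al * Cexp (RtoC al * w0)))%C <= del.
Proof.
  intros Ha del Hd.
  set (h := fun w : CC => Cexp (RtoC t * Cexp w + RtoC gam * w)%C).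
  set (lam := Cexp (RtoC al * w0)%C).
  assert (Hlam : 0 < Cmod lam) by (apply Cmod_gt_0, Cexp_neq_0).
  assert (Hh : continuous (T := prod_UniformSpace R_UniformSpace R_UniformSpace) (U := R_UniformSpace)
                 (fun w => Cmod (h w - h w0)%C) (fst w0, snd w0)).
  { apply (continuous_Cmod (U := prod_UniformSpace R_UniformSpace R_UniformSpace)).
    assert (Hid : ccont (U := prod_UniformSpace R_UniformSpace R_UniformSpace) (fun w => w) (fst w0, snd w0)).
    { split; [apply (@continuous_fst R_UniformSpace R_UniformSpace)
             |apply (@continuous_snd R_UniformSpace R_UniformSpace)]. }
    apply ccont_plus; [|apply ccont_const]. unfold h.
    apply ccont_exp, ccont_plus; (apply ccont_mult; [apply ccont_const|]); auto.
    apply ccont_exp; auto. }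
  (* The final estimate is 2 d1 |z| / (al |lam| |z| / 2) = 4 d1 / (al |lam|), which is [del] for
     this value. *)
  set (d1 := del * (Cmod lam * al) / 4).
  assert (Hd1 : 0 < d1) by (unfold d1; apply Rdiv_lt_0_compat; [|lra]; repeat apply Rmult_lt_0_compat; lra).
  destruct (proj1 (filterlim_locally _ _) Hh (mkposreal d1 Hd1)) as [e1 He1].
  pose proof (Cmod_ge_0 (h w0)) as Hh0.
  (* With z = al (w - w0) this gives |z| <= 1/6, hence |exp z - 1| >= |z| / 2 after the quadratic
     remainder is subtracted, and also 3 |h(w0)| |z| <= d1. *)
  set (e2 := Rmin (/ 6) (d1 / (3 * Cmod (h w0) + 1)) / (2 * al)).
  assert (He2 : 0 < e2).
  { unfold e2. apply Rdiv_lt_0_compat; [|lra]. apply Rmin_glb_lt; [lra|]. apply Rdiv_lt_0_compat; lra. }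
  exists (Rmin e1 e2). split; [apply Rmin_glb_lt; [apply (cond_pos e1) | exact He2]|].
  intros u v Hne Hu Hv.
  assert (Hh1 : Cmod (h (u, v) - h w0)%C < d1).
  { specialize (He1 (u, v)).
    assert (B : ball (M := prod_UniformSpace R_UniformSpace R_UniformSpace) (fst w0, snd w0) e1 (u, v)).
    { split; simpl; unfold ball; simpl; unfold AbsRing_ball, abs, minus, plus, opp; simpl;
        (eapply Rlt_le_trans; [eassumption | apply Rmin_l]). }
    specialize (He1 B). unfold ball in He1; simpl in He1.
    unfold AbsRing_ball, abs, minus, plus, opp in He1; simpl in He1.
    replace (h (fst w0, snd w0) - h w0)%C with (RtoC 0) in He1
      by (destruct w0; simpl; ring).
    rewrite Cmod_0, Ropp_0, Rplus_0_r, Rabs_right in He1 by (apply Rle_ge, Cmod_ge_0).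
    exact He1. }
  set (ze := ((u, v) - w0)%C).
  set (z := (RtoC al * ze)%C).
  assert (Hze : ze <> 0) by (apply Cminus_eq_contra; exact Hne).
  assert (HA : RtoC al <> 0) by (apply RtoC_neq; lra).
  assert (Hz : z <> 0) by (apply Cmult_neq_0; assumption).
  assert (Hzp : 0 < Cmod z) by (apply Cmod_gt_0; exact Hz).
  assert (Hzs : Cmod z <= Rmin (/ 6) (d1 / (3 * Cmod (h w0) + 1))).
  { unfold z. rewrite Cmod_mult, Cmod_R, Rabs_right by lra.
    assert (Cmod ze <= 2 * e2).
    { eapply Rle_trans; [apply Cmod_le_sum|]. 
      change (Rabs (u - fst w0) + Rabs (v - snd w0) <= 2 * e2).
      assert (Rmin e1 e2 <= e2) by apply Rmin_r. lra. }
    replace (Rmin (/ 6) (d1 / (3 * Cmod (h w0) + 1))) with (al * (2 * e2)).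
    - apply Rmult_le_compat_l; lra.
    - unfold e2; field; lra. }
  assert (Hz6 : Cmod z <= / 6) by (eapply Rle_trans; [exact Hzs | apply Rmin_l]).
  assert (Hzd : 3 * Cmod (h w0) * Cmod z <= d1).
  { assert (Cmod z <= d1 / (3 * Cmod (h w0) + 1)) by (eapply Rle_trans; [exact Hzs | apply Rmin_r]).
    apply Rle_trans with ((3 * Cmod (h w0) + 1) * (d1 / (3 * Cmod (h w0) + 1))).
    - apply Rmult_le_compat; lra.
    - right; field; lra. }
  set (E := (Cexp z - 1)%C).
  assert (HE : Cmod (E - z)%C <= 3 * Cmod z ^ 2) by (apply Cexp_sub_1_sub_bound; lra).
  assert (HE2 : Cmod z / 2 <= Cmod E).
  { assert (Cmod z <= Cmod E + Cmod (E - z)%C).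
    { replace z with (E + - (E - z))%C at 1 by ring.
      eapply Rle_trans; [apply Cmod_triangle|]. rewrite Cmod_opp. lra. }
    assert (Cmod z ^ 2 <= Cmod z * / 6) by (simpl; rewrite Rmult_1_r; apply Rmult_le_compat_l; lra).
    lra. }
  assert (HE0 : E <> 0) by (apply Cmod_gt_0; lra).
  assert (Hlam0 : lam <> 0) by apply Cexp_neq_0.
  assert (ED : (Cexp (RtoC al * (u, v)) - lam = lam * E)%C).
  { unfold E, z, ze. replace (RtoC al * (u, v))%C with (RtoC al * w0 + RtoC al * ((u, v) - w0))%C by ring.
    rewrite Cexp_plus. fold lam. ring. }
  unfold Phi. rewrite ED. fold (h (u, v)) (h w0).
  replace (ze * (h (u, v) * (/ (lam * E)) ^ 1) - h w0 / (RtoC al * lam))%C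
    with ((z * (h (u, v) - h w0) + - (h w0 * (E - z))) / (RtoC al * lam * E))%C.
  2:{ unfold z. simpl. field. auto. }
  rewrite Cmod_div by (repeat apply Cmult_neq_0; assumption).
  rewrite !Cmod_mult, Cmod_R, (Rabs_right al) by lra.
  apply Rle_trans with ((Cmod z * d1 + d1 * Cmod z) / (al * Cmod lam * (Cmod z / 2))).
  - apply Rmult_le_compat.
    + apply Cmod_ge_0.
    + left; apply Rinv_0_lt_compat. repeat apply Rmult_lt_0_compat; lra.
    + eapply Rle_trans; [apply Cmod_triangle|]. rewrite Cmod_opp, !Cmod_mult.
      apply Rplus_le_compat; [apply Rmult_le_compat_l; lra|].
      apply Rle_trans with (Cmod (h w0) * (3 * Cmod z ^ 2)); [apply Rmult_le_compat_l; lra|].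
      replace (Cmod (h w0) * (3 * Cmod z ^ 2)) with ((3 * Cmod (h w0) * Cmod z) * Cmod z) by ring.
      apply Rmult_le_compat_r; lra.
    + apply Rinv_le_contravar; [repeat apply Rmult_lt_0_compat; lra|].
      apply Rmult_le_compat_l; [left; apply Rmult_lt_0_compat; lra | lra].
  - right. unfold d1. field. split; [|split]; lra.
Qed.

(** Cauchy's theorem on the four surrounding rectangles shrinks the contour to a square of half-side
    eps about w0. There [Phi] differs from r / (w - w0) by at most del / eps on a perimeter 8 eps,
    so the error is at most 8 del for every del > 0. *)
Lemma RB_Phi_1 al (w0 : CC) t gam a b c d :
  0 < al -> a < fst w0 < b -> c < snd w0 < d ->
  al * (d - snd w0) < 2 * PI -> al * (snd w0 - c) < 2 * PI ->
  RB (Phi al (Cexp (RtoC al * w0)%C) t gam 1) a b c d =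
  (RtoC (2 * PI) * Ci * (Cexp (RtoC t * Cexp w0 + RtoC gam * w0) / (RtoC al * Cexp (RtoC al * w0))))%C.
Proof.
  intros Ha Hu0 Hv0 Hd Hc.
  set (r := (Cexp (RtoC t * Cexp w0 + RtoC gam * w0) / (RtoC al * Cexp (RtoC al * w0)))%C).
  set (lam := Cexp (RtoC al * w0)%C).
  destruct w0 as [u0 v0]; simpl in Hu0, Hv0, Hd, Hc.
  assert (Hstrip : exists eta, 0 < eta /\ forall u v, c - eta < v < d + eta -> (u <> u0 \/ v <> v0) ->
            forall m, Reg al lam m (u, v)).
  { exists (Rmin ((2 * PI - al * (d - v0)) / al) ((2 * PI - al * (v0 - c)) / al)).
    split; [apply Rmin_glb_lt; apply Rdiv_lt_0_compat; lra|].
    intros u v Hv Hn m. apply Reg_strip; auto.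
    assert (E1 : al * ((2 * PI - al * (d - v0)) / al) = 2 * PI - al * (d - v0)) by (field; lra).
    assert (E2 : al * ((2 * PI - al * (v0 - c)) / al) = 2 * PI - al * (v0 - c)) by (field; lra).
    pose proof (Rmin_l ((2 * PI - al * (d - v0)) / al) ((2 * PI - al * (v0 - c)) / al)).
    pose proof (Rmin_r ((2 * PI - al * (d - v0)) / al) ((2 * PI - al * (v0 - c)) / al)).
    apply Rabs_def1; nra. }
  destruct Hstrip as [eta [Heta HR]].
  assert (HR' : forall u v, c <= v <= d -> (u <> u0 \/ v <> v0) -> forall m, Reg al lam m (u, v))
    by (intros; apply HR; auto; lra).
  set (G := Phi al lam t gam 1).
  assert (PC : forall a b c d eta, a <= b -> c <= d -> 0 < eta ->
     (forall u v, a - eta < u < b + eta -> c - eta < v < d + eta -> Reg al lam 1 (u, v)) ->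
     RB G a b c d = 0) by (intros; eapply Phi_Cauchy; eassumption).
  assert (Small : forall eps, 0 < eps -> eps < u0 - a -> eps < b - u0 -> eps < v0 - c -> eps < d - v0 ->
     RB G a b c d = RB G (u0 - eps) (u0 + eps) (v0 - eps) (v0 + eps)).
  { intros eps He H1 H2 H3 H4.
    assert (Hc' : forall u, ccont (fun y => G (y, c)) u)
      by (intros u; apply ccont_Phi_u, HR'; [lra | right; lra]).
    assert (Hd' : forall u, ccont (fun y => G (y, d)) u)
      by (intros u; apply ccont_Phi_u, HR'; [lra | right; lra]).
    rewrite (RB_split_u G a (u0 - eps) b c d); [|lra|intros; exact (Hc' u)|intros; exact (Hd' u)].
    rewrite (RB_split_u G (u0 - eps) (u0 + eps) b c d); [|lra|intros; exact (Hc' u)|intros; exact (Hd' u)].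
    set (e1 := Rmin eta eps).
    assert (He1 : 0 < e1) by (apply Rmin_glb_lt; lra).
    assert (e1 <= eta) by apply Rmin_l. assert (e1 <= eps) by apply Rmin_r.
    rewrite (PC a (u0 - eps) c d e1); try lra.
    2:{ intros u v Hu Hv. apply HR; [lra | left; lra]. }
    rewrite (PC (u0 + eps) b c d e1); try lra.
    2:{ intros u v Hu Hv. apply HR; [lra | left; lra]. }
    assert (Hv : forall u, u <> u0 -> forall v, c <= v <= d -> ccont (fun y => G (u, y)) v).
    { intros u Hu v Hvv; apply ccont_Phi_v, HR'; auto. }
    rewrite (RB_split_v G (u0 - eps) (u0 + eps) c (v0 - eps) d);
      [|lra|intros; apply (Hv (u0 - eps)); lra|intros; apply (Hv (u0 + eps)); lra].
    rewrite (RB_split_v G (u0 - eps) (u0 + eps) (v0 - eps) (v0 + eps) d);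
      [|lra|intros; apply (Hv (u0 - eps)); lra|intros; apply (Hv (u0 + eps)); lra].
    rewrite (PC (u0 - eps) (u0 + eps) c (v0 - eps) e1); try lra.
    2:{ intros u v Hu Hv'. apply HR; [lra | right; lra]. }
    rewrite (PC (u0 - eps) (u0 + eps) (v0 + eps) d e1); try lra.
    2:{ intros u v Hu Hv'. apply HR; [lra | right; lra]. }
    ring. }
  assert (Bound : forall del, 0 < del ->
     Cmod (RB G a b c d - RtoC (2 * PI) * Ci * r)%C <= 8 * del).
  { intros del Hdel.
    destruct (Phi_near_pole al (u0, v0) t gam Ha del Hdel) as [e0 [He0 Hnear]].
    simpl fst in Hnear; simpl snd in Hnear. fold lam r in Hnear.
    set (eps := Rmin (e0 / 2) (Rmin (Rmin ((u0 - a) / 2) ((b - u0) / 2)) (Rmin ((v0 - c) / 2) ((d - v0) / 2)))).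
    assert (Heps : 0 < eps) by (unfold eps; repeat apply Rmin_glb_lt; lra).
    assert (Hb : eps <= e0 / 2 /\ eps <= (u0 - a) / 2 /\ eps <= (b - u0) / 2 /\
                 eps <= (v0 - c) / 2 /\ eps <= (d - v0) / 2).
    { unfold eps. repeat split.
      - apply Rmin_l.
      - eapply Rle_trans; [apply Rmin_r|]. eapply Rle_trans; [apply Rmin_l|]. apply Rmin_l.
      - eapply Rle_trans; [apply Rmin_r|]. eapply Rle_trans; [apply Rmin_l|]. apply Rmin_r.
      - eapply Rle_trans; [apply Rmin_r|]. eapply Rle_trans; [apply Rmin_r|]. apply Rmin_l.
      - eapply Rle_trans; [apply Rmin_r|]. eapply Rle_trans; [apply Rmin_r|]. apply Rmin_r. }
    rewrite (Small eps) by lra.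
    set (P := fun w : CC => (- r * / (w - (u0, v0)))%C).
    assert (NZ : forall u v, (u <> u0 \/ v <> v0) -> ((u, v) - (u0, v0))%C <> 0).
    { intros u v N. apply Cminus_eq_contra. intros E. inversion E; subst. destruct N; auto. }
    assert (Cu' : forall u v, v <> v0 -> ccont (fun y => / ((y, v) - (u0, v0)))%C u).
    { intros u v N. apply (ccont_inv (fun y => (y, v) - (u0, v0))%C); [apply NZ; auto|].
      apply (ccont_plus (fun y => (y, v))); [|apply ccont_const]. eapply cd_ccont, cd_line_u. }
    assert (Cv' : forall u v, u <> u0 -> ccont (fun y => / ((u, y) - (u0, v0)))%C v).
    { intros u v N. apply (ccont_inv (fun y => (u, y) - (u0, v0))%C); [apply NZ; auto|].
      apply (ccont_plus (fun y => (u, y))); [|apply ccont_const]. eapply cd_ccont, cd_line_v. }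
    assert (Cu : forall u v, v <> v0 -> ccont (fun y => P (y, v)) u).
    { intros u v N. unfold P. apply ccont_cmult; apply Cu'; auto. }
    assert (Cv : forall u v, u <> u0 -> ccont (fun y => P (u, y)) v).
    { intros u v N. unfold P. apply ccont_cmult; apply Cv'; auto. }
    assert (Gu : forall u v, c <= v <= d -> v <> v0 -> ccont (fun y => G (y, v)) u).
    { intros u v Hv N. apply ccont_Phi_u, HR'; auto. }
    assert (Gv : forall u v, c <= v <= d -> u <> u0 -> ccont (fun y => G (u, y)) v).
    { intros u v Hv N. apply ccont_Phi_v, HR'; auto. }
    assert (EQ : (RB G (u0 - eps) (u0 + eps) (v0 - eps) (v0 + eps) - RtoC (2 * PI) * Ci * r)%C
       = RB (fun w => G w + P w)%C (u0 - eps) (u0 + eps) (v0 - eps) (v0 + eps)).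
    { rewrite RB_plus; try lra.
      - unfold P. rewrite (RB_scal (- r) (fun w => / (w - (u0, v0)))%C); try lra.
        + rewrite RB_inv_square by exact Heps. ring.
        + intros u v Hu [-> | ->]; apply Cu'; lra.
        + intros u v Hu [-> | ->]; apply Cv'; lra.
      - intros u v Hu [-> | ->]; (split; [apply Gu | apply Cu]); lra.
      - intros u v Hu [-> | ->]; (split; [apply Gv | apply Cv]); lra. }
    rewrite EQ.
    replace (8 * del) with (del / eps * (2 * (u0 + eps - (u0 - eps)) + 2 * (v0 + eps - (v0 - eps))))
      by (field; lra).
    apply RB_bound; try lra.
    - intros u v Hu [-> | ->]; (apply ccont_plus; [apply Gu | apply Cu]); lra.
    - intros u v Hu [-> | ->]; (apply ccont_plus; [apply Gv | apply Cv]); lra.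
    - intros u v Hu Hv Hbd.
      assert (Hne : u <> u0 \/ v <> v0).
      { destruct Hbd as [-> | [-> | [-> | ->]]]; [left|left|right|right]; lra. }
      assert (Hz0 := NZ u v Hne).
      assert (Hz : eps <= Cmod ((u, v) - (u0, v0))%C).
      { destruct Hbd as [-> | [-> | [-> | ->]]].
        - eapply Rle_trans; [|apply abs_fst_le_Cmod]. simpl. rewrite Rabs_left; lra.
        - eapply Rle_trans; [|apply abs_fst_le_Cmod]. simpl. rewrite Rabs_right; lra.
        - eapply Rle_trans; [|apply abs_snd_le_Cmod]. simpl. rewrite Rabs_left; lra.
        - eapply Rle_trans; [|apply abs_snd_le_Cmod]. simpl. rewrite Rabs_right; lra. }
      assert (HN : Cmod (((u, v) - (u0, v0)) * G (u, v) - r)%C <= del).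
      { apply Hnear.
        - intros E; inversion E; subst; destruct Hne; auto.
        - apply Rabs_def1; lra.
        - apply Rabs_def1; lra. }
      replace (G (u, v) + P (u, v))%C
        with ((((u, v) - (u0, v0)) * G (u, v) - r) / ((u, v) - (u0, v0)))%C
        by (unfold P; field; exact Hz0).
      rewrite Cmod_div by exact Hz0.
      apply Rmult_le_compat; [apply Cmod_ge_0 | left; apply Rinv_0_lt_compat; lra | exact HN |].
      apply Rinv_le_contravar; lra. }
  assert (Z : Cmod (RB G a b c d - RtoC (2 * PI) * Ci * r)%C = 0).
  { apply Rle_antisym; [|apply Cmod_ge_0]. apply le_epsilon. intros e He.
    eapply Rle_trans; [apply (Bound (e / 8)); lra|]. lra. }
  apply Cmod_eq_0 in Z.
  replace (RB G a b c d) with ((RB G a b c d - RtoC (2 * PI) * Ci * r) + RtoC (2 * PI) * Ci * r)%C by ring.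
  rewrite Z. ring.
Qed.

(* The j-th Taylor coefficient at z = lam of z |-> p^be exp (t p), where p = z^(1/al). *)
Fixpoint aa (al : R) (w0 : CC) (j : nat) (be t : R) : CC :=
  match j with
  | O => Cexp (RtoC t * Cexp w0 + RtoC be * w0)%C
  | S i => (RtoC (/ (al * INR (S i))) *
             (RtoC be * aa al w0 i (be - al) t + RtoC t * aa al w0 i (be - al + 1) t))%C
  end.

Lemma RB_ext (G H : CC -> CC) a b c d : (forall w, G w = H w) -> RB G a b c d = RB H a b c d.
Proof.
  intros E. unfold RB.
  rewrite (CI_ext (fun u => G (u, c)) (fun u => H (u, c))) by auto.
  rewrite (CI_ext (fun u => G (u, d)) (fun u => H (u, d))) by auto.
  rewrite (CI_ext (fun v => G (a, v)) (fun v => H (a, v))) by auto.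
  rewrite (CI_ext (fun v => G (b, v)) (fun v => H (b, v))) by auto.
  reflexivity.
Qed.

(** The integral of [dPhi] around the pole vanishes. This linear relation expresses an integral of
    order j + 2 by two of order j + 1, and it is the recursion by which [aa] is defined. *)
Lemma RB_Phi_S al (w0 : CC) j t gam a b c d :
  0 < al -> a < fst w0 < b -> c < snd w0 < d ->
  al * (d - snd w0) < 2 * PI -> al * (snd w0 - c) < 2 * PI ->
  RB (Phi al (Cexp (RtoC al * w0)%C) t gam (S j)) a b c d =
  (RtoC (2 * PI) * Ci * (RtoC (/ al) * aa al w0 j (gam - al) t))%C.
Proof.
  intros Ha Hu0 Hv0 Hd Hc. revert gam. induction j as [|j IH]; intros gam.
  - rewrite RB_Phi_1 by assumption. f_equal. simpl. rewrite RtoC_minus.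
    replace (RtoC t * Cexp w0 + (RtoC gam - RtoC al) * w0)%C
      with ((RtoC t * Cexp w0 + RtoC gam * w0) + - (RtoC al * w0))%C by ring.
    rewrite (Cexp_plus _ (- (RtoC al * w0))), Cexp_opp, RtoC_inv by lra.
    field. split; [apply Cexp_neq_0 | apply RtoC_neq; lra].
  - assert (HR : forall u v, c <= v <= d -> (u = a \/ u = b \/ v = c \/ v = d) ->
       forall m, Reg al (Cexp (RtoC al * w0)%C) m (u, v)).
    { intros u v Hv Hb m. destruct w0 as [u0 v0]; simpl in *. apply Reg_strip; auto.
      - apply Rabs_def1; nra.
      - destruct Hb as [-> | [-> | [-> | ->]]]; [left|left|right|right]; lra. }
    set (g := gam - al).
    set (lam := Cexp (RtoC al * w0)%C) in *.
    assert (Cu : forall h m u v, v = c \/ v = d -> ccont (fun y => Phi al lam t h m (y, v)) u).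
    { intros h m u v Hv. apply ccont_Phi_u, HR; [lra|tauto]. }
    assert (Cv : forall h m u v, c <= v <= d -> u = a \/ u = b -> ccont (fun y => Phi al lam t h m (u, y)) v).
    { intros h m u v Hv Hu. apply ccont_Phi_v, HR; tauto. }
    assert (Mu : forall (k : CC) h m u v, v = c \/ v = d -> ccont (fun y => k * Phi al lam t h m (y, v))%C u).
    { intros k h m u v Hv. apply ccont_cmult; apply Cu; exact Hv. }
    assert (Mv : forall (k : CC) h m u v, c <= v <= d -> u = a \/ u = b -> ccont (fun y => k * Phi al lam t h m (u, y))%C v).
    { intros k h m u v Hv Hu. apply ccont_cmult; apply Cv; assumption. }
    assert (E : RB (dPhi al lam t g (S j)) a b c d = 0).
    { apply RB_dPhi; try lra. intros; apply HR; auto. }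
    rewrite RB_ext with (H := fun w =>
      ((RtoC t * Phi al lam t (g + 1) (S j) w + RtoC g * Phi al lam t g (S j) w)
       + RtoC (- (INR (S j) * al)) * Phi al lam t (g + al) (S (S j)) w)%C) in E.
    2:{ intros w. unfold dPhi. rewrite RtoC_opp. ring. }
    rewrite (RB_plus (fun w => RtoC t * Phi al lam t (g + 1) (S j) w + RtoC g * Phi al lam t g (S j) w)%C
               (fun w => RtoC (- (INR (S j) * al)) * Phi al lam t (g + al) (S (S j)) w)%C) in E; try lra.
    2:{ intros u v Hu Hv; split.
        - apply ccont_plus; apply Mu; exact Hv.
        - apply Mu; exact Hv. }
    2:{ intros u v Hu Hv; split.
        - apply ccont_plus; apply Mv; assumption.
        - apply Mv; assumption. }
    rewrite (RB_plus (fun w => RtoC t * Phi al lam t (g + 1) (S j) w)%C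
               (fun w => RtoC g * Phi al lam t g (S j) w)%C) in E; try lra.
    2:{ intros u v Hu Hv; split; apply Mu; assumption. }
    2:{ intros u v Hu Hv; split; apply Mv; assumption. }
    assert (RS : forall (k : CC) h m, RB (fun w => k * Phi al lam t h m w)%C a b c d = (k * RB (Phi al lam t h m) a b c d)%C).
    { intros k h m. apply RB_scal; try lra; intros; [apply Cu | apply Cv]; assumption. }
    rewrite !RS in E.
    rewrite !IH in E.
    replace (g + al) with gam in E by (unfold g; ring).
    set (X := RB (Phi al lam t gam (S (S j))) a b c d) in *.
    cbn [aa]. fold g. replace (g + 1 - al) with (g - al + 1) in E by ring.
    assert (HN : INR (S j) * al <> 0).
    { apply Rmult_integral_contrapositive_currified; [apply not_0_INR; discriminate | lra]. }
    assert (HN2 : RtoC (INR (S j)) <> 0) by (apply RtoC_neq, not_0_INR; discriminate).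
    assert (HA : RtoC al <> 0) by (apply RtoC_neq; lra).
    rewrite RtoC_opp, (RtoC_mult (INR (S j)) al) in E.
    assert (E2 : (X = / (RtoC (INR (S j)) * RtoC al) * (RtoC (INR (S j)) * RtoC al * X))%C) by (field; auto).
    rewrite E2.
    replace (RtoC (INR (S j)) * RtoC al * X)%C with
      (RtoC t * (RtoC (2 * PI) * Ci * (RtoC (/ al) * aa al w0 j (g - al + 1) t)) +
       RtoC g * (RtoC (2 * PI) * Ci * (RtoC (/ al) * aa al w0 j (g - al) t)))%C.
    + rewrite (RtoC_inv (al * INR (S j))) by lra. rewrite (RtoC_mult al (INR (S j))), RtoC_inv by lra. field; auto.
    + match type of E with ?L = _ =>
        transitivity (RtoC (INR (S j)) * RtoC al * X + L)%C; [ring | rewrite E; ring]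
      end.
Qed.
(** * Hankel's integral for the reciprocal Gamma function *)

Lemma Cmod_Phi_0 t gam u v : Cmod (Phi 1 1 t gam 0 (u, v)) = exp (t * (exp u * cos v) + gam * u).
Proof.
  unfold Phi. simpl Cpow. rewrite Cmult_1_r, Cmod_Cexp. f_equal. simpl. ring.
Qed.

Lemma Reg_0 al lam w : Reg al lam 0 w.
Proof. left; reflexivity. Qed.

Lemma Phi_0_scale t gam u v : 0 < t ->
  (Phi 1 1 t gam 0 (u, v) = RtoC (Rpower t (- gam)) * Phi 1 1 1 gam 0 (u + ln t, v)%R)%C.
Proof.
  intros Ht. unfold Phi, Rpower. simpl Cpow. rewrite !Cmult_1_r, <- Cexp_RtoC, <- Cexp_plus.
  f_equal.
  replace (Cexp (u + ln t, v)) with (RtoC t * Cexp (u, v))%C.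
  - apply C_ext; simpl; ring.
  - apply C_ext; unfold Cexp; simpl; rewrite exp_plus, exp_ln by exact Ht; ring.
Qed.

(* (1 / 2 pi i) times the integral of e^p p^(-be) over the arc of radius e^U and angle
   |arg p| <= Th; it tends to 1 / Gamma(be) as U -> oo. *)
Definition cB (Th be U : R) : CC :=
  (RtoC (/ (2 * PI)) * CI (fun v => Phi 1 1 1 (1 - be) 0 (U, v)) (- Th) Th)%C.

(** Cauchy's theorem on the rectangle between the two arcs leaves the two sides at angles -Th and
    Th, on which the modulus of the integrand is the function on the right. *)
Lemma cB_diff Th be U V : 0 < Th -> U <= V ->
  Cmod (cB Th be V - cB Th be U)%C
  <= / PI * RInt (fun u => exp (exp u * cos Th + (1 - be) * u)) U V.
Proof.
  intros HTh HUV. pose proof PI_RGT_0 as HPi.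
  pose proof (Phi_Cauchy 1 1 1 (1 - be) 0 U V (- Th) Th 1 HUV ltac:(lra) ltac:(lra)
                (fun _ _ _ _ => Reg_0 _ _ _)) as H.
  unfold RB in H.
  set (A1 := CI (fun u => Phi 1 1 1 (1 - be) 0 (u, - Th)) U V) in H.
  set (A2 := CI (fun u => Phi 1 1 1 (1 - be) 0 (u, Th)) U V) in H.
  assert (E : (cB Th be V - cB Th be U = RtoC (/ (2 * PI)) * (- Ci * (A2 - A1)))%C).
  { unfold cB.
    set (B1 := CI (fun v => Phi 1 1 1 (1 - be) 0 (V, v)) (- Th) Th) in *.
    set (B2 := CI (fun v => Phi 1 1 1 (1 - be) 0 (U, v)) (- Th) Th) in *.
    assert (Hc : (A2 - A1 = Ci * (B1 - B2))%C).
    { replace (A2 - A1)%C with (Ci * (B1 - B2) - (A1 + Ci * B1 - A2 - Ci * B2))%C by ring.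
      rewrite H. ring. }
    rewrite Hc. replace (- Ci * (Ci * (B1 - B2)))%C with (- (Ci * Ci) * (B1 - B2))%C by ring.
    replace (Ci * Ci)%C with (- (1))%C by (apply C_ext; simpl; ring). ring. }
  rewrite E, !Cmod_mult, Cmod_opp, Cmod_Ci, Cmod_R, Rabs_right
    by (apply Rle_ge; left; apply Rinv_0_lt_compat; lra).
  set (I := RInt (fun u => exp (exp u * cos Th + (1 - be) * u)) U V).
  assert (HI : ex_RInt (fun u => exp (exp u * cos Th + (1 - be) * u)) U V).
  { apply (ex_RInt_continuous (V:=R_CompleteNormedModule)). intros x _.
    apply (ex_derive_continuous (V:=R_NormedModule)). auto_derive; exact Logic.I. }
  assert (B1 : Cmod A1 <= I).
  { apply CI_bound; auto.
    - intros; apply ccont_Phi_u, Reg_0.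
    - intros x Hx. rewrite Cmod_Phi_0, cos_neg. right; f_equal; ring. }
  assert (B2 : Cmod A2 <= I).
  { apply CI_bound; auto.
    - intros; apply ccont_Phi_u, Reg_0.
    - intros x Hx. rewrite Cmod_Phi_0. right; f_equal; ring. }
  assert (B3 : Cmod (A2 - A1)%C <= 2 * I).
  { eapply Rle_trans; [apply Cmod_triangle|]. rewrite Cmod_opp. lra. }
  replace (/ PI * I) with (/ (2 * PI) * (1 * (2 * I))) by (field; lra).
  apply Rmult_le_compat_l; [left; apply Rinv_0_lt_compat; lra | lra].
Qed.

(** Replacing exp (- be u) by its maximum exp (- be U) leaves e^u exp (e^u cos Th), which has an
    elementary primitive. *)
Lemma cB_diff_exp Th be U V : 0 < Th -> cos Th < 0 -> 0 <= be -> U <= V ->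
  Cmod (cB Th be V - cB Th be U)%C <= / (PI * - cos Th) * exp (- be * U + exp U * cos Th).
Proof.
  intros HTh Hk Hbe HUV. pose proof PI_RGT_0 as HPi.
  eapply Rle_trans; [apply cB_diff; assumption|].
  assert (HR : is_RInt (fun u => exp (- be * U) * (exp u * exp (exp u * cos Th))) U V
     (exp (- be * U) * (exp (exp V * cos Th) / cos Th) - exp (- be * U) * (exp (exp U * cos Th) / cos Th))).
  { apply (is_RInt_derive (V:=R_CompleteNormedModule) (fun u => exp (- be * U) * (exp (exp u * cos Th) / cos Th))).
    - intros x _. auto_derive; [exact I|]. field. lra.
    - intros x _. apply (ex_derive_continuous (V:=R_NormedModule)). auto_derive; exact Logic.I. }
  apply Rle_trans with (/ PI * RInt (fun u => exp (- be * U) * (exp u * exp (exp u * cos Th))) U V).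
  - apply Rmult_le_compat_l; [left; apply Rinv_0_lt_compat; lra|].
    apply RInt_le; auto.
    + apply (ex_RInt_continuous (V:=R_CompleteNormedModule)). intros x _.
      apply (ex_derive_continuous (V:=R_NormedModule)). auto_derive; exact I.
    + eexists; exact HR.
    + intros x Hx. rewrite <- !exp_plus. apply exp_le. nra.
  - rewrite (is_RInt_unique _ _ _ _ HR). rewrite exp_plus.
    replace (/ (PI * - cos Th) * (exp (- be * U) * exp (exp U * cos Th))) with
      (/ PI * (- exp (- be * U) * (exp (exp U * cos Th) / cos Th))) by (field; lra).
    apply Rmult_le_compat_l; [left; apply Rinv_0_lt_compat; lra|].
    assert (exp (- be * U) * (exp (exp V * cos Th) / cos Th) <= 0); [|lra].
    pose proof (exp_pos (- be * U)). pose proof (exp_pos (exp V * cos Th)).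
    assert (exp (exp V * cos Th) / cos Th < 0).
    { unfold Rdiv. pose proof (Rinv_lt_0_compat _ Hk). nra. }
    nra.
Qed.

(** Here the factor exp (e^u cos Th) <= 1 is dropped instead, which gives the bound usable as U
    tends to minus infinity. *)
Lemma cB_diff_pow Th be U V : 0 < Th -> cos Th < 0 -> 1 < be -> U <= V ->
  Cmod (cB Th be V - cB Th be U)%C <= / (PI * (be - 1)) * exp ((1 - be) * U).
Proof.
  intros HTh Hk Hbe HUV. pose proof PI_RGT_0 as HPi.
  eapply Rle_trans; [apply cB_diff; assumption|].
  assert (HR : is_RInt (fun u => exp ((1 - be) * u)) U V
     (exp ((1 - be) * V) / (1 - be) - exp ((1 - be) * U) / (1 - be))).
  { apply (is_RInt_derive (V:=R_CompleteNormedModule) (fun u => exp ((1 - be) * u) / (1 - be))).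
    - intros x _. auto_derive; [exact I|]. field. lra.
    - intros x _. apply (ex_derive_continuous (V:=R_NormedModule)). auto_derive; exact Logic.I. }
  apply Rle_trans with (/ PI * RInt (fun u => exp ((1 - be) * u)) U V).
  - apply Rmult_le_compat_l; [left; apply Rinv_0_lt_compat; lra|].
    apply RInt_le; auto.
    + apply (ex_RInt_continuous (V:=R_CompleteNormedModule)). intros x _.
      apply (ex_derive_continuous (V:=R_NormedModule)). auto_derive; exact I.
    + eexists; exact HR.
    + intros x Hx. apply exp_le. pose proof (exp_pos x). nra.
  - rewrite (is_RInt_unique _ _ _ _ HR).
    replace (/ (PI * (be - 1)) * exp ((1 - be) * U)) with
      (/ PI * (- (exp ((1 - be) * U) / (1 - be)))) by (field; lra).
    apply Rmult_le_compat_l; [left; apply Rinv_0_lt_compat; lra|].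
    assert (exp ((1 - be) * V) / (1 - be) <= 0); [|lra].
    pose proof (exp_pos ((1 - be) * V)).
    assert (/ (1 - be) < 0) by (apply Rinv_lt_0_compat; lra).
    unfold Rdiv; nra.
Qed.

Lemma C_seq_cauchy (u : nat -> CC) :
  (forall e, 0 < e -> exists N, forall n m, (N <= n)%nat -> (n <= m)%nat -> Cmod (u m - u n)%C < e) ->
  exists l : CC, forall e, 0 < e -> exists N, forall n, (N <= n)%nat -> Cmod (u n - l)%C < e.
Proof.
  intros H.
  assert (H1 : ex_finite_lim_seq (fun n => fst (u n))).
  { apply ex_lim_seq_cauchy_corr. intros e. destruct (H (e / 2)) as [N HN].
    - pose proof (cond_pos e); lra.
    - exists N. intros n m Hn Hm.
      assert (forall k, (N <= k)%nat -> Rabs (fst (u k) - fst (u N)) < e / 2).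
      { intros k Hk. eapply Rle_lt_trans; [|apply (HN N k (le_n _) Hk)]. apply (abs_fst_le_Cmod (u k - u N)%C). }
      pose proof (H0 n Hn) as A. pose proof (H0 m Hm) as B.
      apply Rabs_def2 in A; apply Rabs_def2 in B. apply Rabs_def1; lra. }
  assert (H2 : ex_finite_lim_seq (fun n => snd (u n))).
  { apply ex_lim_seq_cauchy_corr. intros e. destruct (H (e / 2)) as [N HN].
    - pose proof (cond_pos e); lra.
    - exists N. intros n m Hn Hm.
      assert (forall k, (N <= k)%nat -> Rabs (snd (u k) - snd (u N)) < e / 2).
      { intros k Hk. eapply Rle_lt_trans; [|apply (HN N k (le_n _) Hk)]. apply (abs_snd_le_Cmod (u k - u N)%C). }
      pose proof (H0 n Hn) as A. pose proof (H0 m Hm) as B.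
      apply Rabs_def2 in A; apply Rabs_def2 in B. apply Rabs_def1; lra. }
  destruct H1 as [l1 H1], H2 as [l2 H2]. exists (l1, l2). intros e He.
  apply is_lim_seq_spec in H1; apply is_lim_seq_spec in H2.
  destruct (H1 (mkposreal (e / 2) ltac:(lra))) as [N1 HN1].
  destruct (H2 (mkposreal (e / 2) ltac:(lra))) as [N2 HN2].
  exists (max N1 N2). intros n Hn.
  specialize (HN1 n ltac:(lia)). specialize (HN2 n ltac:(lia)). simpl in HN1, HN2.
  eapply Rle_lt_trans; [apply Cmod_le_sum|].
  change (Rabs (fst (u n) - l1) + Rabs (snd (u n) - l2) < e). lra.
Qed.

Lemma exp_neg_lt_eps (k e : R) : 0 < k -> 0 < e -> exists X, 0 < X /\ forall x, X <= x -> exp (- k * x) < e.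
Proof.
  intros Hk He. exists (Rmax 1 (- ln e / k + 1)). split.
  - eapply Rlt_le_trans; [|apply Rmax_l]; lra.
  - intros x Hx. rewrite <- (exp_ln e He). apply exp_increasing.
    assert (- ln e / k + 1 <= x) by (eapply Rle_trans; [apply Rmax_r | exact Hx]).
    assert (k * (- ln e / k + 1) <= k * x) by (apply Rmult_le_compat_l; lra).
    replace (k * (- ln e / k + 1)) with (- ln e + k) in H0 by (field; lra). lra.
Qed.

(** Both bounds are needed. The first is superexponentially small and is summed over the terms of
    the Mittag-Leffler series. The second, taken at U + ln s, grows only like s^(1-be) as s tends to
    0, which the weight s^(be-1) of the Gamma integral cancels. *)
Lemma cB_limit Th be : 0 < Th -> cos Th < 0 -> 0 <= be ->
  exists cc : CC, forall U,
    Cmod (cB Th be U - cc)%C <= / (PI * - cos Th) * exp (- be * U + exp U * cos Th) /\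
    (1 < be -> Cmod (cB Th be U - cc)%C <= / (PI * (be - 1)) * exp ((1 - be) * U)).
Proof.
  intros HTh Hk Hbe. pose proof PI_RGT_0 as HPi.
  destruct (C_seq_cauchy (fun n => cB Th be (INR n))) as [cc Hcc].
  { intros e He.
    assert (Hp : 0 < PI * - cos Th) by (apply Rmult_lt_0_compat; lra).
    destruct (exp_neg_lt_eps (- cos Th) (e * (PI * - cos Th))) as [X [HX HX2]]; [lra|nra|].
    destruct (nfloor_ex X) as [N HN]; [lra|].
    exists (S N). intros n m Hn Hm.
    assert (HnX : X <= INR n) by (apply le_INR in Hn; rewrite S_INR in Hn; lra).
    eapply Rle_lt_trans; [apply cB_diff_exp; auto; apply le_INR; exact Hm|].
    apply Rle_lt_trans with (/ (PI * - cos Th) * exp (- - cos Th * INR n)).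
    - apply Rmult_le_compat_l; [left; apply Rinv_0_lt_compat; exact Hp|].
      apply exp_le. pose proof (exp_ineq1_le (INR n)). pose proof (pos_INR n). nra.
    - specialize (HX2 _ HnX).
      apply Rmult_lt_reg_l with (PI * - cos Th); [exact Hp|].
      rewrite <- Rmult_assoc, Rinv_r, Rmult_1_l by lra. lra. }
  assert (Hgen : forall U B, (forall V, U <= V -> Cmod (cB Th be V - cB Th be U)%C <= B) ->
            Cmod (cB Th be U - cc)%C <= B).
  { intros U B HB. apply le_epsilon. intros e He.
    destruct (Hcc e He) as [N HN].
    destruct (nfloor_ex (Rmax 0 U)) as [M HM]; [apply Rmax_l|].
    set (n := max N (S M)).
    assert (Hn : U <= INR n).
    { assert (INR (S M) <= INR n) by (apply le_INR; unfold n; lia). rewrite S_INR in H.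
      pose proof (Rmax_r 0 U). lra. }
    specialize (HN n ltac:(unfold n; lia)). specialize (HB _ Hn).
    replace (cB Th be U - cc)%C with (- (cB Th be (INR n) - cB Th be U) + (cB Th be (INR n) - cc))%C by ring.
    eapply Rle_trans; [apply Cmod_triangle|]. rewrite Cmod_opp. lra. }
  exists cc. intros U. split.
  - apply Hgen. intros V HV. apply cB_diff_exp; auto.
  - intros H1. apply Hgen. intros V HV. apply cB_diff_pow; auto.
Qed.

(** * The contour integral with a pole at p = 1 that evaluates the Laplace transform *)

Lemma cd_RtoC (f : R -> R) x l : is_derive f x l -> cd (fun y => RtoC (f y)) x (RtoC l).
Proof. intros H; split; simpl; [exact H | apply (is_derive_const (V:=R_NormedModule))]. Qed.

Lemma cd_Phi_t al lam gam m w T :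
  cd (fun t => Phi al lam t gam m w) T (Phi al lam T (gam + 1) m w).
Proof.
  assert (D1 : cd (fun t => RtoC t * Cexp w + RtoC gam * w)%C T (Cexp w)).
  { eapply cd_eq; [|apply cd_plus; [|apply cd_const]].
    2:{ eapply cd_ext; [intros y; apply Cmult_comm|]. apply cd_cmult. apply (cd_RtoC (fun y => y)). apply (is_derive_id T). }
    change (RtoC one) with (RtoC 1). ring. }
  unfold Phi.
  eapply cd_ext; [intros y; apply Cmult_comm|].
  eapply cd_eq; [|apply cd_cmult; apply cd_exp; exact D1]. cbv beta.
  rewrite RtoC_plus.
  replace (RtoC T * Cexp w + (RtoC gam + 1) * w)%C with (w + (RtoC T * Cexp w + RtoC gam * w))%C by ring.
  rewrite (Cexp_plus w). ring.
Qed.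

Lemma cd_CI_t al lam gam m (p : R -> CC) a b T :
  (forall x, Rmin a b <= x <= Rmax a b -> ccont p x /\ Reg al lam m (p x)) ->
  cd (fun t => CI (fun x => Phi al lam t gam m (p x)) a b) T
     (CI (fun x => Phi al lam T (gam + 1) m (p x)) a b).
Proof.
  intros Hp.
  apply (CI_param_derive (fun t x => Phi al lam t gam m (p x)) (fun t x => Phi al lam t (gam + 1) m (p x))) with 1.
  - lra.
  - intros; apply cd_Phi_t.
  - intros y t _ Ht. destruct (Hp t Ht). apply ccont_Phi; assumption.
  - intros t Ht. destruct (Hp t Ht) as [H1 H2]. unfold ccont2.
    apply (ccont_Phi_t (U := prod_UniformSpace R_UniformSpace R_UniformSpace) al lam
             (fun q => fst q) (gam + 1) m (fun q => p (snd q))).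
    + apply (@continuous_fst R_UniformSpace R_UniformSpace).
    + exact H2.
    + apply (ccont_comp (U := prod_UniformSpace R_UniformSpace R_UniformSpace) (V := R_UniformSpace)
               (fun q => snd q) p); [apply (@continuous_snd R_UniformSpace R_UniformSpace) | exact H1].
  - intros t Ht. apply locally_2d_forall. intros; apply cd_Phi_t.
Qed.

(* Integral along the arc of radius 1/2 and the two rays at angles -Th, Th, up to radius e^U:
   there Re p <= 1/2, so that exp (t (p - 1)) decays in t. *)
Definition Kc (Th U : R) (F : CC -> CC) : CC :=
  (CI (fun u => F (u, Th)) (- ln 2) U - CI (fun u => F (u, (- Th)%R)) (- ln 2) U
   + Ci * CI (fun v => F ((- ln 2)%R, v)) (- Th) Th)%C.

Lemma Reg_unit m u v : Rabs v < 2 * PI -> (u <> 0 \/ v <> 0) -> Reg 1 1 m (u, v).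
Proof.
  intros Hv Hn. replace (RtoC 1) with (Cexp (RtoC 1 * (0, 0))%C).
  - apply Reg_strip; [lra | | exact Hn]. rewrite Rminus_0_r, Rmult_1_l. exact Hv.
  - replace (RtoC 1 * (0, 0))%C with (RtoC 0) by (apply C_ext; simpl; ring). apply Cexp_0.
Qed.

Lemma ln_2_pos : 0 < ln 2.
Proof. rewrite <- ln_1. apply ln_increasing; lra. Qed.

Lemma cos_Th_neg (Th : R) (HTh : PI / 2 < Th <= PI) : cos Th < 0.
Proof. pose proof PI_RGT_0. apply cos_lt_0; lra. Qed.

Lemma Reg_Kc (Th : R) (HTh : PI / 2 < Th <= PI) m u v : 
  (v = Th \/ v = - Th \/ (u = - ln 2 /\ - Th <= v <= Th)) -> Reg 1 1 m (u, v).
Proof.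
  pose proof PI_RGT_0. pose proof ln_2_pos.
  intros [-> | [-> | [-> Hv]]]; apply Reg_unit.
  - apply Rabs_def1; lra.
  - right; lra.
  - apply Rabs_def1; lra.
  - right; lra.
  - apply Rabs_def1; lra.
  - left; lra.
Qed.

Lemma ccont_pair_l v u : ccont (fun y => (y, v)) u.
Proof. eapply cd_ccont, cd_line_u. Qed.

Lemma ccont_pair_r u v : ccont (fun y => (u, y)) v.
Proof. eapply cd_ccont, cd_line_v. Qed.

Lemma cd_Kc (Th : R) (HTh : PI / 2 < Th <= PI) U gam m T :
  cd (fun t => Kc Th U (Phi 1 1 t gam m)) T (Kc Th U (Phi 1 1 T (gam + 1) m)).
Proof.
  unfold Kc.
  assert (D1 := cd_CI_t 1 1 gam m (fun u => (u, Th)) (- ln 2) U T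
     (fun x _ => conj (ccont_pair_l Th x) (Reg_Kc Th HTh m x Th (or_introl eq_refl)))).
  assert (D2 := cd_CI_t 1 1 gam m (fun u => (u, - Th)) (- ln 2) U T
     (fun x _ => conj (ccont_pair_l (- Th) x) (Reg_Kc Th HTh m x (- Th) (or_intror (or_introl eq_refl))))).
  assert (D3 := cd_CI_t 1 1 gam m (fun v => (- ln 2, v)) (- Th) Th T).
  assert (H3 : forall x, Rmin (- Th) Th <= x <= Rmax (- Th) Th -> ccont (fun v => (- ln 2, v)) x /\ Reg 1 1 m (- ln 2, x)).
  { intros x Hx. pose proof PI_RGT_0. rewrite Rmin_left, Rmax_right in Hx by lra.
    split; [apply ccont_pair_r | apply (Reg_Kc Th HTh); right; right; auto]. }
  specialize (D3 H3). cbv beta in D1, D2, D3.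
  eapply cd_ext with (fun t => CI (fun u => Phi 1 1 t gam m (u, Th)) (- ln 2) U
     + (- (1)) * CI (fun u => Phi 1 1 t gam m (u, (- Th)%R)) (- ln 2) U
     + Ci * CI (fun v => Phi 1 1 t gam m ((- ln 2)%R, v)) (- Th) Th)%C; [intros; ring|].
  eapply cd_eq; [|exact (cd_plus _ _ _ _ _ (cd_plus _ _ _ _ _ D1 (cd_cmult (- (1))%C _ _ _ D2)) (cd_cmult Ci _ _ _ D3))].
  ring.
Qed.

Lemma Phi_unit_diff t gam w : Reg 1 1 1 w ->
  (Phi 1 1 t (gam + 1) 1 w + (- (1)) * Phi 1 1 t gam 1 w = Phi 1 1 t gam 0 w)%C.
Proof.
  intros [H|H]; [discriminate|]. rewrite <- Phi_shift. unfold Phi. simpl Cpow.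
  apply Cminus_eq_contra in H. field. exact H.
Qed.

(** Multiplication by p - 1 removes the denominator. Thus the derivative of exp (- t) times the
    contour integral has an entire integrand, to which Cauchy's theorem applies. *)
Lemma Kc_diff (Th : R) (HTh : PI / 2 < Th <= PI) U t gam :
  (Kc Th U (Phi 1 1 t (gam + 1) 1) - Kc Th U (Phi 1 1 t gam 1))%C = Kc Th U (Phi 1 1 t gam 0).
Proof.
  pose proof PI_RGT_0 as HPi.
  assert (L : forall (p : R -> CC) a b, (forall x, Rmin a b <= x <= Rmax a b -> ccont p x /\ Reg 1 1 1 (p x)) ->
    (CI (fun x => Phi 1 1 t gam 0 (p x)) a b =
     CI (fun x => Phi 1 1 t (gam + 1) 1 (p x)) a b - CI (fun x => Phi 1 1 t gam 1 (p x)) a b)%C).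
  { intros p a b Hp.
    rewrite <- (CI_ext (fun x => Phi 1 1 t (gam + 1) 1 (p x) + (- (1)) * Phi 1 1 t gam 1 (p x))%C).
    2:{ intros x Hx. apply Phi_unit_diff. apply Hp. lra. }
    rewrite CI_plus, CI_scal; [ring| | |];
      intros x Hx; destruct (Hp x Hx); try (apply ccont_mult; [apply ccont_const|]); apply ccont_Phi; assumption. }
  unfold Kc.
  rewrite (L (fun u => (u, Th))), (L (fun u => (u, - Th))), (L (fun v => (- ln 2, v))).
  - ring.
  - intros x Hx. rewrite Rmin_left, Rmax_right in Hx by lra.
    split; [apply ccont_pair_r | apply (Reg_Kc Th HTh); right; right; auto].
  - intros x Hx. split; [apply ccont_pair_l | apply (Reg_Kc Th HTh); auto].
  - intros x Hx. split; [apply ccont_pair_l | apply (Reg_Kc Th HTh); auto].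
Qed.

Lemma Kc_Cauchy (Th : R) (HTh : PI / 2 < Th <= PI) U t gam : - ln 2 <= U ->
  Kc Th U (Phi 1 1 t gam 0) = (Ci * CI (fun v => Phi 1 1 t gam 0 (U, v)) (- Th) Th)%C.
Proof.
  intros HU. pose proof PI_RGT_0.
  pose proof (Phi_Cauchy 1 1 t gam 0 (- ln 2) U (- Th) Th 1 HU ltac:(lra) ltac:(lra)
                (fun _ _ _ _ => Reg_0 _ _ _)) as H0.
  unfold RB in H0. unfold Kc.
  match type of H0 with ?L = _ =>
    transitivity (Ci * CI (fun v => Phi 1 1 t gam 0 (U, v)) (- Th) Th - L)%C; [ring | rewrite H0; ring]
  end.
Qed.

(** The inner arc has radius 1/2 and the outer one radius e^U > 1, so closing the contour encloses
    the simple pole p = 1, whose residue is 1. *)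
Lemma Kc_residue (Th : R) (HTh : PI / 2 < Th <= PI) U gam : 0 < U ->
  Kc Th U (Phi 1 1 0 gam 1) =
  (Ci * CI (fun v => Phi 1 1 0 gam 1 (U, v)) (- Th) Th - RtoC (2 * PI) * Ci)%C.
Proof.
  intros HU. pose proof PI_RGT_0. pose proof ln_2_pos.
  pose proof (RB_Phi_1 1 (0, 0) 0 gam (- ln 2) U (- Th) Th) as H1.
  simpl fst in H1; simpl snd in H1.
  specialize (H1 ltac:(lra) ltac:(lra) ltac:(lra) ltac:(lra) ltac:(lra)).
  assert (E0 : (RtoC 1 * (0, 0))%C = 0) by (apply C_ext; simpl; ring).
  rewrite E0, Cexp_0 in H1.
  replace (RtoC 0 * Cexp (0, 0) + RtoC gam * (0, 0))%C with (RtoC 0) in H1 by (apply C_ext; simpl; ring).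
  rewrite Cexp_0 in H1. unfold RB in H1. unfold Kc.
  match type of H1 with ?L = _ =>
    transitivity (Ci * CI (fun v => Phi 1 1 0 gam 1 (U, v)) (- Th) Th - L)%C; [ring | rewrite H1]
  end.
  field. 
Qed.

Lemma Cmod_Phi_1 t gam u v :
  Cmod (Phi 1 1 t gam 1 (u, v)) * Cmod (Cexp (u, v) - 1)%C
  = (if Req_EM_T (Cmod (Cexp (u, v) - 1)%C) 0 then 0 else exp (t * (exp u * cos v) + gam * u)).
Proof.
  destruct (Req_EM_T _ _) as [E|E]; [rewrite E; ring|].
  rewrite <- Cmod_Phi_0, <- Cmod_mult. f_equal.
  unfold Phi. simpl Cpow. rewrite Cmult_1_l.
  assert (Cexp (u, v) - 1 <> 0)%C by (intros H; apply E; rewrite H; apply Cmod_0).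
  field. exact H.
Qed.

Lemma Cmod_Phi_1_le t gam u v d :
  0 < d -> d <= Cmod (Cexp (u, v) - 1)%C ->
  Cmod (Phi 1 1 t gam 1 (u, v)) <= exp (t * (exp u * cos v) + gam * u) / d.
Proof.
  intros Hd Hle. pose proof (Cmod_Phi_1 t gam u v) as E.
  destruct (Req_EM_T _ _) as [E1|E1]; [lra|].
  apply Rmult_le_reg_r with d; [exact Hd|].
  unfold Rdiv. rewrite Rmult_assoc, Rinv_l, Rmult_1_r by lra. rewrite <- E.
  apply Rmult_le_compat_l; [apply Cmod_ge_0 | exact Hle].
Qed.

(** On the whole contour Re p <= 1/2 and |p - 1| >= 1/2; the rays lie in the left half plane and the
    small arc has radius 1/2. *)
Lemma Kc_bound (Th : R) (HTh : PI / 2 < Th <= PI) U gam : 0 < U -> exists K, 0 <= K /\ forall T, 0 <= T ->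
  Cmod (Kc Th U (Phi 1 1 T gam 1)) <= K * exp (T / 2).
Proof.
  intros HU. pose proof PI_RGT_0 as HPi. pose proof ln_2_pos as Hl. pose proof (cos_Th_neg Th HTh) as Hc.
  set (M := exp (Rabs gam * (U + ln 2))).
  assert (HM : forall u, - ln 2 <= u <= U -> gam * u <= Rabs gam * (U + ln 2)).
  { intros u Hu. apply Rle_trans with (Rabs (gam * u)); [apply Rle_abs|].
    rewrite Rabs_mult. apply Rmult_le_compat_l; [apply Rabs_pos|].
    apply Rabs_le; lra. }
  exists (2 * M * (2 * (U + ln 2) + 2 * Th)). split.
  { pose proof (exp_pos (Rabs gam * (U + ln 2))). fold M in H. apply Rmult_le_pos; lra. }
  intros T HT.
  assert (P : forall u v, - ln 2 <= u <= U ->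
     (v = Th \/ v = - Th \/ (u = - ln 2 /\ - Th <= v <= Th)) ->
     Cmod (Phi 1 1 T gam 1 (u, v)) <= 2 * M * exp (T / 2)).
  { intros u v Hu Hv.
    assert (HH : exp u * cos v <= / 2 /\ / 2 <= Cmod (Cexp (u, v) - 1)%C).
    { destruct Hv as [Hv | [Hv | [Hv Hv2]]].
      - subst v. pose proof (exp_pos u). split; [nra|].
        eapply Rle_trans; [|apply abs_fst_le_Cmod]. simpl. rewrite Rabs_left; nra.
      - subst v. rewrite cos_neg. pose proof (exp_pos u). split; [nra|].
        eapply Rle_trans; [|apply abs_fst_le_Cmod]. simpl. rewrite cos_neg, Rabs_left; nra.
      - subst u. rewrite exp_Ropp, exp_ln by lra. pose proof (COS_bound v). split; [lra|].
        assert (Cmod (Cexp ((- ln 2)%R, v)) = / 2).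
        { rewrite Cmod_Cexp. simpl. rewrite exp_Ropp, exp_ln by lra. reflexivity. }
        assert (Cmod (RtoC 1) <= Cmod (Cexp ((- ln 2)%R, v)) + Cmod (Cexp ((- ln 2)%R, v) - 1)%C).
        { replace (RtoC 1) with (Cexp ((- ln 2)%R, v) + - (Cexp ((- ln 2)%R, v) - 1))%C at 1 by ring.
          eapply Rle_trans; [apply Cmod_triangle|]. rewrite Cmod_opp. lra. }
        rewrite Cmod_1 in H1. lra. }
    destruct HH as [H1 H2].
    eapply Rle_trans; [apply Cmod_Phi_1_le with (d := / 2); [lra | exact H2]|].
    replace (2 * M * exp (T / 2)) with (exp (T / 2 + Rabs gam * (U + ln 2)) / / 2)
      by (rewrite exp_plus; unfold M; field).
    apply Rmult_le_compat_r; [rewrite Rinv_inv; lra|].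
    apply exp_le. specialize (HM u Hu). nra. }
  unfold Kc.
  assert (B1 : Cmod (CI (fun u => Phi 1 1 T gam 1 (u, Th)) (- ln 2) U) <= 2 * M * exp (T / 2) * (U - - ln 2)).
  { apply CI_bound_const; [lra| |].
    - intros; apply ccont_Phi_u, (Reg_Kc Th HTh); auto.
    - intros; apply P; [lra|auto]. }
  assert (B2 : Cmod (CI (fun u => Phi 1 1 T gam 1 (u, - Th)) (- ln 2) U) <= 2 * M * exp (T / 2) * (U - - ln 2)).
  { apply CI_bound_const; [lra| |].
    - intros; apply ccont_Phi_u, (Reg_Kc Th HTh); auto.
    - intros; apply P; [lra|auto]. }
  assert (B3 : Cmod (CI (fun v => Phi 1 1 T gam 1 ((- ln 2)%R, v)) (- Th) Th) <= 2 * M * exp (T / 2) * (Th - - Th)).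
  { apply CI_bound_const; [lra| |].
    - intros; apply ccont_Phi_v, (Reg_Kc Th HTh); auto.
    - intros; apply P; [lra|]. right; right; split; [reflexivity | lra]. }
  eapply Rle_trans; [apply Cmod_triangle|].
  eapply Rle_trans; [apply Rplus_le_compat_r, Cmod_triangle|].
  rewrite Cmod_opp, Cmod_mult, Cmod_Ci. lra.
Qed.

(** * Identification of the limit of [cB] with 1 / Gamma *)

Definition Gint (be u v : R) : R := RInt (fun t => Rpower t (be - 1) * exp (- t)) u v.

Lemma Gint_integrand_continuous be t : 0 < t -> continuous (fun t => Rpower t (be - 1) * exp (- t)) t.
Proof.
  intros Ht. apply (ex_derive_continuous (V:=R_NormedModule)). unfold Rpower. auto_derive. exact Ht.
Qed.

Lemma cd_arc (Th U gam T : R) :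
  cd (fun t => CI (fun v => Phi 1 1 t gam 0 (U, v)) (- Th) Th) T
     (CI (fun v => Phi 1 1 T (gam + 1) 0 (U, v)) (- Th) Th).
Proof.
  apply (cd_CI_t 1 1 gam 0 (fun v => (U, v))). intros x _. split; [apply ccont_pair_r | apply Reg_0].
Qed.

(** The function exp (- s) [Kc] is a primitive of the integrand: by [Kc_diff] its derivative has no
    pole left, and by [Kc_Cauchy] the contour may be replaced by the arc of radius e^U. *)
Lemma Hankel_integral (Th : R) (HTh : PI / 2 < Th <= PI) U gam u v : - ln 2 <= U -> u <= v ->
  CI (fun s => Ci * (RtoC (exp (- s)) * CI (fun y => Phi 1 1 s gam 0 (U, y)) (- Th) Th))%C u v
  = (RtoC (exp (- v)) * Kc Th U (Phi 1 1 v gam 1) - RtoC (exp (- u)) * Kc Th U (Phi 1 1 u gam 1))%C.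
Proof.
  intros HU Huv.
  assert (DE : forall s, cd (fun s => RtoC (exp (- s))) s (RtoC (- exp (- s)))).
  { intros s. apply cd_RtoC. auto_derive; [exact I | ring]. }
  apply (CI_derive (fun s => RtoC (exp (- s)) * Kc Th U (Phi 1 1 s gam 1))%C).
  - intros s _. eapply cd_eq; [|apply cd_mult; [apply DE | apply (cd_Kc Th HTh)]].
    cbv beta. rewrite RtoC_opp.
    transitivity (RtoC (exp (- s)) * (Kc Th U (Phi 1 1 s (gam + 1) 1) - Kc Th U (Phi 1 1 s gam 1)))%C; [ring|].
    rewrite (Kc_diff Th HTh), (Kc_Cauchy Th HTh) by exact HU. ring.
  - intros s _. apply ccont_cmult. apply ccont_mult.
    + eapply cd_ccont; apply DE.
    + eapply cd_ccont; apply cd_arc.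
Qed.

Lemma arc_scale Th be U s : 0 < s ->
  CI (fun v => Phi 1 1 s (1 - be) 0 (U, v)) (- Th) Th
  = (RtoC (2 * PI * Rpower s (be - 1)) * cB Th be (U + ln s))%C.
Proof.
  intros Hs. unfold cB. pose proof PI_RGT_0.
  rewrite (CI_ext _ (fun v => RtoC (Rpower s (be - 1)) * Phi 1 1 1 (1 - be) 0 ((U + ln s)%R, v))%C).
  2:{ intros v _. rewrite Phi_0_scale by exact Hs. do 3 f_equal. ring. }
  rewrite CI_scal by (intros; apply ccont_Phi_v, Reg_0).
  rewrite RtoC_mult, RtoC_inv by lra. field. apply RtoC_neq; lra.
Qed.

(** With gam = 1 - be the left side of [Hankel_integral] is 2 pi i times the integral of exp (- s)
    s^(be-1) cB(U + ln s), close to [cc] times the Gamma integral. The right side is a boundary term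
    at v, which decays, minus one at u, which tends to -2 pi i up to a small arc. Dividing by 2 pi i
    gives the limit 1. *)
Lemma Hankel_Gamma_limit (Th : R) (HTh : PI / 2 < Th <= PI) be (cc : CC) : 1 < be ->
  (forall U, Cmod (cB Th be U - cc)%C <= / (PI * (be - 1)) * exp ((1 - be) * U)) ->
  forall eps, 0 < eps -> exists del, 0 < del /\ exists M, 0 < M /\
    forall u v, 0 < u < del -> M < v -> u <= v -> Cmod (cc * RtoC (Gint be u v) - 1)%C < eps.
Proof.
  intros Hbe Hcc eps Heps. pose proof PI_RGT_0 as HPi. pose proof PI2_1 as HPi2.
  pose proof ln_2_pos as Hl.
  (* The term 2 / (be - 1) comes from writing [cc] for [cB], the term 2 pi from the arc [AU]. [U] is
     taken so large that both together stay below eps; with the two boundary terms this makes 3 eps,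
     less than 2 pi eps. *)
  set (c1 := 2 / (be - 1) + 2 * PI).
  assert (Hi : 0 < 2 / (be - 1)) by (apply Rdiv_lt_0_compat; lra).
  assert (Hc1 : 0 < c1) by (unfold c1; lra).
  destruct (exp_neg_lt_eps (be - 1) (eps / c1)) as [U0 [HU0 HU]]; [lra | apply Rdiv_lt_0_compat; lra|].
  set (U := Rmax U0 1).
  assert (HUU0 : U0 <= U) by apply Rmax_l. assert (HU1 : 1 <= U) by apply Rmax_r.
  specialize (HU U HUU0).
  replace (- (be - 1) * U) with ((1 - be) * U) in HU by ring.
  destruct (Kc_bound Th HTh U (1 - be)) as [K [HK0 HK]]; [lra|].
  destruct (exp_neg_lt_eps (/ 2) (eps / (K + 1))) as [M [HM0 HM]]; [lra | apply Rdiv_lt_0_compat; lra|].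
  set (Q := fun T => (RtoC (exp (- T)) * Kc Th U (Phi 1 1 T (1 - be) 1))%C).
  assert (HQ : continuous (fun T => Cmod (Q T - Q 0)%C) 0).
  { apply (continuous_Cmod (fun T => (Q T - Q 0)%C)). apply ccont_plus; [|apply ccont_const].
    unfold Q. apply ccont_mult.
    - apply ccont_RtoC. apply (ex_derive_continuous (V:=R_NormedModule)). auto_derive; exact I.
    - eapply cd_ccont. apply (cd_Kc Th HTh). }
  destruct (proj1 (filterlim_locally _ _) HQ (mkposreal eps Heps)) as [del Hdel].
  exists del. split; [apply cond_pos|]. exists M. split; [exact HM0|]. intros u v Hu Hv Huv.
  assert (HQu : Cmod (Q u - Q 0)%C < eps).
  { assert (B : ball 0 del u).
    { unfold ball; simpl; unfold AbsRing_ball, abs, minus, plus, opp; simpl. rewrite Rabs_right; lra. }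
    specialize (Hdel u B). unfold ball in Hdel; simpl in Hdel.
    unfold AbsRing_ball, abs, minus, plus, opp in Hdel; simpl in Hdel.
    replace (Q 0 - Q 0)%C with (RtoC 0) in Hdel by ring.
    rewrite Cmod_0, Ropp_0, Rplus_0_r, Rabs_right in Hdel by (apply Rle_ge, Cmod_ge_0).
    exact Hdel. }
  assert (HQv : Cmod (Q v) < eps).
  { unfold Q. rewrite Cmod_mult, Cmod_R, Rabs_right by (left; apply exp_pos).
    apply Rle_lt_trans with (exp (- v) * (K * exp (v / 2))).
    - apply Rmult_le_compat_l; [left; apply exp_pos | apply HK; lra].
    - replace (exp (- v) * (K * exp (v / 2))) with (K * exp (- / 2 * v)).
      + specialize (HM v ltac:(lra)).
        apply Rle_lt_trans with ((K + 1) * exp (- / 2 * v)).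
        * pose proof (exp_pos (- / 2 * v)). nra.
        * apply Rmult_lt_reg_l with (/ (K + 1)); [apply Rinv_0_lt_compat; lra|].
          rewrite <- Rmult_assoc, Rinv_l, Rmult_1_l by lra.
          unfold Rdiv in HM. lra.
      + replace (- / 2 * v) with (- v + v / 2) by field. rewrite exp_plus. ring. }
  set (AU := CI (fun y => Phi 1 1 0 (1 - be) 1 (U, y)) (- Th) Th).
  assert (HAU : Cmod AU <= 2 * PI * exp ((1 - be) * U)).
  { apply Rle_trans with (exp ((1 - be) * U) * (Th - - Th)).
    - apply CI_bound_const; [lra| |].
      + intros y Hy. apply ccont_Phi_v, Reg_unit; [apply Rabs_def1; lra | left; lra].
      + intros y Hy. eapply Rle_trans; [apply (Cmod_Phi_1_le _ _ _ _ 1); [lra|]|].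
        * assert (Cmod (Cexp (U, y)) <= Cmod (Cexp (U, y) - 1)%C + Cmod (RtoC 1)).
          { replace (Cexp (U, y)) with ((Cexp (U, y) - 1) + 1)%C at 1 by ring. apply Cmod_triangle. }
          rewrite Cmod_1, Cmod_Cexp in H. simpl in H. pose proof (exp_ineq1_le U). lra.
        * right. unfold Rdiv. rewrite Rinv_1, Rmult_1_r, Rmult_0_l, Rplus_0_l. reflexivity.
    - pose proof (exp_pos ((1 - be) * U)). nra. }
  assert (HQ0 : Q 0 = (Ci * AU - RtoC (2 * PI) * Ci)%C).
  { unfold Q. rewrite (Kc_residue Th HTh) by lra. rewrite Ropp_0, exp_0. fold AU. ring. }
  set (g := fun t => Rpower t (be - 1) * exp (- t)).
  assert (Hgc : forall t, 0 < t -> continuous g t) by (intros; apply Gint_integrand_continuous; assumption).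
  set (H := fun s => (RtoC (exp (- s)) * CI (fun y => Phi 1 1 s (1 - be) 0 (U, y)) (- Th) Th)%C).
  assert (HHc : forall s, ccont H s).
  { intros s. apply ccont_mult.
    - apply ccont_RtoC. apply (ex_derive_continuous (V:=R_NormedModule)). auto_derive; exact I.
    - eapply cd_ccont; apply cd_arc. }
  assert (HI1 : (Ci * CI H u v = Q v - Q u)%C).
  { rewrite <- CI_scal by auto. apply (Hankel_integral Th HTh); lra. }
  assert (HI2 : CI (fun s => RtoC (2 * PI * g s) * cc)%C u v = (RtoC (2 * PI) * (cc * RtoC (Gint be u v)))%C).
  { rewrite (CI_ext _ (fun s => (RtoC (2 * PI) * cc) * RtoC (g s))%C).
    2:{ intros; rewrite RtoC_mult; ring. }
    rewrite CI_scal.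
    2:{ intros x Hx. rewrite Rmin_left in Hx by lra. apply ccont_RtoC, Hgc; lra. }
    replace (CI (fun s => RtoC (g s)) u v) with (RtoC (Gint be u v)); [ring|].
    apply C_ext; simpl; [reflexivity|]. rewrite RInt_const. unfold scal; simpl; unfold mult; simpl. ring. }
  assert (HI3 : Cmod (RtoC (2 * PI) * (cc * RtoC (Gint be u v)) - CI H u v)%C
                <= 2 / (be - 1) * exp ((1 - be) * U)).
  { rewrite <- HI2.
    assert (Cg : forall x, u <= x <= v -> ccont (fun s => RtoC (2 * PI * g s) * cc)%C x).
    { intros x Hx. apply ccont_mult; [|apply ccont_const]. apply ccont_RtoC.
      apply (continuous_scal_r (V:=R_NormedModule)). apply Hgc; lra. }
    replace (CI (fun s => RtoC (2 * PI * g s) * cc)%C u v - CI H u v)%C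
      with (CI (fun s => RtoC (2 * PI * g s) * cc + (- (1)) * H s)%C u v).
    2:{ rewrite CI_plus, CI_scal; auto; [ring| |].
        - intros x Hx; rewrite Rmin_left, Rmax_right in Hx by lra; apply Cg; lra.
        - intros; apply ccont_cmult; auto. }
    (* The error exp ((1 - be) (U + ln s)) carries s^(1-be), which cancels s^(be-1) exactly. The
       majorant is therefore integrable down to s = 0. *)
    set (k := fun s => 2 / (be - 1) * exp ((1 - be) * U) * exp (- s)).
    assert (HR : is_RInt k u v (2 / (be - 1) * exp ((1 - be) * U) * - exp (- v)
                                - 2 / (be - 1) * exp ((1 - be) * U) * - exp (- u))).
    { apply (is_RInt_derive (V:=R_CompleteNormedModule) (fun s => 2 / (be - 1) * exp ((1 - be) * U) * - exp (- s))).
      - intros x _. unfold k. auto_derive; [exact I|]. field. lra.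
      - intros x _. unfold k. apply (ex_derive_continuous (V:=R_NormedModule)). auto_derive; exact I. }
    pose proof (exp_pos ((1 - be) * U)) as He.
    apply Rle_trans with (RInt k u v).
    - apply CI_bound; auto.
      + intros x Hx. apply ccont_plus; [apply Cg; exact Hx|]. apply ccont_cmult; auto.
      + eexists; exact HR.
      + intros s Hs. unfold H. rewrite arc_scale by lra.
        replace (RtoC (2 * PI * g s) * cc + - (1) * (RtoC (exp (- s)) * (RtoC (2 * PI * Rpower s (be - 1)) * cB Th be (U + ln s))))%C
          with (RtoC (- (2 * PI * g s)) * (cB Th be (U + ln s) - cc))%C.
        2:{ unfold g. rewrite RtoC_opp, !RtoC_mult. ring. }
        assert (Hg : 0 < g s) by (unfold g, Rpower; apply Rmult_lt_0_compat; apply exp_pos).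
        rewrite Cmod_mult, Cmod_R, Rabs_Ropp, Rabs_right by nra.
        eapply Rle_trans; [apply Rmult_le_compat_l; [nra | apply Hcc]|].
        right. unfold g, k, Rpower.
        replace ((1 - be) * (U + ln s)) with ((1 - be) * U + - ((be - 1) * ln s)) by ring.
        rewrite exp_plus, (exp_Ropp ((be - 1) * ln s)).
        pose proof (exp_pos ((be - 1) * ln s)). field. repeat split; lra.
    - rewrite (is_RInt_unique _ _ _ _ HR).
      assert (exp (- u) <= 1) by (rewrite <- exp_0; apply exp_le; lra).
      pose proof (exp_pos (- v)).
      assert (0 < 2 / (be - 1) * exp ((1 - be) * U)) by nra. nra. }
  assert (Hfin : Cmod (RtoC (2 * PI) * (cc * RtoC (Gint be u v) - 1))%C < 2 * PI * eps).
  { replace (RtoC (2 * PI) * (cc * RtoC (Gint be u v) - 1))%C with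
      ((RtoC (2 * PI) * (cc * RtoC (Gint be u v)) - CI H u v)
       + (- Ci * (Q v) + (Ci * (Q u - Q 0) + - AU)))%C.
    2:{ assert (E : CI H u v = (- Ci * (Q v - Q u))%C).
        { rewrite <- HI1. replace (- Ci * (Ci * CI H u v))%C with (- (Ci * Ci) * CI H u v)%C by ring.
          replace (Ci * Ci)%C with (- (1))%C by (apply C_ext; simpl; ring). ring. }
        rewrite E, HQ0.
        replace (Ci * (Q u - (Ci * AU - RtoC (2 * PI) * Ci)))%C
          with (Ci * Q u + - (Ci * Ci) * (AU - RtoC (2 * PI)))%C by ring.
        replace (Ci * Ci)%C with (- (1))%C by (apply C_ext; simpl; ring). ring. }
    eapply Rle_lt_trans; [apply Cmod_triangle|].
    assert (B1 : Cmod (- Ci * Q v)%C < eps) by (rewrite Cmod_mult, Cmod_opp, Cmod_Ci; lra).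
    assert (B2 : Cmod (Ci * (Q u - Q 0))%C < eps) by (rewrite Cmod_mult, Cmod_Ci; lra).
    assert (B3 : Cmod (- Ci * Q v + (Ci * (Q u - Q 0) + - AU))%C
        <= Cmod (- Ci * Q v)%C + (Cmod (Ci * (Q u - Q 0))%C + Cmod AU)).
    { eapply Rle_trans; [apply Cmod_triangle|]. apply Rplus_le_compat_l.
      eapply Rle_trans; [apply Cmod_triangle|]. rewrite Cmod_opp. lra. }
    assert (B4 : c1 * exp ((1 - be) * U) < eps).
    { apply Rmult_lt_reg_l with (/ c1); [apply Rinv_0_lt_compat; lra|].
      rewrite <- Rmult_assoc, Rinv_l, Rmult_1_l by lra. unfold Rdiv in HU. lra. }
    unfold c1 in B4. nra. }
  rewrite Cmod_mult, Cmod_R, Rabs_right in Hfin by lra.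
  apply Rmult_lt_reg_l with (2 * PI); [lra | exact Hfin].
Qed.

Lemma RInt_eq_RInt f a b : ex_RInt f a b -> RInt_eq f a b (RInt f a b).
Proof. intros H. exists (ex_RInt_Reals_0 f a b H). symmetry. apply RInt_Reals. Qed.

Lemma RInt_eq_inv f a b l : RInt_eq f a b l -> ex_RInt f a b /\ RInt f a b = l.
Proof.
  intros [pr <-]. split; [apply ex_RInt_Reals_1, pr | apply RInt_Reals].
Qed.

Lemma Gint_ex be u v : 0 < u -> 0 < v -> ex_RInt (fun t => Rpower t (be - 1) * exp (- t)) u v.
Proof.
  intros Hu Hv. apply (ex_RInt_continuous (V:=R_CompleteNormedModule)). intros t Ht.
  apply Gint_integrand_continuous. apply Rlt_le_trans with (Rmin u v); [apply Rmin_glb_lt; assumption | apply Ht].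
Qed.

Lemma is_Gamma_Gint x l :
  is_Gamma x l <->
  (forall eps, 0 < eps -> exists del, 0 < del /\ exists M,
    forall u v, 0 < u < del -> M < v -> 0 < v -> Rabs (Gint x u v - l) < eps).
Proof.
  split; intros H eps Heps; destruct (H eps Heps) as [del [Hdel [M HM]]].
  - exists del; split; [exact Hdel|]. exists M. intros u v Hu Hv Hv0.
    destruct (HM u v Hu Hv) as [J [HJ1 HJ2]]. apply RInt_eq_inv in HJ1. destruct HJ1 as [_ <-]. exact HJ2.
  - exists del; split; [exact Hdel|]. exists (Rmax M 0). intros u v Hu Hv.
    assert (M < v) by (eapply Rle_lt_trans; [apply Rmax_l | exact Hv]).
    assert (0 < v) by (eapply Rle_lt_trans; [apply Rmax_r | exact Hv]).
    exists (Gint x u v). split; [apply RInt_eq_RInt, Gint_ex; lra | apply HM; auto].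
Qed.

Lemma is_Gamma_unique x l1 l2 : is_Gamma x l1 -> is_Gamma x l2 -> l1 = l2.
Proof.
  intros G1 G2. pose proof (proj1 (is_Gamma_Gint _ _) G1) as H1; pose proof (proj1 (is_Gamma_Gint _ _) G2) as H2.
  apply cond_eq. intros e He.
  destruct (H1 (e / 2)) as [d1 [Hd1 [M1 HM1]]]; [lra|].
  destruct (H2 (e / 2)) as [d2 [Hd2 [M2 HM2]]]; [lra|].
  set (u := Rmin d1 d2 / 2). set (v := Rmax (Rmax M1 M2) 0 + 1).
  assert (Hu : 0 < u < d1 /\ u < d2).
  { assert (0 < Rmin d1 d2) by (apply Rmin_glb_lt; auto).
    pose proof (Rmin_l d1 d2). pose proof (Rmin_r d1 d2). unfold u; lra. }
  assert (Hv : M1 < v /\ M2 < v /\ 0 < v).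
  { pose proof (Rmax_l M1 M2). pose proof (Rmax_r M1 M2).
    pose proof (Rmax_l (Rmax M1 M2) 0). pose proof (Rmax_r (Rmax M1 M2) 0). unfold v; lra. }
  specialize (HM1 u v ltac:(lra) ltac:(lra) ltac:(lra)).
  specialize (HM2 u v ltac:(lra) ltac:(lra) ltac:(lra)).
  apply Rabs_def2 in HM1; apply Rabs_def2 in HM2. apply Rabs_def1; lra.
Qed.

Lemma Gamma_eq x l : is_Gamma x l -> Gamma x = l.
Proof.
  intros H. apply is_Gamma_unique with x; [|exact H].
  unfold Gamma. apply epsilon_spec. exists l. exact H.
Qed.

(** Since cc times the Gamma integral tends to 1, Re cc is nonzero and the Gamma integral converges
    to 1 / Re cc. As Im cc times the same integral tends to 0 and its limit is nonzero, Im cc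
    vanishes. *)
Lemma Hankel_Gamma (Th : R) (HTh : PI / 2 < Th <= PI) be (cc : CC) : 1 < be ->
  (forall U, Cmod (cB Th be U - cc)%C <= / (PI * (be - 1)) * exp ((1 - be) * U)) ->
  exists l, l <> 0 /\ is_Gamma be l /\ cc = RtoC (/ l).
Proof.
  intros Hbe Hcc. pose proof (Hankel_Gamma_limit Th HTh be cc Hbe Hcc) as HL.
  assert (Hfst : forall eps, 0 < eps -> exists del, 0 < del /\ exists M, 0 < M /\
    forall u v, 0 < u < del -> M < v -> u <= v ->
      Rabs (fst cc * Gint be u v - 1) < eps /\ Rabs (snd cc * Gint be u v) < eps).
  { intros eps Heps. destruct (HL eps Heps) as [del [Hd [M [HM0 HM]]]].
    exists del; split; [exact Hd|]. exists M; split; [exact HM0|]. intros u v Hu Hv Huv.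
    specialize (HM u v Hu Hv Huv). split.
    - eapply Rle_lt_trans; [|exact HM]. eapply Rle_trans; [|apply abs_fst_le_Cmod]. simpl. right; f_equal; ring.
    - eapply Rle_lt_trans; [|exact HM]. eapply Rle_trans; [|apply abs_snd_le_Cmod]. simpl. right; f_equal; ring. }
  assert (Hc0 : fst cc <> 0).
  { intros E. destruct (Hfst (/ 2)) as [del [Hd [M [HM0 HM]]]]; [lra|].
    destruct (HM (Rmin (del / 2) M) (M + 1)) as [H1 _].
    - split; [apply Rmin_glb_lt; lra|]. eapply Rle_lt_trans; [apply Rmin_l|]; lra.
    - lra.
    - eapply Rle_trans; [apply Rmin_r|]; lra.
    - rewrite E, Rmult_0_l, Rabs_left in H1; lra. }
  exists (/ fst cc). split; [apply Rinv_neq_0_compat; exact Hc0|].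
  assert (HG : forall eps, 0 < eps -> exists del, 0 < del /\ exists M,
    forall u v, 0 < u < del -> M < v -> Rabs (Gint be u v - / fst cc) < eps /\ Rabs (snd cc * Gint be u v) < eps).
  { intros eps Heps.
    assert (Hp : 0 < Rabs (fst cc)) by (apply Rabs_pos_lt; exact Hc0).
    destruct (Hfst (Rmin eps (Rabs (fst cc) * eps))) as [del [Hd [M [HM0 HM]]]].
    { apply Rmin_glb_lt; [lra|]. apply Rmult_lt_0_compat; assumption. }
    (* The minimum with M ensures u < M < v, hence the order u <= v that [Hfst] asks for. *)
    exists (Rmin del M). split; [apply Rmin_glb_lt; assumption|]. exists M. intros u v Hu Hv.
    assert (u < del) by (eapply Rlt_le_trans; [apply Hu | apply Rmin_l]).
    assert (u < M) by (eapply Rlt_le_trans; [apply Hu | apply Rmin_r]).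
    destruct (HM u v) as [H1 H2]; try lra. split.
    - apply Rmult_lt_reg_l with (Rabs (fst cc)); [exact Hp|].
      rewrite <- Rabs_mult. replace (fst cc * (Gint be u v - / fst cc)) with (fst cc * Gint be u v - 1) by (field; exact Hc0).
      eapply Rlt_le_trans; [exact H1 | apply Rmin_r].
    - eapply Rlt_le_trans; [exact H2 | apply Rmin_l]. }
  split.
  - apply (proj2 (is_Gamma_Gint _ _)). intros eps Heps. destruct (HG eps Heps) as [del [Hd [M HM]]].
    exists del; split; [exact Hd|]. exists M. intros u v Hu Hv _. apply HM; assumption.
  - rewrite Rinv_inv. apply C_ext; simpl; [reflexivity|].
    assert (Hs : Rabs (snd cc * / fst cc) = 0).
    { apply Rle_antisym; [|apply Rabs_pos]. apply le_epsilon. intros eps Heps.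
      set (K := Rabs (snd cc) + 1).
      assert (HK : 0 < K) by (unfold K; pose proof (Rabs_pos (snd cc)); lra).
      destruct (HG (eps / 2 / K)) as [d1 [Hd1 [M1 HM1]]]; [repeat apply Rdiv_lt_0_compat; lra|].
      destruct (HG (eps / 2)) as [d2 [Hd2 [M2 HM2]]]; [lra|].
      set (u := Rmin d1 d2 / 2). set (v := Rmax M1 M2 + 1).
      assert (Hu : 0 < u < d1 /\ u < d2).
      { assert (0 < Rmin d1 d2) by (apply Rmin_glb_lt; auto).
        pose proof (Rmin_l d1 d2). pose proof (Rmin_r d1 d2). unfold u; lra. }
      assert (Hv : M1 < v /\ M2 < v).
      { pose proof (Rmax_l M1 M2). pose proof (Rmax_r M1 M2). unfold v; lra. }
      destruct (HM1 u v) as [H1 _]; try lra. destruct (HM2 u v) as [_ H2]; try lra.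
      replace (snd cc * / fst cc) with (snd cc * Gint be u v + - (snd cc * (Gint be u v - / fst cc))) by ring.
      eapply Rle_trans; [apply Rabs_triang|]. rewrite Rabs_Ropp, (Rabs_mult (snd cc) (_ - _)).
      assert (Rabs (snd cc) * Rabs (Gint be u v - / fst cc) <= K * (eps / 2 / K)).
      { apply Rmult_le_compat; try apply Rabs_pos; [unfold K; lra | left; exact H1]. }
      replace (K * (eps / 2 / K)) with (eps / 2) in H by (field; lra). lra. }
    rewrite Rabs_mult, Rabs_inv in Hs.
    assert (0 < Rabs (fst cc)) by (apply Rabs_pos_lt; exact Hc0).
    apply Rmult_integral in Hs. destruct Hs as [Hs|Hs].
    + destruct (Req_dec (snd cc) 0) as [E|E]; [exact E|]. apply Rabs_pos_lt in E. lra.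
    + pose proof (Rinv_0_lt_compat _ H). lra.
Qed.

(** * Functional equation and growth of Gamma *)

Lemma Gint_succ x u v : 0 < u -> 0 < v ->
  x * Gint x u v - Gint (x + 1) u v = Rpower v x * exp (- v) - Rpower u x * exp (- u).
Proof.
  intros Hu Hv.
  assert (Hpos : forall t, Rmin u v <= t -> 0 < t).
  { intros t Ht. apply Rlt_le_trans with (Rmin u v); [apply Rmin_glb_lt; assumption | exact Ht]. }
  assert (D : is_RInt (fun t => x * (Rpower t (x - 1) * exp (- t)) - Rpower t (x + 1 - 1) * exp (- t)) u v
                (Rpower v x * exp (- v) - Rpower u x * exp (- u))).
  { apply (is_RInt_derive (V:=R_CompleteNormedModule) (fun t => Rpower t x * exp (- t))).
    - intros t [Ht _]. apply Hpos in Ht.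
      unfold Rpower. auto_derive; [exact Ht|].
      replace ((x - 1) * ln t) with (x * ln t + - ln t) by ring.
      replace ((x + 1 - 1) * ln t) with (x * ln t) by ring.
      rewrite exp_plus, (exp_Ropp (ln t)), exp_ln by exact Ht. field. lra.
    - intros t [Ht _]. apply Hpos in Ht.
      apply (continuous_minus (V:=R_NormedModule)).
      + apply (continuous_scal_r (V:=R_NormedModule)). apply Gint_integrand_continuous; exact Ht.
      + apply Gint_integrand_continuous; exact Ht. }
  rewrite <- (is_RInt_unique _ _ _ _ D). unfold Gint.
  rewrite (RInt_minus (V:=R_CompleteNormedModule) (fun t => x * (Rpower t (x - 1) * exp (- t)))).
  - rewrite (RInt_scal (V:=R_CompleteNormedModule) _ u v x) by (apply Gint_ex; assumption). reflexivity.
  - apply (ex_RInt_scal (V:=R_NormedModule)). apply Gint_ex; assumption.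
  - apply Gint_ex; assumption.
Qed.

(** This reaches the parameters in (0, 1], not covered by [Hankel_Gamma]. The boundary terms of the
    integration by parts in [Gint_succ] tend to 0 at both ends. *)
Lemma is_Gamma_pred x l : 0 < x -> is_Gamma (x + 1) l -> is_Gamma x (l / x).
Proof.
  intros Hx HG. pose proof (proj1 (is_Gamma_Gint _ _) HG) as H.
  apply (proj2 (is_Gamma_Gint _ _)). intros eps Heps.
  assert (He : 0 < x * eps / 3) by (apply Rdiv_lt_0_compat; [apply Rmult_lt_0_compat; lra | lra]).
  destruct (H _ He) as [d1 [Hd1 [M1 HM1]]].
  (* From ln (v / (2x)) <= v / (2x) - 1 one gets v^x <= (2x)^x e^(v/2), so the boundary term at v is
     at most (2x)^x e^(-v/2). *)
  destruct (exp_neg_lt_eps (/ 2) (x * eps / 3 / exp (x * ln (2 * x)))) as [M2 [HM20 HM2]];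
    [lra | apply Rdiv_lt_0_compat; [lra | apply exp_pos]|].
  exists (Rmin d1 (exp (ln (x * eps / 3) / x))).
  split; [apply Rmin_glb_lt; [exact Hd1 | apply exp_pos]|].
  exists (Rmax M1 M2). intros u v Hu Hv Hv0.
  assert (Hu1 : u < d1) by (eapply Rlt_le_trans; [apply Hu | apply Rmin_l]).
  assert (Hu2 : u < exp (ln (x * eps / 3) / x)) by (eapply Rlt_le_trans; [apply Hu | apply Rmin_r]).
  assert (Hv1 : M1 < v) by (eapply Rle_lt_trans; [apply Rmax_l | apply Hv]).
  assert (Hv2 : M2 < v) by (eapply Rle_lt_trans; [apply Rmax_r | apply Hv]).
  specialize (HM1 u v ltac:(lra) Hv1 Hv0). specialize (HM2 v ltac:(lra)).
  pose proof (Gint_succ x u v ltac:(lra) Hv0) as E.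
  assert (B1 : Rpower v x * exp (- v) < x * eps / 3).
  { apply Rle_lt_trans with (exp (x * ln (2 * x)) * exp (- / 2 * v)).
    - unfold Rpower. rewrite <- !exp_plus. apply exp_le.
      assert (ln v = ln (v / (2 * x)) + ln (2 * x)).
      { rewrite <- ln_mult; [f_equal; field; lra | apply Rdiv_lt_0_compat; lra | lra]. }
      assert (1 + ln (v / (2 * x)) <= v / (2 * x)).
      { eapply Rle_trans; [apply exp_ineq1_le|]. rewrite exp_ln; [lra | apply Rdiv_lt_0_compat; lra]. }
      rewrite H0. assert (x * (v / (2 * x)) = v / 2) by (field; lra).
      assert (x * (1 + ln (v / (2 * x))) <= x * (v / (2 * x))) by (apply Rmult_le_compat_l; lra).
      lra.
    - pose proof (exp_pos (x * ln (2 * x))) as Hp.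
      apply Rmult_lt_reg_l with (/ exp (x * ln (2 * x))); [apply Rinv_0_lt_compat; exact Hp|].
      rewrite <- Rmult_assoc, Rinv_l, Rmult_1_l by lra. unfold Rdiv in *. lra. }
  assert (B2 : Rpower u x * exp (- u) < x * eps / 3).
  { apply Rle_lt_trans with (Rpower u x * 1).
    - apply Rmult_le_compat_l; [left; apply exp_pos|]. rewrite <- exp_0. apply exp_le. lra.
    - rewrite Rmult_1_r. unfold Rpower. rewrite <- (exp_ln (x * eps / 3)) by exact He.
      apply exp_increasing. apply ln_increasing in Hu2; [|lra]. rewrite ln_exp in Hu2.
      apply Rmult_lt_reg_l with (/ x); [apply Rinv_0_lt_compat; lra|].
      rewrite <- Rmult_assoc, Rinv_l, Rmult_1_l by lra. unfold Rdiv in *. lra. }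
  assert (P1 : 0 < Rpower v x * exp (- v)) by (apply Rmult_lt_0_compat; apply exp_pos).
  assert (P2 : 0 < Rpower u x * exp (- u)) by (apply Rmult_lt_0_compat; apply exp_pos).
  apply Rmult_lt_reg_l with x; [exact Hx|].
  rewrite <- (Rabs_right x) at 1 by lra. rewrite <- Rabs_mult.
  replace (x * (Gint x u v - l / x)) with ((Gint (x + 1) u v - l) + (x * Gint x u v - Gint (x + 1) u v)) by (field; lra).
  rewrite E. apply Rabs_def2 in HM1. apply Rabs_def1; lra.
Qed.

(** Integration by parts along the arc: the combination on the left is the difference of p^(-be) e^p
    at the two end points, up to the factor 2 pi i. *)
Lemma cB_succ Th be U : 0 < Th ->
  Cmod (cB Th be U - RtoC be * cB Th (be + 1) U)%C <= / PI * exp (exp U * cos Th - be * U).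
Proof.
  intros HTh. pose proof PI_RGT_0 as HPi.
  assert (E : CI (fun v => Ci * dPhi 1 1 1 (- be) 0 (U, v))%C (- Th) Th =
    (Phi 1 1 1 (- be) 0 (U, Th) - Phi 1 1 1 (- be) 0 (U, (- Th)%R))%C).
  { apply (CI_derive (fun v => Phi 1 1 1 (- be) 0 (U, v))).
    - intros v _. apply (cd_Phi 1 1 1 (- be) 0 (fun y => (U, y)) v Ci (Reg_0 _ _ _) (cd_line_v U v)).
    - intros v _. apply ccont_cmult.
      apply (ccont_dPhi 1 1 1 (- be) 0 (fun y => (U, y)) v (Reg_0 _ _ _) (ccont_pair_r U v)). }
  assert (Cc : forall g v, ccont (fun v => Phi 1 1 1 g 0 (U, v)) v) by (intros; apply ccont_Phi_v, Reg_0).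
  rewrite (CI_ext _ (fun v => Ci * (Phi 1 1 1 (1 - be) 0 (U, v) + RtoC (- be) * Phi 1 1 1 (1 - (be + 1)) 0 (U, v)))%C) in E.
  2:{ intros v _. unfold dPhi. simpl INR. rewrite Rmult_0_l.
      replace (- be + 1) with (1 - be) by ring. replace (1 - (be + 1)) with (- be) by ring. ring. }
  rewrite CI_scal in E.
  2:{ intros; apply ccont_plus; [apply Cc | apply ccont_cmult; apply Cc]. }
  rewrite CI_plus in E; [|intros; apply Cc | intros; apply ccont_cmult; apply Cc].
  rewrite CI_scal in E by (intros; apply Cc).
  replace (cB Th be U - RtoC be * cB Th (be + 1) U)%C with
    (RtoC (/ (2 * PI)) * (- Ci) * (Phi 1 1 1 (- be) 0 (U, Th) - Phi 1 1 1 (- be) 0 (U, (- Th)%R)))%C.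
  2:{ rewrite <- E. unfold cB. rewrite RtoC_opp.
      set (A := CI _ _ _). set (B := CI (fun x => Phi 1 1 1 (1 - (be + 1)) 0 (U, x)) (- Th) Th).
      transitivity (RtoC (/ (2 * PI)) * - (Ci * Ci) * (A + - be * B))%C; [ring|].
      replace (Ci * Ci)%C with (- (1))%C by (apply C_ext; simpl; ring). ring. }
  rewrite !Cmod_mult, Cmod_opp, Cmod_Ci, Cmod_R, Rabs_right
    by (apply Rle_ge; left; apply Rinv_0_lt_compat; lra).
  replace (/ PI * exp (exp U * cos Th - be * U)) with (/ (2 * PI) * 1 * (exp (exp U * cos Th - be * U) + exp (exp U * cos Th - be * U)))
    by (field; lra).
  apply Rmult_le_compat_l; [rewrite Rmult_1_r; left; apply Rinv_0_lt_compat; lra|].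
  eapply Rle_trans; [apply Cmod_triangle|]. rewrite Cmod_opp, !Cmod_Phi_0, cos_neg.
  right; f_equal; f_equal; ring.
Qed.

(** The Laplace argument needs be > 1. The value be = 1, which occurs as the term k = 0 of the
    series, is obtained from be = 2 by letting U grow in [cB_succ]. *)
Lemma cB_Gamma (Th : R) (HTh : PI / 2 < Th <= PI) be : 1 <= be ->
  exists l, l <> 0 /\ is_Gamma be l /\ forall U,
    Cmod (cB Th be U - RtoC (/ l))%C <= / (PI * - cos Th) * exp (- be * U + exp U * cos Th).
Proof.
  intros Hbe. pose proof PI_RGT_0 as HPi. pose proof (cos_Th_neg Th HTh) as Hc.
  assert (HTh0 : 0 < Th) by lra.
  assert (Big : forall be, 1 < be -> exists l, l <> 0 /\ is_Gamma be l /\ forall U,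
    Cmod (cB Th be U - RtoC (/ l))%C <= / (PI * - cos Th) * exp (- be * U + exp U * cos Th)).
  { intros b Hb. destruct (cB_limit Th b) as [cc Hcc]; [lra|exact Hc|lra|].
    destruct (Hankel_Gamma Th HTh b cc Hb) as [l [Hl [HG ->]]].
    - intros U. apply Hcc; exact Hb.
    - exists l. split; [exact Hl|]. split; [exact HG|]. intros U; apply (proj1 (Hcc U)). }
  destruct Hbe as [Hbe|<-]; [apply Big; exact Hbe|].
  destruct (Big 2) as [l [Hl [HG HB]]]; [lra|].
  destruct (cB_limit Th 1) as [cc Hcc]; [lra|exact Hc|lra|].
  exists l. split; [exact Hl|]. split.
  { replace l with (l / 1) by field. apply is_Gamma_pred; [lra|]. replace (1 + 1) with 2 by ring. exact HG. }
  assert (E : cc = RtoC (/ l)).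
  { assert (Z : Cmod (cc - RtoC (/ l))%C = 0).
    { apply Rle_antisym; [|apply Cmod_ge_0]. apply le_epsilon. intros e He.
      set (K := / (PI * - cos Th) + / PI + / (PI * - cos Th)).
      assert (HK1 : 0 < / (PI * - cos Th)) by (apply Rinv_0_lt_compat, Rmult_lt_0_compat; lra).
      assert (HK2 : 0 < / PI) by (apply Rinv_0_lt_compat; lra).
      assert (HK : 0 < K) by (unfold K; lra).
      destruct (exp_neg_lt_eps (- cos Th) (e / K)) as [U [HU HU2]]; [lra | apply Rdiv_lt_0_compat; lra|].
      specialize (HU2 U ltac:(lra)).
      assert (HX : exp U * cos Th <= - - cos Th * U).
      { pose proof (exp_ineq1_le U). nra. }
      set (X := exp (- - cos Th * U)) in *.
      assert (A1 : Cmod (cB Th 1 U - cc)%C <= / (PI * - cos Th) * X).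
      { eapply Rle_trans; [apply (proj1 (Hcc U))|]. apply Rmult_le_compat_l; [lra|]. apply exp_le. lra. }
      assert (A2 : Cmod (cB Th 1 U - RtoC 1 * cB Th 2 U)%C <= / PI * X).
      { replace 2 with (1 + 1) by ring. eapply Rle_trans; [apply cB_succ; lra|].
        apply Rmult_le_compat_l; [lra|]. apply exp_le. lra. }
      assert (A3 : Cmod (cB Th 2 U - RtoC (/ l))%C <= / (PI * - cos Th) * X).
      { eapply Rle_trans; [apply HB|]. apply Rmult_le_compat_l; [lra|]. apply exp_le. lra. }
      replace (cc - RtoC (/ l))%C with (- (cB Th 1 U - cc) + ((cB Th 1 U - RtoC 1 * cB Th 2 U) + (cB Th 2 U - RtoC (/ l))))%C by ring.
      eapply Rle_trans; [apply Cmod_triangle|]. rewrite Cmod_opp.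
      eapply Rle_trans; [apply Rplus_le_compat_l, Cmod_triangle|].
      assert (K * X <= e).
      { left. apply Rmult_lt_reg_l with (/ K); [apply Rinv_0_lt_compat; exact HK|].
        rewrite <- Rmult_assoc, Rinv_l, Rmult_1_l by lra. unfold Rdiv in HU2; lra. }
      unfold K in H. lra. }
    apply Cmod_eq_0 in Z. replace cc with ((cc - RtoC (/ l)) + RtoC (/ l))%C by ring. rewrite Z. ring. }
  intros U. rewrite <- E. apply (proj1 (Hcc U)).
Qed.

Lemma Gamma_ge_1_neq_0 be : 1 <= be -> Gamma be <> 0 /\ is_Gamma be (Gamma be).
Proof.
  intros Hbe. pose proof PI_RGT_0.
  destruct (cB_Gamma PI ltac:(lra) be Hbe) as [l [Hl [HG _]]].
  rewrite (Gamma_eq _ _ HG). auto.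
Qed.

Lemma Gamma_succ x : 0 < x -> Gamma (x + 1) = x * Gamma x.
Proof.
  intros Hx. destruct (Gamma_ge_1_neq_0 (x + 1)) as [_ HG]; [lra|].
  rewrite (Gamma_eq x _ (is_Gamma_pred _ _ Hx HG)). field. lra.
Qed.

Lemma Gamma_neq_0 x : 0 < x -> Gamma x <> 0.
Proof.
  intros Hx E. destruct (Gamma_ge_1_neq_0 (x + 1)) as [N _]; [lra|].
  apply N. rewrite Gamma_succ, E by exact Hx. ring.
Qed.

Lemma cB_Gamma_bound (Th : R) (HTh : PI / 2 < Th <= PI) be U : 1 <= be ->
    Cmod (cB Th be U - RtoC (/ Gamma be))%C <= / (PI * - cos Th) * exp (- be * U + exp U * cos Th).
Proof.
  intros Hbe. destruct (cB_Gamma Th HTh be Hbe) as [l [Hl [HG HB]]].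
  rewrite (Gamma_eq _ _ HG). apply HB.
Qed.

Lemma Cmod_cB_le Th be U : 0 < Th <= PI -> Cmod (cB Th be U) <= exp (exp U + (1 - be) * U).
Proof.
  intros HTh. pose proof PI_RGT_0. unfold cB.
  rewrite Cmod_mult, Cmod_R, Rabs_right by (apply Rle_ge; left; apply Rinv_0_lt_compat; lra).
  apply Rle_trans with (/ (2 * PI) * (exp (exp U + (1 - be) * U) * (Th - - Th))).
  - apply Rmult_le_compat_l; [left; apply Rinv_0_lt_compat; lra|].
    apply CI_bound_const; [lra| |].
    + intros; apply ccont_Phi_v, Reg_0.
    + intros v Hv. rewrite Cmod_Phi_0. apply exp_le. pose proof (COS_bound v). pose proof (exp_pos U). nra.
  - replace (exp (exp U + (1 - be) * U)) with (/ (2 * PI) * (exp (exp U + (1 - be) * U) * (2 * PI))) at 2 by (field; lra).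
    apply Rmult_le_compat_l; [left; apply Rinv_0_lt_compat; lra|].
    apply Rmult_le_compat_l; [left; apply exp_pos | lra].
Qed.

(** As U is arbitrary, Gamma grows faster than every exponential. The trivial bound of the arc
    integral and the Hankel error at Th = pi both carry the factor exp (- be U). *)
Lemma inv_Gamma_bound U : exists K, 0 < K /\ forall be, 1 <= be -> / Rabs (Gamma be) <= K * exp (- be * U).
Proof.
  pose proof PI_RGT_0 as HPi. pose proof (exp_pos U) as HU.
  exists (exp (exp U + U) + / PI).
  assert (0 < / PI) by (apply Rinv_0_lt_compat; lra).
  split; [pose proof (exp_pos (exp U + U)); lra|]. intros be Hbe.
  pose proof (cB_Gamma_bound PI ltac:(lra) be U Hbe) as H1.
  pose proof (Cmod_cB_le PI be U ltac:(lra)) as H2.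
  rewrite cos_PI in H1.
  assert (E : Cmod (RtoC (/ Gamma be)) = / Rabs (Gamma be)) by (rewrite Cmod_R; apply Rabs_inv).
  rewrite <- E. replace (RtoC (/ Gamma be)) with (cB PI be U + - (cB PI be U - RtoC (/ Gamma be)))%C by ring.
  eapply Rle_trans; [apply Cmod_triangle|]. rewrite Cmod_opp, Rmult_plus_distr_r.
  apply Rplus_le_compat.
  - eapply Rle_trans; [exact H2|]. rewrite <- exp_plus. right; f_equal; ring.
  - eapply Rle_trans; [exact H1|].
    replace (PI * - -1) with PI by ring.
    apply Rmult_le_compat_l; [lra|]. apply exp_le. lra.
Qed.
(** * Mittag-Leffler series and their asymptotics *)

(* qq lam j k = binomial(k, j) lam^(k-j), the j-th superdiagonal of the k-th power of a Jordan block. *)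
Fixpoint qq (lam : CC) (j k : nat) : CC :=
  match k with
  | O => match j with O => 1 | S _ => 0 end
  | S k' => (lam * qq lam j k' + match j with O => 0 | S j' => qq lam j' k' end)%C
  end.

Lemma qq_0_0 lam : qq lam 0 0 = 1.
Proof. reflexivity. Qed.

Lemma qq_S_0 lam j : qq lam (S j) 0 = 0.
Proof. reflexivity. Qed.

Lemma qq_0_S lam k : qq lam 0 (S k) = (lam * qq lam 0 k)%C.
Proof. simpl. ring. Qed.

Lemma qq_S_S lam j k : qq lam (S j) (S k) = (lam * qq lam (S j) k + qq lam j k)%C.
Proof. reflexivity. Qed.

Lemma qq_bound lam j k : Cmod (qq lam j k) <= (1 + Cmod lam) ^ k.
Proof.
  pose proof (Cmod_ge_0 lam) as Hl.
  revert j; induction k as [|k IH]; intros j.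
  - destruct j; [rewrite qq_0_0, Cmod_1 | rewrite qq_S_0, Cmod_0]; simpl; lra.
  - assert (HP : 0 <= (1 + Cmod lam) ^ k) by (apply pow_le; lra).
    destruct j as [|j].
    + rewrite qq_0_S, Cmod_mult. simpl. specialize (IH 0%nat).
      apply Rle_trans with (Cmod lam * (1 + Cmod lam) ^ k); [apply Rmult_le_compat_l; lra | nra].
    + rewrite qq_S_S. eapply Rle_trans; [apply Cmod_triangle|]. rewrite Cmod_mult. simpl.
      pose proof (IH j). pose proof (IH (S j)).
      assert (Cmod lam * Cmod (qq lam (S j) k) <= Cmod lam * (1 + Cmod lam) ^ k) by (apply Rmult_le_compat_l; lra).
      lra.
Qed.

(** This is (k + 1) binomial(k, j) = (j + 1) binomial(k + 1, j + 1); the power of lam is the same on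
    both sides. *)
Lemma qq_shift lam j k :
  (RtoC (INR (S k)) * qq lam j k = RtoC (INR (S j)) * qq lam (S j) (S k))%C.
Proof.
  revert j; induction k as [|k IH]; intros j.
  - rewrite qq_S_S, qq_S_0. destruct j; simpl qq; simpl INR; ring.
  - rewrite qq_S_S.
    assert (E : (RtoC (INR (S k)) * qq lam j (S k) = lam * (RtoC (INR (S k)) * qq lam j k) + RtoC (INR j) * qq lam j (S k))%C).
    { destruct j as [|i].
      - rewrite qq_0_S. simpl (INR 0). ring.
      - rewrite qq_S_S at 1. pose proof (IH i) as H.
        transitivity (lam * (RtoC (INR (S k)) * qq lam (S i) k) + RtoC (INR (S k)) * qq lam i k)%C; [ring|].
        rewrite H. ring. }
    rewrite (S_INR (S k)), (S_INR j), !RtoC_plus.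
    transitivity (RtoC (INR (S k)) * qq lam j (S k) + qq lam j (S k))%C; [ring|].
    rewrite E. pose proof (IH j) as H.
    transitivity (lam * (RtoC (INR (S j)) * qq lam (S j) (S k)) + (RtoC (INR j) + 1) * qq lam j (S k))%C.
    + rewrite <- H. ring.
    + rewrite (S_INR j), RtoC_plus. ring.
Qed.

Definition entire_seq (a : nat -> R) : Prop :=
  forall r, 0 < r -> exists K, forall k, Rabs (a k) <= K * r ^ k.

Lemma entire_CV_radius a : entire_seq a -> CV_radius a = p_infty.
Proof.
  intros H. destruct (CV_radius_bounded a) as [Hub _].
  assert (B : forall x, 0 < x -> Rbar_le x (CV_radius a)).
  { intros x Hx. apply Hub. destruct (H (/ x)) as [K HK]; [apply Rinv_0_lt_compat; exact Hx|].
    exists K. intros n. rewrite Rabs_mult, <- RPow_abs, (Rabs_right x) by lra.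
    apply Rle_trans with (K * (/ x) ^ n * x ^ n).
    - apply Rmult_le_compat_r; [apply pow_le; lra | apply HK].
    - rewrite Rmult_assoc, <- Rpow_mult_distr, Rinv_l, pow1 by lra. lra. }
  destruct (CV_radius a) as [r| |] eqn:E; auto.
  - exfalso. specialize (B (Rabs r + 1)). pose proof (Rabs_pos r). pose proof (Rle_abs r).
    simpl in B. specialize (B ltac:(lra)). lra.
  - exfalso. specialize (B 1 ltac:(lra)). exact B.
Qed.

Lemma entire_ex_pseries a x : entire_seq a -> ex_pseries a x.
Proof. intros H. apply CV_radius_inside. rewrite (entire_CV_radius a H). exact I. Qed.

Lemma entire_continuous a x : entire_seq a -> continuous (PSeries a) x.
Proof.
  intros H. apply continuity_pt_filterlim, PSeries_continuity.
  rewrite (entire_CV_radius a H). exact I.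
Qed.

Fixpoint Rsum (n : nat) (f : nat -> R) : R := match n with O => 0 | S m => Rsum m f + f m end.

Lemma entire_partial_sums a x : entire_seq a ->
  is_lim_seq (fun N => Rsum N (fun k => a k * x ^ k)) (PSeries a x).
Proof.
  intros H. pose proof (PSeries_correct a x (entire_ex_pseries a x H)) as HS.
  apply is_lim_seq_incr_1.
  apply is_lim_seq_ext with (sum_n (fun k => scal (pow_n x k) (a k))).
  - intros n. assert (E : forall k, scal (pow_n x k) (a k) = a k * x ^ k).
    { intros k. rewrite pow_n_pow. unfold scal; simpl; unfold mult; simpl. ring. }
    induction n as [|n IH].
    + rewrite sum_O, E. simpl. ring.
    + rewrite sum_Sn, IH, E. reflexivity.
  - exact HS.
Qed.

Lemma INR_le_pow2 k : INR k <= 2 ^ k.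
Proof.
  induction k as [|k IH]; [simpl; lra|]. rewrite S_INR. simpl.
  pose proof (pow_R1_Rle 2 k). lra.
Qed.

Lemma exp_INR_mult x k : exp (INR k * x) = exp x ^ k.
Proof.
  induction k as [|k IH]; [simpl; rewrite Rmult_0_l; apply exp_0|].
  rewrite S_INR, Rmult_plus_distr_r, exp_plus, IH, Rmult_1_l. simpl. ring.
Qed.

Lemma inv_Gamma_geom al be r : 0 < al < 1 -> 0 < be -> 0 < r ->
  exists K, 0 <= K /\ forall k, / Rabs (Gamma (al * INR k + be)) <= K * r ^ k.
Proof.
  intros Hal Hbe Hr.
  (* Then e^(-al U) = r / 2. The spare factor 2^(-k) absorbs y <= (1 + be) 2^k, which enters through
     1 / Gamma(y) = y / Gamma(y + 1), a detour because y may be below 1. *)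
  set (U := - ln (r / 2) / al).
  destruct (inv_Gamma_bound U) as [K [HK HB]].
  exists ((1 + be) * (K * exp (- (be + 1) * U))).
  pose proof (exp_pos (- (be + 1) * U)) as He.
  split; [apply Rmult_le_pos; [lra | apply Rmult_le_pos; lra]|].
  intros k. pose proof (pos_INR k) as Hk.
  assert (Hy : 0 < al * INR k + be) by nra.
  set (y := al * INR k + be) in *.
  assert (E : / Rabs (Gamma y) = y * / Rabs (Gamma (y + 1))).
  { rewrite Gamma_succ, Rabs_mult, (Rabs_right y) by lra.
    field. split; [apply Rabs_no_R0, Gamma_neq_0; exact Hy | lra]. }
  rewrite E.
  assert (Ek : exp (- (y + 1) * U) = exp (- (be + 1) * U) * (r / 2) ^ k).
  { rewrite <- (exp_ln (r / 2)) by lra. rewrite <- exp_INR_mult, <- exp_plus. f_equal.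
    unfold y, U. field. lra. }
  specialize (HB (y + 1) ltac:(lra)). rewrite Ek in HB.
  assert (Hyk : y <= (1 + be) * 2 ^ k).
  { pose proof (INR_le_pow2 k). pose proof (pow_R1_Rle 2 k ltac:(lra)). unfold y. nra. }
  apply Rle_trans with ((1 + be) * 2 ^ k * (K * (exp (- (be + 1) * U) * (r / 2) ^ k))).
  - apply Rmult_le_compat; try lra. left. apply Rinv_0_lt_compat, Rabs_pos_lt, Gamma_neq_0; lra.
  - right. unfold Rdiv. rewrite Rpow_mult_distr, pow_inv. field. apply pow_nonzero; lra.
Qed.

Definition mlc (al be : R) (lam : CC) (j : nat) (proj : CC -> R) (k : nat) : R :=
  proj (qq lam j k) / Gamma (al * INR k + be).

(* x^j E^(j)(lam x) / j! with E the Mittag-Leffler function E_(al,be); below x = t^al. *)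
Definition MLs (al be : R) (lam : CC) (j : nat) (x : R) : CC :=
  (PSeries (mlc al be lam j fst) x, PSeries (mlc al be lam j snd) x).

Lemma mlc_entire al be lam j proj : 0 < al < 1 -> 0 < be ->
  (forall z : CC, Rabs (proj z) <= Cmod z) -> entire_seq (mlc al be lam j proj).
Proof.
  intros Hal Hbe Hp r Hr. pose proof (Cmod_ge_0 lam) as Hl.
  destruct (inv_Gamma_geom al be (r / (1 + Cmod lam)) Hal Hbe) as [K [HK HB]].
  { apply Rdiv_lt_0_compat; lra. }
  exists K. intros k. unfold mlc, Rdiv. rewrite Rabs_mult, Rabs_inv.
  apply Rle_trans with ((1 + Cmod lam) ^ k * (K * (r / (1 + Cmod lam)) ^ k)).
  - apply Rmult_le_compat; [apply Rabs_pos | | | apply HB].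
    + left. apply Rinv_0_lt_compat, Rabs_pos_lt, Gamma_neq_0. pose proof (pos_INR k). nra.
    + eapply Rle_trans; [apply Hp | apply qq_bound].
  - right. unfold Rdiv. rewrite Rpow_mult_distr, pow_inv. field. apply pow_nonzero; lra.
Qed.

Lemma Csum_S n (f : nat -> CC) : Csum (S n) f = (Csum n f + f n)%C :> CC.
Proof. reflexivity. Qed.

Lemma Csum_ext n (f g : nat -> CC) :
  (forall k, (k < n)%nat -> f k = g k) -> Csum n f = Csum n g :> CC.
Proof.
  induction n as [|n IH]; intros H; [reflexivity|].
  rewrite !Csum_S, H by lia. rewrite IH; [reflexivity|]. intros; apply H; lia.
Qed.

Lemma Csum_Rsum n (f : nat -> CC) :
  Csum n f = (Rsum n (fun k => fst (f k)), Rsum n (fun k => snd (f k))).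
Proof. induction n as [|n IH]; [reflexivity|]. rewrite Csum_S, IH. reflexivity. Qed.

Lemma Rsum_ext n f g : (forall k, (k < n)%nat -> f k = g k) -> Rsum n f = Rsum n g.
Proof. induction n as [|n IH]; intros H; simpl; [reflexivity|]. rewrite IH, H; auto. Qed.

Definition Climit (u : nat -> CC) (l : CC) : Prop :=
  is_lim_seq (fun n => fst (u n)) (fst l) /\ is_lim_seq (fun n => snd (u n)) (snd l).

Lemma Climit_eps u l : Climit u l -> forall e, 0 < e -> exists N, forall n, (N <= n)%nat -> Cmod (u n - l)%C < e.
Proof.
  intros [H1 H2] e He. apply is_lim_seq_spec in H1; apply is_lim_seq_spec in H2.
  destruct (H1 (mkposreal (e / 2) ltac:(lra))) as [N1 HN1].
  destruct (H2 (mkposreal (e / 2) ltac:(lra))) as [N2 HN2].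
  exists (max N1 N2). intros n Hn.
  specialize (HN1 n ltac:(lia)). specialize (HN2 n ltac:(lia)). simpl in HN1, HN2.
  eapply Rle_lt_trans; [apply Cmod_le_sum|].
  change (Rabs (fst (u n) - fst l) + Rabs (snd (u n) - snd l) < e). lra.
Qed.

Lemma MLs_Climit al be lam j x : 0 < al < 1 -> 0 < be ->
  Climit (fun N => Csum N (fun k => RtoC (x ^ k / Gamma (al * INR k + be)) * qq lam j k)%C) (MLs al be lam j x).
Proof.
  intros Hal Hbe. split; unfold MLs; simpl.
  - eapply is_lim_seq_ext; [|apply entire_partial_sums, mlc_entire; auto; apply abs_fst_le_Cmod].
    intros n. rewrite Csum_Rsum. simpl. apply Rsum_ext. intros k _. unfold mlc. simpl. unfold Rdiv; ring.
  - eapply is_lim_seq_ext; [|apply entire_partial_sums, mlc_entire; auto; apply abs_snd_le_Cmod].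
    intros n. rewrite Csum_Rsum. simpl. apply Rsum_ext. intros k _. unfold mlc. simpl. unfold Rdiv; ring.
Qed.

Lemma MLs_continuous al be lam j x : 0 < al < 1 -> 0 < be -> ccont (MLs al be lam j) x.
Proof.
  intros Hal Hbe. split; simpl; apply entire_continuous, mlc_entire; auto;
    [apply abs_fst_le_Cmod | apply abs_snd_le_Cmod].
Qed.

(** The relation between R_j and S_(j+1), coefficient by coefficient: [qq_shift] combined with
    Gamma(al (k+1) + 1) = al (k+1) Gamma(al k + al). *)
Lemma MLs_shift al lam j x : 0 < al < 1 ->
  (RtoC x * MLs al al lam j x = RtoC (al * INR (S j)) * MLs al 1 lam (S j) x)%C.
Proof.
  intros Hal.
  assert (Hj : 0 < INR (S j)) by (apply lt_0_INR; lia).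
  assert (Q1 : forall k, INR (S k) * fst (qq lam j k) = INR (S j) * fst (qq lam (S j) (S k))).
  { intros k. pose proof (f_equal fst (qq_shift lam j k)) as E. simpl fst in E.
    rewrite !Rmult_0_l, !Rminus_0_r in E. exact E. }
  assert (Q2 : forall k, INR (S k) * snd (qq lam j k) = INR (S j) * snd (qq lam (S j) (S k))).
  { intros k. pose proof (f_equal snd (qq_shift lam j k)) as E. simpl snd in E.
    rewrite !Rmult_0_l, !Rplus_0_r in E. exact E. }
  assert (G : forall k, Gamma (al * INR (S k) + 1) = al * INR (S k) * Gamma (al * INR k + al) /\
                        Gamma (al * INR k + al) <> 0 /\ INR (S k) <> 0).
  { intros k. rewrite Gamma_succ.
    - rewrite S_INR. replace (al * INR k + al) with (al * (INR k + 1)) by ring.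
      pose proof (pos_INR k). repeat split; [apply Gamma_neq_0; nra | lra].
    - apply Rmult_lt_0_compat; [lra | apply lt_0_INR; lia]. }
  apply C_ext; simpl fst; simpl snd.
  - rewrite !Rmult_0_l, !Rminus_0_r, <- PSeries_incr_1, <- PSeries_scal.
    apply PSeries_ext. intros [|k]; unfold PS_scal, PS_incr_1, mlc.
    + rewrite qq_S_0. simpl. unfold scal, zero; simpl; unfold mult; simpl. unfold Rdiv; ring.
    + destruct (G k) as [G1 [G2 G3]]. 
      change (fst (qq lam j k) / Gamma (al * INR k + al)
              = (al * INR (S j)) * (fst (qq lam (S j) (S k)) / Gamma (al * INR (S k) + 1))).
      rewrite G1.
      transitivity (INR (S k) * fst (qq lam j k) / (INR (S k) * Gamma (al * INR k + al))); [field; auto|].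
      rewrite Q1. field. repeat split; auto; lra.
  - rewrite !Rmult_0_l, !Rplus_0_r, <- PSeries_incr_1, <- PSeries_scal.
    apply PSeries_ext. intros [|k]; unfold PS_scal, PS_incr_1, mlc.
    + rewrite qq_S_0. simpl. unfold scal, zero; simpl; unfold mult; simpl. unfold Rdiv; ring.
    + destruct (G k) as [G1 [G2 G3]]. 
      change (snd (qq lam j k) / Gamma (al * INR k + al)
              = (al * INR (S j)) * (snd (qq lam (S j) (S k)) / Gamma (al * INR (S k) + 1))).
      rewrite G1.
      transitivity (INR (S k) * snd (qq lam j k) / (INR (S k) * Gamma (al * INR k + al))); [field; auto|].
      rewrite Q2. field. repeat split; auto; lra.
Qed.
(* Partial sums of the expansion of z / (z - lam)^(j+1) in powers of 1/z. *)
Definition FN (lam : CC) (j N : nat) (z : CC) : CC := Csum N (fun k => qq lam j k * (/ z) ^ k)%C.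

Lemma FN_succ lam j N z : FN lam j (S N) z = (FN lam j N z + qq lam j N * (/ z) ^ N)%C.
Proof. reflexivity. Qed.

Lemma FN_0 lam N (z : CC) : z <> 0 ->
  ((z - lam) * FN lam 0 N z = z - z * (qq lam 0 N * (/ z) ^ N))%C.
Proof.
  intros Hz. induction N as [|N IH].
  - unfold FN; simpl. change C0 with (RtoC 0). ring.
  - rewrite FN_succ, Cmult_plus_distr_l, IH, qq_0_S, Cpow_S. field. exact Hz.
Qed.

Lemma FN_S lam j N (z : CC) : z <> 0 ->
  ((z - lam) * FN lam (S j) N z = FN lam j N z - z * (qq lam (S j) N * (/ z) ^ N))%C.
Proof.
  intros Hz. induction N as [|N IH].
  - unfold FN; simpl. change C0 with (RtoC 0). ring.
  - rewrite !FN_succ, Cmult_plus_distr_l, IH, qq_S_S, Cpow_S. field. exact Hz.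
Qed.

(** [FN_S] exchanges one order of j for one division by z - lam, whose modulus is at least 1. Each
    of the j + 1 divisions adds a remainder of size at most |z| 2^(-N). *)
Lemma FN_error lam j N (z : CC) : 2 * (1 + Cmod lam) <= Cmod z ->
  Cmod (FN lam j N z - z * (/ (z - lam)) ^ (S j))%C <= INR (S j) * Cmod z * (/ 2) ^ N.
Proof.
  intros HZ. pose proof (Cmod_ge_0 lam) as Hl.
  assert (Hz0 : z <> 0) by (apply Cmod_gt_0; lra).
  assert (Hzl : 1 <= Cmod (z - lam)%C).
  { assert (Cmod z <= Cmod (z - lam)%C + Cmod lam).
    { replace z with ((z - lam) + lam)%C at 1 by ring. apply Cmod_triangle. }
    lra. }
  assert (Hzl0 : (z - lam)%C <> 0) by (apply Cmod_gt_0; lra).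
  assert (T : forall j, Cmod (z * (qq lam j N * (/ z) ^ N))%C <= Cmod z * (/ 2) ^ N).
  { intros i. rewrite !Cmod_mult, Cmod_pow, Cmod_inv by exact Hz0.
    apply Rmult_le_compat_l; [lra|].
    apply Rle_trans with ((1 + Cmod lam) ^ N * (/ Cmod z) ^ N).
    - apply Rmult_le_compat_r; [apply pow_le; left; apply Rinv_0_lt_compat; lra | apply qq_bound].
    - rewrite <- Rpow_mult_distr. apply pow_incr. split.
      + apply Rmult_le_pos; [lra | left; apply Rinv_0_lt_compat; lra].
      + apply Rmult_le_reg_r with (Cmod z); [lra|].
        rewrite Rmult_assoc, Rinv_l by lra. lra. }
  assert (D : forall w, Cmod (w / (z - lam))%C <= Cmod w).
  { intros w. rewrite Cmod_div by exact Hzl0. rewrite <- (Rmult_1_r (Cmod w)) at 2. 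
    apply Rmult_le_compat_l; [apply Cmod_ge_0|]. rewrite <- Rinv_1. apply Rinv_le_contravar; lra. }
  induction j as [|j IH].
  - replace (FN lam 0 N z - z * (/ (z - lam)) ^ 1)%C with (- (z * (qq lam 0 N * (/ z) ^ N)) / (z - lam))%C.
    + eapply Rle_trans; [apply D|]. rewrite Cmod_opp. simpl INR. rewrite Rmult_1_l. apply T.
    + transitivity (((z - lam) * FN lam 0 N z - z) / (z - lam))%C.
      * rewrite FN_0 by exact Hz0. f_equal. ring.
      * simpl Cpow. field. exact Hzl0.
  - replace (FN lam (S j) N z - z * (/ (z - lam)) ^ (S (S j)))%C
      with (((FN lam j N z - z * (/ (z - lam)) ^ (S j)) + - (z * (qq lam (S j) N * (/ z) ^ N))) / (z - lam))%C.
    + eapply Rle_trans; [apply D|]. eapply Rle_trans; [apply Cmod_triangle|]. rewrite Cmod_opp.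
      rewrite (S_INR (S j)). pose proof (T (S j)). lra.
    + transitivity (((z - lam) * FN lam (S j) N z - z * (/ (z - lam)) ^ (S j)) / (z - lam))%C.
      * rewrite FN_S by exact Hz0. f_equal. ring.
      * rewrite (Cpow_S _ (S j)). field. exact Hzl0.
Qed.

Lemma Cmod_Csum_geom (f : nat -> CC) A N : (forall k, Cmod (f k) <= A * (/ 2) ^ k) ->
  Cmod (Csum N f) <= 2 * A.
Proof.
  intros H.
  assert (HA : 0 <= A) by (specialize (H 0%nat); pose proof (Cmod_ge_0 (f 0%nat)); simpl in H; lra).
  assert (B : Cmod (Csum N f) <= 2 * A * (1 - (/ 2) ^ N)).
  { induction N as [|N IH].
    - change (Csum 0 f) with (RtoC 0). rewrite Cmod_0. simpl. lra.
    - rewrite Csum_S. eapply Rle_trans; [apply Cmod_triangle|]. specialize (H N). simpl. lra. }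
  assert (0 < (/ 2) ^ N) by (apply pow_lt; lra). nra.
Qed.

Lemma Phi_as_power t a k w :
  Phi 1 1 t (- (a * INR k)) 0 w = (Cexp (RtoC t * Cexp w) * (/ Cexp (RtoC a * w)) ^ k)%C.
Proof.
  unfold Phi. simpl Cpow at 1. rewrite Cmult_1_r, Cexp_plus, <- Cexp_opp, Cexp_pow. f_equal. f_equal.
  rewrite RtoC_opp, RtoC_mult. ring.
Qed.

Lemma ccont_Csum {U : UniformSpace} n (f : nat -> U -> CC) x :
  (forall k, ccont (f k) x) -> ccont (fun y => Csum n (fun k => f k y)) x.
Proof.
  intros H. induction n as [|n IH]; [apply ccont_const|].
  apply (ccont_plus (fun y => Csum n (fun k => f k y))); [exact IH | apply H].
Qed.

Lemma CI_Csum n (f : nat -> R -> CC) a b : (forall k x, (k < n)%nat -> ccont (f k) x) ->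
  CI (fun x => Csum n (fun k => f k x)) a b = Csum n (fun k => CI (f k) a b) /\
  forall x, ccont (fun x => Csum n (fun k => f k x)) x.
Proof.
  induction n as [|n IH]; intros H.
  - split; [|intros; apply ccont_const].
    unfold CI; simpl. rewrite RInt_const. apply C_ext; simpl; unfold scal; simpl; unfold mult; simpl; ring.
  - destruct IH as [IH1 IH2]; [intros; apply H; lia|]. split.
    + rewrite Csum_S, <- IH1. rewrite <- CI_plus; [reflexivity| |].
      * intros; apply IH2.
      * intros; apply H; lia.
    + intros x. apply (ccont_plus (fun x => Csum n (fun k => f k x)) (f n)); [apply IH2 | apply H; lia].
Qed.

Lemma Csum_scal (c : CC) n (f : nat -> CC) : (c * Csum n f)%C = Csum n (fun k => c * f k)%C.
Proof.
  induction n as [|n IH]; [change (c * 0 = 0)%C; ring|].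
  rewrite !Csum_S, <- IH. ring.
Qed.

Lemma Csum_plus n (f g : nat -> CC) : (Csum n f + Csum n g)%C = Csum n (fun k => f k + g k)%C.
Proof.
  induction n as [|n IH]; [change (0 + 0 = 0)%C; ring|].
  rewrite !Csum_S, <- IH. ring.
Qed.

Lemma Rpower_mult_pow t al k : Rpower t (al * INR k) = (Rpower t al) ^ k.
Proof. unfold Rpower. rewrite <- exp_INR_mult. f_equal; ring. Qed.

(** On the left 1 / Gamma is replaced by its approximation on the arc of radius t e^U. The scaling p
    -> p / t brings all terms to the common radius e^U, where they sum to the partial sum [FN]. *)
Lemma arc_partial_sum Th al lam j N t U : 0 < t ->
  Csum N (fun k => RtoC (Rpower t al ^ k) * cB Th (al * INR k + 1) (U + ln t) * qq lam j k)%C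
  = (RtoC (/ (2 * PI)) * CI (fun v => Cexp (RtoC t * Cexp (U, v)) * FN lam j N (Cexp (RtoC al * (U, v))))%C (- Th) Th)%C.
Proof.
  intros Ht. pose proof PI_RGT_0.
  rewrite (CI_ext _ (fun v => Csum N (fun k => qq lam j k * Phi 1 1 t (1 - (al * INR k + 1)) 0 (U, v)))%C).
  2:{ intros v _. unfold FN. rewrite Csum_scal. apply Csum_ext. intros k _.
      replace (1 - (al * INR k + 1)) with (- (al * INR k)) by ring. rewrite Phi_as_power. ring. }
  rewrite (proj1 (CI_Csum N (fun k v => qq lam j k * Phi 1 1 t (1 - (al * INR k + 1)) 0 (U, v))%C _ _ ltac:(intros k v _; apply ccont_cmult, ccont_Phi_v, Reg_0))).
  rewrite Csum_scal. apply Csum_ext. intros k _.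
  rewrite CI_scal by (intros; apply ccont_Phi_v, Reg_0).
  rewrite arc_scale by exact Ht.
  replace (al * INR k + 1 - 1) with (al * INR k) by ring.
  rewrite Rpower_mult_pow, !RtoC_mult, RtoC_inv by lra. rewrite !RtoC_mult. field.
  apply RtoC_neq; lra.
Qed.

Lemma Reg_large al (lam : CC) m u v : Cmod lam < exp (al * u) -> Reg al lam m (u, v).
Proof.
  intros H. right. intros E. rewrite <- E, Cmod_Cexp in H. simpl in H.
  replace (al * u - 0 * v) with (al * u) in H by ring. lra.
Qed.

(** Two comparisons at fixed radius. Replacing 1 / Gamma by [cB] costs at most A 2^(-k) in the k-th
    term, because (1 + |lam|) e^(-al U) <= 1/2; this sums to 2 A. The resulting finite sum differs
    from the arc integral only by the tail of the expansion, which vanishes as N grows. *)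
Lemma series_vs_arc (Th : R) (HTh : PI / 2 < Th <= PI) al lam j t U :
  0 < al < 1 -> 0 < t -> 2 * (1 + Cmod lam) <= exp (al * U) ->
  Cmod (MLs al 1 lam j (Rpower t al)
        - RtoC (/ (2 * PI)) * CI (fun v => Phi al lam t al (S j) (U, v)) (- Th) Th)%C
  <= 2 * (/ (PI * - cos Th) * exp (- (U + ln t) + t * exp U * cos Th)).
Proof.
  intros Hal Ht HU. pose proof PI_RGT_0 as HPi. pose proof (cos_Th_neg Th HTh) as Hc.
  pose proof (Cmod_ge_0 lam) as Hl.
  set (x := Rpower t al).
  set (A := / (PI * - cos Th) * exp (- (U + ln t) + t * exp U * cos Th)).
  apply le_epsilon. intros e He.
  destruct (Climit_eps _ _ (MLs_Climit al 1 lam j x Hal ltac:(lra)) (e / 2)) as [N1 HN1]; [lra|].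
  (* On the arc this is the maximum of |e^(tp)| times the prefactor of [FN_error]. *)
  set (B := exp (t * exp U) * (INR (S j) * exp (al * U))).
  assert (HB : 0 < B).
  { unfold B. repeat apply Rmult_lt_0_compat; try apply exp_pos. apply lt_0_INR; lia. }
  destruct (pow_lt_1_zero (/ 2) ltac:(rewrite Rabs_right; lra) (e / 2 / B) ltac:(repeat apply Rdiv_lt_0_compat; lra)) as [N2 HN2].
  set (N := max N1 N2).
  specialize (HN1 N ltac:(unfold N; lia)). specialize (HN2 N ltac:(unfold N; lia)).
  rewrite Rabs_right in HN2 by (left; apply pow_lt; lra).
  set (S1 := Csum N (fun k => RtoC (x ^ k / Gamma (al * INR k + 1)) * qq lam j k)%C) in *.
  set (S2 := Csum N (fun k => RtoC (x ^ k) * cB Th (al * INR k + 1) (U + ln t) * qq lam j k)%C).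
  assert (H12 : Cmod (S2 - S1)%C <= 2 * A).
  { replace (S2 - S1)%C with (S2 + (- (1)) * S1)%C by ring. unfold S1, S2.
    rewrite Csum_scal, Csum_plus. apply Cmod_Csum_geom. intros k.
    replace (RtoC (x ^ k) * cB Th (al * INR k + 1) (U + ln t) * qq lam j k
             + - (1) * (RtoC (x ^ k / Gamma (al * INR k + 1)) * qq lam j k))%C
      with (RtoC (x ^ k) * (cB Th (al * INR k + 1) (U + ln t) - RtoC (/ Gamma (al * INR k + 1))) * qq lam j k)%C
      by (unfold Rdiv; rewrite RtoC_mult; ring).
    assert (Hxk : x ^ k = exp (al * INR k * ln t)) by (unfold x; rewrite <- Rpower_mult_pow; reflexivity).
    rewrite !Cmod_mult, Cmod_R, Rabs_right by (rewrite Hxk; left; apply exp_pos).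
    pose proof (pos_INR k) as Hk.
    pose proof (cB_Gamma_bound Th HTh (al * INR k + 1) (U + ln t) ltac:(nra)) as HG.
    rewrite (exp_plus U (ln t)), exp_ln in HG by exact Ht.
    apply Rle_trans with (x ^ k * (/ (PI * - cos Th) * exp (- (al * INR k + 1) * (U + ln t) + exp U * t * cos Th)) * (1 + Cmod lam) ^ k).
    - apply Rmult_le_compat.
      + apply Rmult_le_pos; [rewrite Hxk; left; apply exp_pos | apply Cmod_ge_0].
      + apply Cmod_ge_0.
      + apply Rmult_le_compat_l; [rewrite Hxk; left; apply exp_pos | exact HG].
      + apply qq_bound.
    - apply Rle_trans with (A * (exp (- (al * U)) ^ k * (1 + Cmod lam) ^ k)).
      + right. rewrite Hxk, <- exp_INR_mult. unfold A.
        transitivity (/ (PI * - cos Th) * (exp (al * INR k * ln t) * exp (- (al * INR k + 1) * (U + ln t) + exp U * t * cos Th)) * (1 + Cmod lam) ^ k); [ring|].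
        transitivity (/ (PI * - cos Th) * (exp (- (U + ln t) + t * exp U * cos Th) * exp (INR k * - (al * U))) * (1 + Cmod lam) ^ k); [|ring].
        rewrite <- !exp_plus. do 3 f_equal. ring.
      + assert (HA : 0 < A).
        { unfold A. apply Rmult_lt_0_compat; [|apply exp_pos]. apply Rinv_0_lt_compat, Rmult_lt_0_compat; lra. }
        apply Rmult_le_compat_l; [lra|]. rewrite <- Rpow_mult_distr. apply pow_incr.
        pose proof (exp_pos (al * U)). rewrite exp_Ropp. split.
        * apply Rmult_le_pos; [left; apply Rinv_0_lt_compat; lra | lra].
        * apply Rmult_le_reg_l with (exp (al * U)); [lra|].
          rewrite <- Rmult_assoc, Rinv_r, Rmult_1_l by lra. lra. }
  assert (H23 : Cmod (S2 - RtoC (/ (2 * PI)) * CI (fun v => Phi al lam t al (S j) (U, v)) (- Th) Th)%C <= e / 2).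
  { unfold S2, x. rewrite arc_partial_sum by exact Ht.
    set (f := fun v => (Cexp (RtoC t * Cexp (U, v)) * FN lam j N (Cexp (RtoC al * (U, v))))%C).
    assert (Cf : forall v, ccont f v).
    { intros v. unfold f, FN.
      assert (C1 : ccont (fun v => (U, v)) v) by apply ccont_pair_r.
      apply ccont_mult.
      - apply ccont_exp, ccont_mult; [apply ccont_const | apply ccont_exp; exact C1].
      - apply (ccont_Csum N (fun k v => qq lam j k * (/ Cexp (RtoC al * (U, v))) ^ k)%C).
        intros k. apply ccont_cmult. apply ccont_pow.
        apply ccont_inv; [apply Cexp_neq_0|]. apply ccont_exp, ccont_mult; [apply ccont_const | exact C1]. }
    assert (Cp : forall v, ccont (fun v => Phi al lam t al (S j) (U, v)) v).
    { intros v. apply ccont_Phi_v, Reg_large. lra. }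
    replace (RtoC (/ (2 * PI)) * CI f (- Th) Th - RtoC (/ (2 * PI)) * CI (fun v => Phi al lam t al (S j) (U, v)) (- Th) Th)%C
      with (RtoC (/ (2 * PI)) * CI (fun v => f v + (- (1)) * Phi al lam t al (S j) (U, v))%C (- Th) Th)%C.
    2:{ rewrite CI_plus, CI_scal; auto; [ring|]. intros; apply ccont_cmult; auto. }
    rewrite Cmod_mult, Cmod_R, Rabs_right by (apply Rle_ge; left; apply Rinv_0_lt_compat; lra).
    assert (HB2 : Cmod (CI (fun v => f v + (- (1)) * Phi al lam t al (S j) (U, v))%C (- Th) Th) <= (B * (/ 2) ^ N) * (Th - - Th)).
    { apply CI_bound_const; [lra| |].
      - intros; apply ccont_plus; [apply Cf|]. apply ccont_cmult; apply Cp.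
      - intros v Hv. unfold f.
        set (z := Cexp (RtoC al * (U, v))%C).
        assert (Hz : Cmod z = exp (al * U)).
        { unfold z. rewrite Cmod_Cexp. simpl. f_equal; ring. }
        replace (Phi al lam t al (S j) (U, v)) with (Cexp (RtoC t * Cexp (U, v)) * (z * (/ (z - lam)) ^ (S j)))%C.
        2:{ unfold Phi. rewrite Cexp_plus. fold z. ring. }
        replace (Cexp (RtoC t * Cexp (U, v)) * FN lam j N z + - (1) * (Cexp (RtoC t * Cexp (U, v)) * (z * (/ (z - lam)) ^ S j)))%C
          with (Cexp (RtoC t * Cexp (U, v)) * (FN lam j N z - z * (/ (z - lam)) ^ S j))%C by ring.
        rewrite Cmod_mult, Cmod_Cexp. unfold B. rewrite (Rmult_assoc (exp (t * exp U))).
        apply Rmult_le_compat; [left; apply exp_pos | apply Cmod_ge_0 | |].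
        + apply exp_le. simpl. pose proof (COS_bound v). pose proof (exp_pos U).
          replace (t * (exp U * cos v) - 0 * (exp U * sin v)) with (t * exp U * cos v) by ring.
          assert (0 < t * exp U) by nra. nra.
        + rewrite <- Hz. apply FN_error. lra. }
    apply Rle_trans with (/ (2 * PI) * ((B * (/ 2) ^ N) * (2 * PI))).
    - apply Rmult_le_compat_l; [left; apply Rinv_0_lt_compat; lra|].
      eapply Rle_trans; [exact HB2|].
      assert (0 < (/ 2) ^ N) by (apply pow_lt; lra).
      apply Rmult_le_compat_l; [left; apply Rmult_lt_0_compat; lra | lra].
    - replace (/ (2 * PI) * ((B * (/ 2) ^ N) * (2 * PI))) with (B * (/ 2) ^ N) by (field; lra).
      apply Rle_trans with (B * (e / 2 / B)); [apply Rmult_le_compat_l; lra | right; field; lra]. }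
  match goal with |- Cmod (?M - ?P)%C <= _ =>
    replace (M - P)%C with ((- (S1 - M) + - (S2 - S1)) + (S2 - P))%C by ring end.
  eapply Rle_trans; [apply Cmod_triangle|].
  eapply Rle_trans; [apply Rplus_le_compat_r, Cmod_triangle|]. rewrite !Cmod_opp. fold A. lra.
Qed.

(** * Decay of the ray integrals and the resulting asymptotics *)

Lemma Rpower_le_1_plus y al : 0 < y -> 0 < al < 1 -> Rpower y al <= 1 + y.
Proof.
  intros Hy Hal. unfold Rpower. destruct (Rle_lt_dec y 1) as [H|H].
  - assert (ln y <= 0) by (rewrite <- ln_1; destruct H as [H|H]; [left; apply ln_increasing; lra | rewrite H; lra]).
    apply Rle_trans with (exp 0); [apply exp_le; nra | rewrite exp_0; lra].
  - assert (0 < ln y) by (rewrite <- ln_1; apply ln_increasing; lra).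
    apply Rle_trans with (exp (ln y)); [apply exp_le; nra | rewrite exp_ln; lra].
Qed.

(** The right side times y^(al-1) has an elementary primitive, so the ray integrals get an explicit
    bound. It follows from 1 + y^al <= 2 + y <= 2 e^(y/2). *)
Lemma exp_neg_le_rational y al : 0 < y -> 0 < al < 1 -> exp (- y) <= 4 / (1 + Rpower y al) ^ 2.
Proof.
  intros Hy Hal. pose proof (Rpower_le_1_plus y al Hy Hal) as H.
  assert (HP : 0 < Rpower y al) by apply exp_pos.
  apply Rmult_le_reg_r with ((1 + Rpower y al) ^ 2); [apply pow_lt; lra|].
  replace (4 / (1 + Rpower y al) ^ 2 * (1 + Rpower y al) ^ 2) with 4 by (field; lra).
  apply Rle_trans with (exp (- y) * (4 * (exp (y / 2)) ^ 2)).
  - apply Rmult_le_compat_l; [left; apply exp_pos|].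
    pose proof (exp_ineq1_le (y / 2)). 
    replace (4 * exp (y / 2) ^ 2) with ((2 * exp (y / 2)) ^ 2) by ring.
    apply pow_incr. lra.
  - replace (exp (- y) * (4 * exp (y / 2) ^ 2)) with (4 * (exp (- y) * (exp (y / 2) * exp (y / 2)))) by ring.
    rewrite <- !exp_plus. replace (- y + (y / 2 + y / 2)) with 0 by field. rewrite exp_0. lra.
Qed.

Lemma ray_integral_bound al k t a U : 0 < al < 1 -> 0 < k -> 0 < t -> a <= U ->
  RInt (fun u => exp (- k * t * exp u + al * u)) a U <= 4 / al * Rpower (k * t) (- al).
Proof.
  intros Hal Hk Ht HaU.
  assert (Hkt : 0 < k * t) by (apply Rmult_lt_0_compat; assumption).
  set (Y := Rpower (k * t) al). assert (HY : 0 < Y) by apply exp_pos.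
  assert (HR : is_RInt (fun u => 4 * exp (al * u) / (1 + Y * exp (al * u)) ^ 2) a U
      (- (4 / (al * Y)) / (1 + Y * exp (al * U)) - - (4 / (al * Y)) / (1 + Y * exp (al * a)))).
  { apply (is_RInt_derive (V:=R_CompleteNormedModule) (fun u => - (4 / (al * Y)) / (1 + Y * exp (al * u)))).
    - intros u _. pose proof (exp_pos (al * u)). assert (0 < Y * exp (al * u)) by nra.
      auto_derive; [lra|]. field. repeat split; lra.
    - intros u _. pose proof (exp_pos (al * u)). assert (0 < Y * exp (al * u)) by nra.
      apply (ex_derive_continuous (V:=R_NormedModule)). auto_derive.
      apply Rgt_not_eq. rewrite Rmult_1_r. nra. }
  apply Rle_trans with (RInt (fun u => 4 * exp (al * u) / (1 + Y * exp (al * u)) ^ 2) a U).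
  - apply RInt_le; [exact HaU | | eexists; exact HR |].
    + apply (ex_RInt_continuous (V:=R_CompleteNormedModule)). intros x _.
      apply (ex_derive_continuous (V:=R_NormedModule)). auto_derive; exact I.
    + intros u _. pose proof (exp_pos u).
      pose proof (exp_neg_le_rational (k * t * exp u) al ltac:(nra) Hal) as HE.
      replace (Rpower (k * t * exp u) al) with (Y * exp (al * u)) in HE.
      2:{ unfold Y, Rpower. rewrite <- exp_plus, (ln_mult (k * t)), ln_exp by assumption. f_equal; ring. }
      replace (- k * t * exp u + al * u) with (- (k * t * exp u) + al * u) by ring.
      rewrite exp_plus. replace (4 * exp (al * u) / (1 + Y * exp (al * u)) ^ 2) with
        (4 / (1 + Y * exp (al * u)) ^ 2 * exp (al * u)) by (unfold Rdiv; ring).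
      apply Rmult_le_compat_r; [left; apply exp_pos | exact HE].
  - rewrite (is_RInt_unique _ _ _ _ HR).
    replace (Rpower (k * t) (- al)) with (/ Y) by (unfold Y, Rpower; rewrite <- exp_Ropp; f_equal; ring).
    pose proof (exp_pos (al * U)). pose proof (exp_pos (al * a)).
    assert (P1 : 0 < Y * exp (al * U)) by nra. assert (P2 : 0 < Y * exp (al * a)) by nra.
    assert (HK : 0 < 4 / (al * Y)) by (apply Rdiv_lt_0_compat; nra).
    replace (4 / al * / Y) with (4 / (al * Y)) by (field; lra).
    assert (Q1 : 0 < / (1 + Y * exp (al * U))) by (apply Rinv_0_lt_compat; lra).
    assert (Q2 : / (1 + Y * exp (al * a)) <= 1) by (rewrite <- Rinv_1; apply Rinv_le_contravar; lra).
    unfold Rdiv at 1 3. nra.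
Qed.

(** With moduli r and L and b the cosine of the angle between them, the squared distance is (1+b)/2
    (r-L)^2 + (1-b)/2 (r+L)^2 >= (1-b)/2 L^2. The bound is uniform along the ray. *)
Lemma ray_distance al u0 v0 u v c : cos (al * (v - v0)) <= c < 1 ->
  exp (al * u0) * sqrt ((1 - c) / 2) <= Cmod (Cexp (RtoC al * (u, v)) - Cexp (RtoC al * (u0, v0)))%C.
Proof.
  intros Hc. set (L := exp (al * u0)). set (r := exp (al * u)).
  assert (HL : 0 < L) by apply exp_pos. assert (Hr : 0 < r) by apply exp_pos.
  assert (HD : L * sqrt ((1 - c) / 2) = sqrt (L ^ 2 * ((1 - c) / 2))).
  { rewrite sqrt_mult by nra. rewrite sqrt_pow2 by lra. reflexivity. }
  rewrite HD. unfold Cmod. apply sqrt_le_1_alt.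
  unfold Cexp, RtoC; simpl fst; simpl snd.
  replace (al * u - 0 * v) with (al * u) by ring.
  replace (al * v + 0 * u) with (al * v) by ring.
  replace (al * u0 - 0 * v0) with (al * u0) by ring.
  replace (al * v0 + 0 * u0) with (al * v0) by ring.
  fold L r.
  set (b := cos (al * (v - v0))) in *.
  assert (E : (r * cos (al * v) + - (L * cos (al * v0))) ^ 2 + (r * sin (al * v) + - (L * sin (al * v0))) ^ 2
     = r ^ 2 + L ^ 2 - 2 * r * L * b).
  { unfold b. rewrite Rmult_minus_distr_l, cos_minus.
    pose proof (sin2_cos2 (al * v)) as S1. pose proof (sin2_cos2 (al * v0)) as S2. unfold Rsqr in S1, S2.
    transitivity (r ^ 2 * (sin (al * v) * sin (al * v) + cos (al * v) * cos (al * v))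
       + L ^ 2 * (sin (al * v0) * sin (al * v0) + cos (al * v0) * cos (al * v0))
       - 2 * r * L * (cos (al * v) * cos (al * v0) + sin (al * v) * sin (al * v0))); [ring|].
    rewrite S1, S2. ring. }
  unfold Cminus, Cplus, Copp; simpl fst; simpl snd. rewrite E.
  assert (Hb : -1 <= b) by apply COS_bound.
  assert (L ^ 2 * ((1 - c) / 2) <= L ^ 2 * ((1 - b) / 2)) by (apply Rmult_le_compat_l; [apply pow2_ge_0 | lra]).
  eapply Rle_trans; [eassumption|].
  assert (0 <= (1 + b) / 2 * (r - L) ^ 2) by (apply Rmult_le_pos; [lra | apply pow2_ge_0]).
  assert (0 <= (1 - b) / 2 * (r + L) ^ 2 - (1 - b) / 2 * L ^ 2).
  { rewrite <- Rmult_minus_distr_l. apply Rmult_le_pos.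
    - pose proof (COS_bound (al * (v - v0))) as [_ Hb1]. fold b in Hb1. lra.
    - assert (0 < r * L) by (apply Rmult_lt_0_compat; assumption). pose proof (pow2_ge_0 r). nra. }
  lra.
Qed.

Lemma Cmod_Phi_le al lam t gam m u v d : 0 < d -> d <= Cmod (Cexp (RtoC al * (u, v)) - lam)%C ->
  Cmod (Phi al lam t gam m (u, v)) <= exp (t * (exp u * cos v) + gam * u) * (/ d) ^ m.
Proof.
  intros Hd Hle. unfold Phi.
  assert (N : (Cexp (RtoC al * (u, v)) - lam)%C <> 0) by (apply Cmod_gt_0; lra).
  rewrite Cmod_mult, Cmod_Cexp, Cmod_pow, Cmod_inv by exact N.
  apply Rmult_le_compat.
  - left; apply exp_pos.
  - apply pow_le; left; apply Rinv_0_lt_compat; lra.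
  - right; f_equal. simpl. ring.
  - apply pow_incr. split; [left; apply Rinv_0_lt_compat; lra | apply Rinv_le_contravar; lra].
Qed.

(** [PP] is whatever the residue contributes, so that the stable and the unstable case share this
    proof. For fixed t the outer arc approximates the series as U grows, the inner arc vanishes as a
    tends to minus infinity, and the two rays give the term t^(-al). *)
Lemma ML_asym (Th : R) (HTh : PI / 2 < Th <= PI) al (w0 : CC) j (PP : R -> CC) :
  0 < al < 1 -> snd w0 <> Th -> snd w0 <> - Th ->
  al * (Th + Rabs (snd w0)) < 2 * PI ->
  (forall t a U, 0 < t -> a < fst w0 < U ->
     RB (Phi al (Cexp (RtoC al * w0)%C) t al (S j)) a U (- Th) Th = (RtoC (2 * PI) * Ci * PP t)%C) ->
  exists C, 0 <= C /\ forall t, 0 < t ->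
    Cmod (MLs al 1 (Cexp (RtoC al * w0)%C) j (Rpower t al) - PP t)%C <= C * Rpower t (- al).
Proof.
  intros Hal Hn1 Hn2 Hstrip HRB.
  pose proof PI_RGT_0 as HPi. pose proof (cos_Th_neg Th HTh) as Hct.
  destruct w0 as [u0 v0]; simpl in Hn1, Hn2, Hstrip, HRB.
  set (lam := Cexp (RtoC al * (u0, v0))%C) in *.
  set (L := exp (al * u0)). assert (HL : 0 < L) by apply exp_pos.
  assert (HlamL : Cmod lam = L) by (unfold lam, L; rewrite Cmod_Cexp; simpl; f_equal; ring).
  pose proof (Rle_abs v0) as Hv1. pose proof (Rle_abs (- v0)) as Hv2. rewrite Rabs_Ropp in Hv2.
  assert (Hc1 : cos (al * (Th - v0)) < 1).
  { pose proof (COS_bound (al * (Th - v0))) as [_ [H|H]]; [exact H|].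
    apply cos_eq_1 in H; [exfalso; apply Hn1; nra | apply Rabs_def1; nra]. }
  assert (Hc2 : cos (al * (- Th - v0)) < 1).
  { pose proof (COS_bound (al * (- Th - v0))) as [_ [H|H]]; [exact H|].
    apply cos_eq_1 in H; [exfalso; apply Hn2; nra | apply Rabs_def1; nra]. }
  set (c := Rmax (cos (al * (Th - v0))) (cos (al * (- Th - v0)))).
  assert (Hc : c < 1) by (apply Rmax_lub_lt; assumption).
  set (d := L * sqrt ((1 - c) / 2)).
  assert (Hd : 0 < d) by (apply Rmult_lt_0_compat; [exact HL | apply sqrt_lt_R0; lra]).
  assert (Hray : forall u v, v = Th \/ v = - Th -> d <= Cmod (Cexp (RtoC al * (u, v)) - lam)%C).
  { intros u v Hv. apply ray_distance. split; [|exact Hc].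
    destruct Hv as [-> | ->]; [apply Rmax_l | apply Rmax_r]. }
  set (k := - cos Th). assert (Hk : 0 < k) by (unfold k; lra).
  set (D := (/ d) ^ (S j)). assert (HD : 0 < D) by (apply pow_lt, Rinv_0_lt_compat; exact Hd).
  exists (/ PI * (D * (4 / al * Rpower k (- al)))).
  assert (HC0 : 0 < / PI) by (apply Rinv_0_lt_compat; lra).
  assert (HC1 : 0 < 4 / al * Rpower k (- al)).
  { apply Rmult_lt_0_compat; [apply Rdiv_lt_0_compat; lra | apply exp_pos]. }
  split; [left; apply Rmult_lt_0_compat; [lra | apply Rmult_lt_0_compat; lra]|].
  intros t Ht.
  apply le_epsilon. intros e He.
  set (M0 := 2 / (PI * k) * exp (- ln t)).
  assert (HM0 : 0 < M0) by (unfold M0; apply Rmult_lt_0_compat; [apply Rdiv_lt_0_compat; nra | apply exp_pos]).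
  destruct (exp_neg_lt_eps 1 (e / 2 / M0)) as [U1 [HU1 HU1']]; [lra | repeat apply Rdiv_lt_0_compat; lra|].
  set (U := Rmax U1 (Rmax (u0 + 1) (ln (2 * (1 + L)) / al))).
  assert (HUa : U1 <= U) by apply Rmax_l.
  assert (HUb : u0 + 1 <= U) by (eapply Rle_trans; [apply Rmax_l | apply Rmax_r]).
  assert (HUc : ln (2 * (1 + L)) / al <= U) by (eapply Rle_trans; [apply Rmax_r | apply Rmax_r]).
  specialize (HU1' U HUa).
  assert (HU : 2 * (1 + Cmod lam) <= exp (al * U)).
  { rewrite HlamL, <- (exp_ln (2 * (1 + L))) by lra. apply exp_le.
    apply Rmult_le_reg_l with (/ al); [apply Rinv_0_lt_compat; lra|].
    rewrite <- Rmult_assoc, Rinv_l by lra. unfold Rdiv in HUc. lra. }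
  pose proof (series_vs_arc Th HTh al lam j t U Hal Ht HU) as HS.
  set (E2 := (2 / L) ^ (S j)). assert (HE2 : 0 < E2) by (apply pow_lt, Rdiv_lt_0_compat; lra).
  destruct (exp_neg_lt_eps al (e / 2 / (exp t * E2))) as [a1 [Ha1 Ha1']]; [lra | |].
  { repeat apply Rdiv_lt_0_compat; try lra. apply Rmult_lt_0_compat; [apply exp_pos | lra]. }
  set (a := Rmin (- a1) (Rmin (u0 - 1) (Rmin 0 (ln (L / 2) / al)))).
  assert (Haa : a <= - a1) by apply Rmin_l.
  assert (Hab : a <= u0 - 1) by (eapply Rle_trans; [apply Rmin_r | apply Rmin_l]).
  assert (Hac : a <= 0) by (do 2 (eapply Rle_trans; [apply Rmin_r|]); apply Rmin_l).
  assert (Had : a <= ln (L / 2) / al) by (do 2 (eapply Rle_trans; [apply Rmin_r|]); apply Rmin_r).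
  specialize (Ha1' (- a) ltac:(lra)). replace (- al * - a) with (al * a) in Ha1' by ring.
  specialize (HRB t a U Ht ltac:(lra)).
  set (ArcU := CI (fun v => Phi al lam t al (S j) (U, v)) (- Th) Th) in *.
  set (Arca := CI (fun v => Phi al lam t al (S j) (a, v)) (- Th) Th).
  assert (HArca : Cmod Arca <= e / 2 * (2 * PI)).
  { assert (HaL : exp (al * a) <= L / 2).
    { rewrite <- (exp_ln (L / 2)) by lra. apply exp_le.
      apply Rmult_le_reg_l with (/ al); [apply Rinv_0_lt_compat; lra|].
      rewrite <- Rmult_assoc, Rinv_l by lra. unfold Rdiv in Had. lra. }
    assert (Hdist : forall v, L / 2 <= Cmod (Cexp (RtoC al * (a, v)) - lam)%C).
    { intros v.
      assert (Cmod lam <= Cmod (Cexp (RtoC al * (a, v))%C) + Cmod (Cexp (RtoC al * (a, v)) - lam)%C).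
      { replace lam with (Cexp (RtoC al * (a, v)) + - (Cexp (RtoC al * (a, v)) - lam))%C at 1 by ring.
        eapply Rle_trans; [apply Cmod_triangle|]. rewrite Cmod_opp. lra. }
      rewrite HlamL, Cmod_Cexp in H. simpl fst in H.
      replace (al * a - 0 * v) with (al * a) in H by ring. lra. }
    apply Rle_trans with (e / 2 * (Th - - Th)); [|apply Rmult_le_compat_l; lra].
    apply CI_bound_const; [lra| |].
    - intros v _. apply ccont_Phi_v. right. intros E.
      specialize (Hdist v). rewrite E in Hdist. replace (lam - lam)%C with (RtoC 0) in Hdist by ring.
      rewrite Cmod_0 in Hdist. lra.
    - intros v _. eapply Rle_trans; [apply (Cmod_Phi_le _ _ _ _ _ _ _ (L / 2)); [lra | apply Hdist]|].
      replace (/ (L / 2)) with (2 / L) by (field; lra). fold E2.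
      rewrite exp_plus.
      apply Rle_trans with (exp t * exp (al * a) * E2).
      + apply Rmult_le_compat_r; [lra|]. apply Rmult_le_compat_r; [left; apply exp_pos|].
        apply exp_le. pose proof (COS_bound v).
        assert (0 < exp a <= 1) by (split; [apply exp_pos | rewrite <- exp_0; apply exp_le; lra]).
        assert (exp a * cos v <= exp a * 1) by (apply Rmult_le_compat_l; lra).
        assert (t * (exp a * cos v) <= t * 1) by (apply Rmult_le_compat_l; lra). lra.
      + assert (0 < exp t * E2) by (apply Rmult_lt_0_compat; [apply exp_pos | lra]).
        apply Rle_trans with (exp t * E2 * (e / 2 / (exp t * E2))); [|right; field; split; [lra|]].
        * replace (exp t * exp (al * a) * E2) with (exp t * E2 * exp (al * a)) by ring.
          apply Rmult_le_compat_l; lra.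
        * pose proof (exp_pos t); lra. }
  assert (HRay : forall v, v = Th \/ v = - Th ->
     Cmod (CI (fun u => Phi al lam t al (S j) (u, v)) a U) <= D * (4 / al * Rpower k (- al)) * Rpower t (- al)).
  { intros v Hv.
    assert (HcosT : cos v = cos Th) by (destruct Hv as [-> | ->]; [reflexivity | apply cos_neg]).
    assert (Hex : ex_RInt (fun u => exp (- k * t * exp u + al * u)) a U).
    { apply (ex_RInt_continuous (V:=R_CompleteNormedModule)). intros x _.
      apply (ex_derive_continuous (V:=R_NormedModule)). auto_derive; exact I. }
    apply Rle_trans with (RInt (fun u => D * exp (- k * t * exp u + al * u)) a U).
    - apply CI_bound; [lra| | |].
      + intros u _. apply ccont_Phi_u. right. intros E.
        specialize (Hray u v Hv). rewrite E in Hray. replace (lam - lam)%C with (RtoC 0) in Hray by ring.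
        rewrite Cmod_0 in Hray. lra.
      + apply (ex_RInt_scal (V:=R_NormedModule)). exact Hex.
      + intros u _. eapply Rle_trans; [apply (Cmod_Phi_le _ _ _ _ _ _ _ d); [exact Hd | apply Hray; exact Hv]|].
        fold D. rewrite Rmult_comm. rewrite HcosT. right. do 2 f_equal. unfold k. ring.
    - rewrite (RInt_scal (V:=R_CompleteNormedModule) _ a U D) by exact Hex.
      unfold scal; simpl; unfold mult; simpl. rewrite Rmult_assoc.
      apply Rmult_le_compat_l; [lra|].
      eapply Rle_trans; [apply ray_integral_bound; try lra|].
      right. rewrite Rmult_assoc. f_equal. unfold Rpower. rewrite <- exp_plus, ln_mult by lra. f_equal; ring. }
  pose proof (HRay Th (or_introl eq_refl)) as HR1. pose proof (HRay (- Th) (or_intror eq_refl)) as HR2.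
  unfold RB in HRB. fold ArcU Arca in HRB.
  set (R1 := CI (fun u => Phi al lam t al (S j) (u, Th)) a U) in *.
  set (R2 := CI (fun u => Phi al lam t al (S j) (u, (- Th)%R)) a U) in *.
  (* The rectangle identity solved for the outer arc: residue, inner arc and the two rays. *)
  assert (HP : (RtoC (/ (2 * PI)) * ArcU - PP t = RtoC (/ (2 * PI)) * (Arca + - Ci * (R1 - R2)))%C).
  { assert (HPN : RtoC (2 * PI) <> 0) by (apply RtoC_neq; lra).
    rewrite RtoC_inv by lra.
    transitivity (/ RtoC (2 * PI) * (ArcU - RtoC (2 * PI) * PP t))%C; [field; exact HPN|]. f_equal.
    transitivity (- (Ci * Ci) * ArcU + Ci * (RtoC (2 * PI) * Ci * PP t))%C.
    - replace (Ci * (RtoC (2 * PI) * Ci * PP t))%C with (Ci * Ci * (RtoC (2 * PI) * PP t))%C by ring.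
      replace (Ci * Ci)%C with (- (1))%C by (apply C_ext; simpl; ring). ring.
    - rewrite <- HRB.
      transitivity (- (Ci * Ci) * Arca + - Ci * (R1 - R2))%C; [ring|].
      replace (Ci * Ci)%C with (- (1))%C by (apply C_ext; simpl; ring). ring. }
  assert (HB : Cmod (RtoC (/ (2 * PI)) * ArcU - PP t)%C
     <= e / 2 + / PI * (D * (4 / al * Rpower k (- al))) * Rpower t (- al)).
  { rewrite HP, Cmod_mult, Cmod_R, Rabs_right by (apply Rle_ge; left; apply Rinv_0_lt_compat; lra).
    set (X := D * (4 / al * Rpower k (- al)) * Rpower t (- al)) in *.
    apply Rle_trans with (/ (2 * PI) * (e / 2 * (2 * PI) + 2 * X)).
    - apply Rmult_le_compat_l; [left; apply Rinv_0_lt_compat; lra|].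
      eapply Rle_trans; [apply Cmod_triangle|]. rewrite Cmod_mult, Cmod_opp, Cmod_Ci, Rmult_1_l.
      assert (Cmod (R1 - R2)%C <= 2 * X).
      { eapply Rle_trans; [apply Cmod_triangle|]. rewrite Cmod_opp. lra. }
      lra.
    - right. unfold X. field. lra. }
  assert (HA : 2 * (/ (PI * - cos Th) * exp (- (U + ln t) + t * exp U * cos Th)) <= e / 2).
  { fold k. apply Rle_trans with (M0 * exp (- (1) * U)).
    - unfold M0. replace (2 / (PI * k) * exp (- ln t) * exp (- (1) * U)) with (2 * (/ (PI * k) * (exp (- ln t) * exp (- (1) * U)))) by (unfold Rdiv; ring).
      apply Rmult_le_compat_l; [lra|]. apply Rmult_le_compat_l; [left; apply Rinv_0_lt_compat, Rmult_lt_0_compat; lra|].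
      rewrite <- exp_plus. apply exp_le.
      assert (0 < t * exp U * - cos Th).
      { apply Rmult_lt_0_compat; [apply Rmult_lt_0_compat; [exact Ht | apply exp_pos] | lra]. }
      lra.
    - apply Rle_trans with (M0 * (e / 2 / M0)); [apply Rmult_le_compat_l; lra | right; field; lra]. }
  match goal with |- Cmod (?S - ?P)%C <= _ =>
    replace (S - P)%C with ((S - RtoC (/ (2 * PI)) * ArcU) + (RtoC (/ (2 * PI)) * ArcU - P))%C by ring end.
  eapply Rle_trans; [apply Cmod_triangle|]. lra.
Qed.
Lemma Carg_spec (z : CC) : z <> 0 ->
  fst z = Cmod z * cos (Carg z) /\ snd z = Cmod z * sin (Carg z) /\ - PI < Carg z <= PI.
Proof.
  intros Hz. pose proof PI_RGT_0 as HPi.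
  destruct z as [x y]. set (r := Cmod (x, y)).
  assert (Hr : 0 < r) by (apply Cmod_gt_0; exact Hz).
  assert (Hr2 : r ^ 2 = x ^ 2 + y ^ 2) by (unfold r; rewrite Cmod_sqr; reflexivity).
  assert (Hs : forall s, 0 < s -> s ^ 2 = x ^ 2 -> sqrt (1 + Rsqr (y / x)) = r / s).
  { intros s Hs Hsx. rewrite <- (sqrt_pow2 (r / s)) by (left; apply Rdiv_lt_0_compat; assumption).
    f_equal. unfold Rsqr. assert (x <> 0) by (intros E; rewrite E in Hsx; nra).
    unfold Rdiv. rewrite Rpow_mult_distr, pow_inv, Hr2, Hsx. field. assumption. }
  pose proof (atan_bound (y / x)) as HA.
  unfold Carg; simpl fst; simpl snd.
  destruct (Rlt_dec 0 x) as [Hx|Hx].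
  - rewrite cos_atan, sin_atan, (Hs x Hx eq_refl). repeat split; try lra; field; lra.
  - destruct (Rlt_dec x 0) as [Hx'|Hx'].
    + assert (Hsx := Hs (- x) ltac:(lra) ltac:(ring)).
      destruct (Rle_dec 0 y) as [Hy|Hy].
      * rewrite neg_cos, neg_sin, cos_atan, sin_atan, Hsx.
        repeat split; try lra; try (field; lra).
        assert (atan (y / x) <= 0); [|lra].
        rewrite <- atan_0. destruct Hy as [Hy|Hy].
        -- left. apply atan_increasing. unfold Rdiv. pose proof (Rinv_lt_0_compat x Hx'). nra.
        -- rewrite <- Hy. unfold Rdiv. rewrite Rmult_0_l. lra.
      * assert (E : forall a, cos (a - PI) = - cos a /\ sin (a - PI) = - sin a).
        { intros a. rewrite cos_minus, sin_minus, cos_PI, sin_PI. split; ring. }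
        destruct (E (atan (y / x))) as [-> ->]. rewrite cos_atan, sin_atan, Hsx.
        repeat split; try lra; try (field; lra).
        assert (0 < atan (y / x)); [|lra].
        rewrite <- atan_0. apply atan_increasing. unfold Rdiv. pose proof (Rinv_lt_0_compat x Hx'). nra.
    + assert (x = 0) by lra. subst x.
      assert (Hry : r ^ 2 = y ^ 2) by (rewrite Hr2; ring).
      destruct (Rlt_dec 0 y) as [Hy|Hy].
      * rewrite cos_PI2, sin_PI2. assert (r = y) by nra. repeat split; lra.
      * destruct (Rlt_dec y 0) as [Hy'|Hy'].
        -- rewrite cos_neg, sin_neg, cos_PI2, sin_PI2. assert (r = - y) by nra. repeat split; lra.
        -- exfalso. assert (y = 0) by lra. subst. nra.
Qed.

(* log lam / al, so that Cexp (wl al lam) is the principal value of lam^(1/al) *)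
Definition wl (al : R) (lam : CC) : CC := (ln (Cmod lam) / al, Carg lam / al).

Lemma Cexp_wl al (lam : CC) : 0 < al -> lam <> 0 -> Cexp (RtoC al * wl al lam)%C = lam.
Proof.
  intros Hal Hl. destruct (Carg_spec lam Hl) as [H1 [H2 _]].
  assert (0 < Cmod lam) by (apply Cmod_gt_0; exact Hl).
  unfold wl, Cexp; simpl.
  replace (al * (ln (Cmod lam) / al) - 0 * (Carg lam / al)) with (ln (Cmod lam)) by (field; lra).
  replace (al * (Carg lam / al) + 0 * (ln (Cmod lam) / al)) with (Carg lam) by (field; lra).
  rewrite exp_ln by assumption. rewrite <- H1, <- H2. destruct lam; reflexivity.
Qed.

(* The exponentially growing part: the contribution of the pole at p^al = lam, if it lies in the right half plane. *)
Definition pp (al : R) (lam : CC) (j : nat) (be t : R) : CC :=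
  if Rlt_dec (Rabs (Carg lam)) (al * PI / 2) then (RtoC (/ al) * aa al (wl al lam) j be t)%C else 0.

(** An unstable pole has angle |arg lam| / al < pi/2 and is enclosed with Th = pi; the strip
    condition holds because al pi + |arg lam| < 3 al pi / 2. For a stable eigenvalue the angle Th is
    taken smaller than that of the pole, and the residue is 0. *)
Lemma ML_asym_pp al (lam : CC) j : 0 < al < 1 -> lam <> 0 -> Rabs (Carg lam) <> al * PI / 2 ->
  exists C, 0 <= C /\ forall t, 0 < t ->
    Cmod (MLs al 1 lam j (Rpower t al) - pp al lam j 0 t)%C <= C * Rpower t (- al).
Proof.
  intros Hal Hl Hne. pose proof PI_RGT_0 as HPi.
  destruct (Carg_spec lam Hl) as [_ [_ Harg]].
  assert (Hl0 : 0 < al) by lra.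
  pose proof (Cexp_wl al lam Hl0 Hl) as Ew.
  assert (Habs : Rabs (Carg lam) <= PI) by (apply Rabs_le; lra).
  assert (Hsnd : Rabs (snd (wl al lam)) = Rabs (Carg lam) / al).
  { unfold wl; simpl. unfold Rdiv. rewrite Rabs_mult, Rabs_inv, (Rabs_right al) by lra. reflexivity. }
  assert (Hsnd2 : al * Rabs (snd (wl al lam)) = Rabs (Carg lam)) by (rewrite Hsnd; field; lra).
  unfold pp. destruct (Rlt_dec (Rabs (Carg lam)) (al * PI / 2)) as [Hu|Hs].
  - assert (Hv : Rabs (snd (wl al lam)) < PI / 2).
    { apply Rmult_lt_reg_l with al; lra. }
    pose proof (Rabs_def2 _ _ Hv) as [Hv1 Hv2].
    pose proof (ML_asym PI ltac:(lra) al (wl al lam) j (fun t => RtoC (/ al) * aa al (wl al lam) j 0 t)%C) as HM.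
    rewrite Ew in HM. apply HM; try lra.
    + rewrite Rmult_plus_distr_l, Hsnd2. nra.
    + intros t a U Ht Ha.
      pose proof (RB_Phi_S al (wl al lam) j t al a U (- PI) PI) as HR. rewrite Ew in HR.
      rewrite HR; try lra.
      * replace (al - al) with 0 by ring. reflexivity.
      * nra.
      * nra.
  - assert (Hgt : al * PI / 2 < Rabs (Carg lam)) by lra.
    set (m := Rmin PI (Rabs (Carg lam) / al)).
    assert (Hm1 : m <= PI) by apply Rmin_l.
    assert (Hm2 : m <= Rabs (Carg lam) / al) by apply Rmin_r.
    assert (Hm3 : PI / 2 < m).
    { apply Rmin_glb_lt; [lra|]. apply Rmult_lt_reg_l with al; [lra|].
      replace (al * (Rabs (Carg lam) / al)) with (Rabs (Carg lam)) by (field; lra). lra. }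
    (* Halfway between pi/2 and m: the rays still lie in the open left half plane, and the pole at
       angle |arg lam| / al lies outside the sector. *)
    set (Th := (PI / 2 + m) / 2).
    assert (HTh : PI / 2 < Th < m) by (unfold Th; lra).
    assert (Hv : Th < Rabs (snd (wl al lam))) by (rewrite Hsnd; lra).
    assert (Hst : al * (Th + Rabs (snd (wl al lam))) < 2 * PI) by (rewrite Rmult_plus_distr_l, Hsnd2; nra).
    pose proof (ML_asym Th ltac:(lra) al (wl al lam) j (fun _ => RtoC 0)) as HM.
    rewrite Ew in HM. apply HM; try lra.
    + intros E. rewrite E, Rabs_right in Hv; lra.
    + intros E. rewrite E, Rabs_Ropp, Rabs_right in Hv; lra.
    + intros t a U Ht Ha.
      (* The margin around the rectangle: the first bound keeps this pole out, the second keeps out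
         the other solutions of p^al = lam. *)
      set (eta := Rmin (Rabs (snd (wl al lam)) - Th) ((2 * PI - al * (Th + Rabs (snd (wl al lam)))) / al)).
      assert (He1 : eta <= Rabs (snd (wl al lam)) - Th) by apply Rmin_l.
      assert (He2 : eta <= (2 * PI - al * (Th + Rabs (snd (wl al lam)))) / al) by apply Rmin_r.
      assert (He0 : 0 < eta) by (apply Rmin_glb_lt; [lra | apply Rdiv_lt_0_compat; lra]).
      assert (He3 : al * eta <= 2 * PI - al * (Th + Rabs (snd (wl al lam)))).
      { apply Rle_trans with (al * ((2 * PI - al * (Th + Rabs (snd (wl al lam)))) / al));
          [apply Rmult_le_compat_l; lra | right; field; lra]. }
      rewrite (Phi_Cauchy _ _ _ _ _ a U (- Th) Th eta); try lra; [ring|].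
      intros u v Hu' Hv'.
      assert (Hvv : Rabs v < Th + eta) by (apply Rabs_def1; lra).
      set (w0 := wl al lam) in *. destruct w0 as [u0 v0]. simpl in *.
      rewrite <- Ew. apply Reg_strip; [lra| |].
      * rewrite Rabs_mult, (Rabs_right al) by lra.
        pose proof (Rabs_triang v (- v0)) as HT. rewrite Rabs_Ropp in HT.
        change (v + - v0) with (v - v0) in HT. 
        apply Rle_lt_trans with (al * (Rabs v + Rabs v0)); [apply Rmult_le_compat_l; lra|].
        apply Rlt_le_trans with (al * (Th + eta + Rabs v0)); [apply Rmult_lt_compat_l; lra|]. lra.
      * right. intros E. rewrite E in Hvv. lra.
Qed.

(** With z = p^al one has d/dz = (1/al) p^(1-al) d/dp, which applied to p^be e^(tp) yields the two
    terms; the factor i + 1 is that of Taylor coefficients. *)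
Lemma aa_rec al w0 i be t : 0 < al ->
  (RtoC (al * INR (S i)) * aa al w0 (S i) be t
   = RtoC be * aa al w0 i (be - al) t + RtoC t * aa al w0 i (be - al + 1) t)%C.
Proof.
  intros Hal. assert (0 < INR (S i)) by (apply lt_0_INR; lia).
  cbn [aa]. rewrite RtoC_inv by nra. field. apply RtoC_neq; nra.
Qed.

Lemma Csum_first n (f : nat -> CC) : (Csum (S n) f = f 0%nat + Csum n (fun k => f (S k)) :> CC)%C.
Proof.
  induction n as [|n IH]; [change (C0 + f 0%nat = f 0%nat + C0)%C; apply Cplus_comm|].
  rewrite (Csum_S (S n)), IH, (Csum_S n). ring.
Qed.

Definition aasum al w0 m be gam t s : CC :=
  Csum (S m) (fun j => aa al w0 j be t * aa al w0 (m - j) gam s)%C.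

(* Leibniz rule, for the product of z^(be/al) exp (t z^(1/al)) and z^(gam/al) exp (s z^(1/al)) *)
Lemma aa_product al w0 m be gam t s : 0 < al ->
  aa al w0 m (be + gam) (t + s) = aasum al w0 m be gam t s.
Proof.
  intros Hal. revert be gam. induction m as [|m IH]; intros be gam.
  - unfold aasum. rewrite Csum_S. simpl. change C0 with (RtoC 0).
    rewrite Cplus_0_l, <- Cexp_plus. f_equal. rewrite !RtoC_plus. ring.
  - assert (Hm : 0 < INR (S m)) by (apply lt_0_INR; lia).
    assert (HN : RtoC (al * INR (S m)) <> 0) by (apply RtoC_neq; nra).
    assert (E : (RtoC (al * INR (S m)) * aa al w0 (S m) (be + gam) (t + s)
                 = RtoC (al * INR (S m)) * aasum al w0 (S m) be gam t s)%C).
    { rewrite aa_rec by exact Hal. rewrite !RtoC_plus.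
      transitivity (RtoC be * aa al w0 m ((be - al) + gam) (t + s) + RtoC t * aa al w0 m ((be - al + 1) + gam) (t + s)
        + (RtoC gam * aa al w0 m (be + (gam - al)) (t + s) + RtoC s * aa al w0 m (be + (gam - al + 1)) (t + s)))%C.
      { replace (be + gam - al + 1) with (be - al + 1 + gam) by ring.
        replace (be + gam - al) with (be - al + gam) by ring.
        replace (be + (gam - al)) with (be - al + gam) by ring.
        replace (be + (gam - al + 1)) with (be - al + 1 + gam) by ring. ring. }
      rewrite !IH. unfold aasum.
      rewrite !Csum_scal, !Csum_plus.
      transitivity (Csum (S m) (fun k => RtoC (al * INR (S k)) * aa al w0 (S k) be t * aa al w0 (m - k) gam s)
        + Csum (S m) (fun k => aa al w0 k be t * (RtoC (al * INR (S (m - k))) * aa al w0 (S (m - k)) gam s)))%C.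
      { rewrite Csum_plus. apply Csum_ext. intros k _. rewrite !aa_rec by exact Hal. ring. }
      (* One term of weight 0 is added to each sum so that both run over the same m + 2 indices. The
         weights al k and al (m + 1 - k) then add up to al (m + 1). *)
      transitivity (Csum (S (S m)) (fun k => RtoC (al * INR k) * aa al w0 k be t * aa al w0 (S m - k) gam s)
        + Csum (S (S m)) (fun k => aa al w0 k be t * (RtoC (al * INR (S m - k)) * aa al w0 (S m - k) gam s)))%C.
      { f_equal.
        - rewrite (Csum_first (S m)). simpl (INR 0). rewrite Rmult_0_r.
          replace (fun k => RtoC (al * INR (S k)) * aa al w0 (S k) be t * aa al w0 (S m - S k) gam s)%C
            with (fun k => RtoC (al * INR (S k)) * aa al w0 (S k) be t * aa al w0 (m - k) gam s)%C by reflexivity.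
          symmetry; match goal with |- @eq _ ?a ?b => change (@eq CC a b) end; ring.
        - rewrite (Csum_S (S m)). rewrite Nat.sub_diag. simpl (INR 0). rewrite Rmult_0_r.
          rewrite (Csum_ext (S m) (fun k => aa al w0 k be t * (RtoC (al * INR (S m - k)) * aa al w0 (S m - k) gam s))%C
             (fun k => aa al w0 k be t * (RtoC (al * INR (S (m - k))) * aa al w0 (S (m - k)) gam s))%C).
          + symmetry; match goal with |- @eq _ ?a ?b => change (@eq CC a b) end; ring.
          + intros k Hk. replace (S m - k)%nat with (S (m - k)) by lia. reflexivity. }
      rewrite Csum_plus. apply Csum_ext. intros k Hk.
      assert (E : INR (S m) = INR k + INR (S m - k)).
      { rewrite <- plus_INR. f_equal. lia. }
      rewrite E, !RtoC_mult, RtoC_plus. ring. }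
    replace (aa al w0 (S m) (be + gam) (t + s))
      with (/ RtoC (al * INR (S m)) * (RtoC (al * INR (S m)) * aa al w0 (S m) (be + gam) (t + s)))%C by (field; exact HN).
    rewrite E. field. exact HN.
Qed.

Lemma aa_continuous al w0 j be t : ccont (fun t => aa al w0 j be t) t.
Proof.
  revert be; induction j as [|j IH]; intros be; simpl.
  - apply ccont_exp, ccont_plus; [|apply ccont_const].
    apply ccont_mult; [|apply ccont_const]. apply ccont_RtoC, continuous_id.
  - apply ccont_cmult. apply ccont_plus.
    + apply ccont_cmult; apply IH.
    + apply ccont_mult; [apply ccont_RtoC, continuous_id | apply IH].
Qed.

(** At -s the coefficient is a polynomial in s times exp (- s p) with p = [Cexp w0]. The induction
    gives up a little of the rate at each order: c' lies between c and Re p, and s exp (-(c' - c) s)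
    is bounded. *)
Lemma aa_decay al w0 j be c : 0 < al -> c < fst (Cexp w0) ->
  exists K, 0 <= K /\ forall s, 0 <= s -> Cmod (aa al w0 j be (- s)) <= K * exp (- c * s).
Proof.
  intros Hal. revert be c; induction j as [|j IH]; intros be c Hc.
  - exists (exp (be * fst w0)). split; [left; apply exp_pos|]. intros s Hs.
    cbn [aa]. rewrite Cmod_Cexp, <- exp_plus. apply exp_le. 
    change (- s * fst (Cexp w0) - 0 * snd (Cexp w0) + (be * fst w0 - 0 * snd w0) <= be * fst w0 + - c * s). nra.
  - set (mu := fst (Cexp w0)) in *. set (c' := (c + mu) / 2).
    assert (Hc' : c < c' < mu) by (unfold c'; lra).
    destruct (IH (be - al) c' ltac:(lra)) as [K1 [HK1 H1]].
    destruct (IH (be - al + 1) c' ltac:(lra)) as [K2 [HK2 H2]].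
    assert (Hi : 0 < / (al * INR (S j))).
    { apply Rinv_0_lt_compat, Rmult_lt_0_compat; [exact Hal | apply lt_0_INR; lia]. }
    exists (/ (al * INR (S j)) * (Rabs be * K1 + K2 / (c' - c))).
    assert (HK3 : 0 <= K2 / (c' - c)) by (apply Rmult_le_pos; [exact HK2 | left; apply Rinv_0_lt_compat; lra]).
    split; [apply Rmult_le_pos; [lra|]; pose proof (Rabs_pos be); nra|].
    intros s Hs. cbn [aa]. rewrite Cmod_mult, Cmod_R, Rabs_right by lra.
    rewrite Rmult_assoc. apply Rmult_le_compat_l; [lra|].
    eapply Rle_trans; [apply Cmod_triangle|]. rewrite !Cmod_mult, !Cmod_R, Rabs_Ropp, (Rabs_right s) by lra.
    specialize (H1 s Hs). specialize (H2 s Hs).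
    pose proof (exp_pos (- c * s)) as Hp. pose proof (Rabs_pos be) as Hb.
    assert (E : exp (- c' * s) = exp (- c * s) * exp (- (c' - c) * s)) by (rewrite <- exp_plus; f_equal; ring).
    assert (E1 : exp (- (c' - c) * s) <= 1) by (rewrite <- exp_0; apply exp_le; nra).
    assert (E2 : s * exp (- (c' - c) * s) <= / (c' - c)).
    { pose proof (exp_ineq1_le ((c' - c) * s)) as H. pose proof (exp_pos (- (c' - c) * s)) as Hq.
      apply Rmult_le_reg_l with (c' - c); [lra|]. rewrite Rinv_r by lra.
      apply Rle_trans with (exp ((c' - c) * s) * exp (- (c' - c) * s)).
      - rewrite <- Rmult_assoc. apply Rmult_le_compat_r; lra.
      - rewrite <- exp_plus. replace ((c' - c) * s + - (c' - c) * s) with 0 by ring. rewrite exp_0; lra. }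
    pose proof (exp_pos (- (c' - c) * s)) as Hq.
    rewrite Rmult_plus_distr_r. apply Rplus_le_compat.
    + rewrite Rmult_assoc. apply Rmult_le_compat_l; [exact Hb|].
      eapply Rle_trans; [exact H1|]. apply Rmult_le_compat_l; [exact HK1|]. rewrite E. nra.
    + apply Rle_trans with (s * (K2 * exp (- c' * s))); [apply Rmult_le_compat_l; assumption|].
      rewrite E.
      replace (s * (K2 * (exp (- c * s) * exp (- (c' - c) * s)))) with (K2 * exp (- c * s) * (s * exp (- (c' - c) * s))) by ring.
      replace (K2 / (c' - c) * exp (- c * s)) with (K2 * exp (- c * s) * / (c' - c)) by (unfold Rdiv; ring).
      apply Rmult_le_compat_l; [nra | exact E2].
Qed.

(* Of order t^(al-1) at 0 and t^(-al-1) at infinity, with an explicit bounded antiderivative. *)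
Definition rho (al t : R) : R := Rpower t (al - 1) / (1 + Rpower t al) ^ 2.

Definition RR (al : R) (lam : CC) (j : nat) (t : R) : CC :=
  (RtoC (Rpower t (al - 1)) * MLs al al lam j (Rpower t al))%C.

Lemma ccont_bounded (f : R -> CC) a b : a <= b -> (forall x, a <= x <= b -> ccont f x) ->
  exists M, 0 <= M /\ forall x, a <= x <= b -> Cmod (f x) <= M.
Proof.
  intros Hab Hf.
  destruct (continuity_ab_maj (fun x => Cmod (f x)) a b Hab) as [m [Hm _]].
  - intros c Hc. apply continuity_pt_filterlim. apply (continuous_Cmod f c), Hf, Hc.
  - exists (Cmod (f m)). split; [apply Cmod_ge_0 | exact Hm].
Qed.

Lemma pp_continuous al lam j be t : ccont (fun t => pp al lam j be t) t.
Proof.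
  unfold pp. destruct (Rlt_dec _ _); [|apply ccont_const].
  apply ccont_cmult; apply aa_continuous.
Qed.

Lemma pp_shift al lam j t : 0 < al ->
  (RtoC (al * INR (S j)) * pp al lam (S j) 0 t = RtoC t * pp al lam j (1 - al) t)%C.
Proof.
  intros Hal. unfold pp. destruct (Rlt_dec _ _); [|ring].
  transitivity (RtoC (/ al) * (RtoC (al * INR (S j)) * aa al (wl al lam) (S j) 0 t))%C; [ring|].
  rewrite aa_rec by exact Hal. replace (0 - al + 1) with (1 - al) by ring. ring.
Qed.

(** For t <= 1 both terms are at most a constant times t^(al-1), which is comparable with [rho]. For
    t > 1 the shift identities hold for the kernel and for its pole part alike, so t times the
    difference is al (j + 1) times the O(t^(-al)) remainder of S_(j+1). *)
Lemma RR_asym al (lam : CC) j : 0 < al < 1 -> lam <> 0 -> Rabs (Carg lam) <> al * PI / 2 ->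
  exists K, 0 <= K /\ forall t, 0 < t ->
    Cmod (RR al lam j t - pp al lam j (1 - al) t)%C <= K * rho al t.
Proof.
  intros Hal Hl Hne.
  destruct (ML_asym_pp al lam (S j) Hal Hl Hne) as [C [HC HB]].
  destruct (ccont_bounded (MLs al al lam j) 0 1) as [M1 [HM1 HB1]]; [lra | intros; apply MLs_continuous; lra|].
  destruct (ccont_bounded (fun t => pp al lam j (1 - al) t) 0 1) as [M2 [HM2 HB2]]; [lra | intros; apply pp_continuous|].
  assert (Hj : 0 < INR (S j)) by (apply lt_0_INR; lia).
  exists (4 * (al * INR (S j) * C + M1 + M2)).
  assert (HCC : 0 <= al * INR (S j) * C) by (apply Rmult_le_pos; [nra | exact HC]).
  split; [lra|]. intros t Ht.
  assert (HP : 0 < Rpower t al) by apply exp_pos.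
  assert (HP1 : 0 < Rpower t (al - 1)) by apply exp_pos.
  assert (Hrho : 0 < rho al t) by (apply Rdiv_lt_0_compat; [exact HP1 | apply pow_lt; lra]).
  destruct (Rle_lt_dec t 1) as [H1|H1].
  - assert (HPle : Rpower t al <= 1).
    { unfold Rpower. rewrite <- exp_0. apply exp_le.
      assert (ln t <= 0) by (rewrite <- ln_1; destruct H1 as [H1|H1]; [left; apply ln_increasing; lra | rewrite H1; lra]). nra. }
    assert (HP1ge : 1 <= Rpower t (al - 1)).
    { unfold Rpower. rewrite <- exp_0 at 1. apply exp_le.
      assert (ln t <= 0) by (rewrite <- ln_1; destruct H1 as [H1|H1]; [left; apply ln_increasing; lra | rewrite H1; lra]). nra. }
    assert (Hr4 : Rpower t (al - 1) <= 4 * rho al t).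
    { unfold rho. apply Rmult_le_reg_r with ((1 + Rpower t al) ^ 2); [apply pow_lt; lra|].
      replace (4 * (Rpower t (al - 1) / (1 + Rpower t al) ^ 2) * (1 + Rpower t al) ^ 2) with (Rpower t (al - 1) * 4) by (field; lra).
      apply Rmult_le_compat_l; [lra|]. nra. }
    apply Rle_trans with ((M1 + M2) * Rpower t (al - 1)).
    + eapply Rle_trans; [apply Cmod_triangle|]. rewrite Cmod_opp. unfold RR.
      rewrite Cmod_mult, Cmod_R, Rabs_right by lra.
      specialize (HB1 (Rpower t al) ltac:(lra)). specialize (HB2 t ltac:(lra)). cbv beta in HB2.
      assert (Rpower t (al - 1) * Cmod (MLs al al lam j (Rpower t al)) <= Rpower t (al - 1) * M1) by (apply Rmult_le_compat_l; lra).
      assert (M2 * 1 <= M2 * Rpower t (al - 1)) by (apply Rmult_le_compat_l; lra). lra.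
    + apply Rle_trans with ((M1 + M2) * (4 * rho al t)); [apply Rmult_le_compat_l; lra|]. nra.
  - assert (Hlt : 0 < ln t) by (rewrite <- ln_1; apply ln_increasing; lra).
    assert (HPge : 1 <= Rpower t al) by (unfold Rpower; rewrite <- exp_0 at 1; apply exp_le; nra).
    assert (ET : Rpower t al = t * Rpower t (al - 1)).
    { rewrite <- (exp_ln t) at 2 by lra. unfold Rpower. rewrite <- exp_plus. f_equal; ring. }
    assert (EN : Rpower t al * Rpower t (- al) = 1).
    { unfold Rpower. rewrite <- exp_plus, <- exp_0. f_equal; ring. }
    set (N := Rpower t (- al)) in *. assert (HN : 0 < N) by apply exp_pos.
    assert (Hr4 : N <= 4 * rho al t * t).
    { unfold rho. apply Rmult_le_reg_r with ((1 + Rpower t al) ^ 2); [apply pow_lt; lra|].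
      replace (4 * (Rpower t (al - 1) / (1 + Rpower t al) ^ 2) * t * (1 + Rpower t al) ^ 2) with (4 * (t * Rpower t (al - 1))) by (field; lra).
      rewrite <- ET. set (X := Rpower t al) in *.
      apply Rle_trans with (N * (2 * X) ^ 2); [apply Rmult_le_compat_l; [lra | apply pow_incr; lra]|].
      replace (N * (2 * X) ^ 2) with (4 * X * (X * N)) by ring. rewrite EN. lra. }
    specialize (HB t Ht).
    assert (E : (RtoC t * (RR al lam j t - pp al lam j (1 - al) t)
                 = RtoC (al * INR (S j)) * (MLs al 1 lam (S j) (Rpower t al) - pp al lam (S j) 0 t))%C).
    { transitivity (RtoC (Rpower t al) * MLs al al lam j (Rpower t al) - RtoC t * pp al lam j (1 - al) t)%C.
      - unfold RR. rewrite ET at 2. rewrite RtoC_mult. ring.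
      - rewrite MLs_shift by exact Hal. rewrite <- pp_shift by lra. ring. }
    apply (f_equal Cmod) in E. rewrite !Cmod_mult, !Cmod_R, (Rabs_right t), (Rabs_right (al * INR (S j))) in E by nra.
    apply Rmult_le_reg_l with t; [lra|]. rewrite E.
    apply Rle_trans with (al * INR (S j) * (C * N)); [apply Rmult_le_compat_l; [nra | exact HB]|].
    apply Rle_trans with (al * INR (S j) * C * (4 * rho al t * t)).
    + rewrite <- Rmult_assoc. apply Rmult_le_compat_l; assumption.
    + assert (0 < rho al t * t) by nra.
      replace (t * (4 * (al * INR (S j) * C + M1 + M2) * rho al t)) with ((al * INR (S j) * C + (M1 + M2)) * (4 * rho al t * t)) by ring.
      apply Rmult_le_compat_r; lra.
Qed.
(** * Functions of matrices in Jordan form *)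

(** The product of the superdiagonal entries between i and i + m. For a Jordan matrix it is 1 when
    these entries are all 1, so that both indices lie in one block, and 0 otherwise. *)
Fixpoint chain (A : Mat) (i m : nat) : CC :=
  match m with O => 1 | S p => (chain A i p * A (i + p)%nat (S (i + p)))%C end.

(* The (i, k) entry of f(A) for A in Jordan form, where F lam j = f^(j)(lam) / j!. *)
Definition ent (A : Mat) (F : CC -> nat -> CC) (i k : nat) : CC :=
  if (i <=? k)%nat then (chain A i (k - i) * F (A i i) (k - i)%nat)%C else 0.

Lemma chain_cases n A i m : is_jordan n A -> (i + m < n)%nat ->
  chain A i m = 0 \/ (chain A i m = 1 /\ A (i + m)%nat (i + m)%nat = A i i).
Proof.
  intros [_ HJ]. induction m as [|m IH]; intros Hm.
  - right. rewrite Nat.add_0_r. split; reflexivity.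
  - simpl. destruct IH as [H|[H1 H2]]; [lia| |].
    + left. rewrite H. ring.
    + destruct (HJ (i + m)%nat ltac:(lia)) as [H|[H3 H4]].
      * left. rewrite H. change C0 with (RtoC 0). ring.
      * right. split.
        -- rewrite H1, H3. change C1 with (RtoC 1). ring.
        -- rewrite Nat.add_succ_r, <- H4. exact H2.
Qed.

Lemma chain_plus A i m p : chain A i (m + p) = (chain A i m * chain A (i + m) p)%C.
Proof.
  induction p as [|p IH].
  - rewrite Nat.add_0_r. simpl. ring.
  - rewrite Nat.add_succ_r. simpl. rewrite IH, Nat.add_assoc. ring.
Qed.

Lemma Cmod_ent_le n A F i k : is_jordan n A -> (i < n)%nat -> (k < n)%nat ->
  Cmod (ent A F i k) <= Cmod (F (A i i) (k - i)%nat).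
Proof.
  intros HJ Hi Hk. unfold ent. destruct (Nat.leb_spec i k) as [H|H].
  - rewrite Cmod_mult. destruct (chain_cases n A i (k - i) HJ ltac:(lia)) as [->|[-> _]].
    + rewrite Cmod_0, Rmult_0_l. apply Cmod_ge_0.
    + rewrite Cmod_1, Rmult_1_l. lra.
  - rewrite Cmod_0. apply Cmod_ge_0.
Qed.

Lemma ent_minus A F G i k : (ent A F i k - ent A G i k = ent A (fun l j => F l j - G l j) i k)%C.
Proof. unfold ent. destruct (i <=? k)%nat; ring. Qed.

Lemma Csum_0 n (f : nat -> CC) : (forall k, (k < n)%nat -> f k = 0) -> Csum n f = 0 :> CC.
Proof.
  induction n as [|n IH]; intros H; [reflexivity|].
  rewrite Csum_S, IH, H by (auto; intros; apply H; lia). ring.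
Qed.

Lemma Csum_single n (f : nat -> CC) k : (k < n)%nat ->
  (forall l, (l < n)%nat -> l <> k -> f l = 0) -> Csum n f = f k :> CC.
Proof.
  induction n as [|n IH]; intros Hk H; [lia|].
  rewrite Csum_S. destruct (Nat.eq_dec k n) as [->|E].
  - rewrite Csum_0; [ring|]. intros l Hl; apply H; lia.
  - rewrite IH, (H n) by (try lia; intros; apply H; lia). ring.
Qed.

Lemma Csum_double n (f : nat -> CC) k : (S k < n)%nat ->
  (forall l, (l < n)%nat -> l <> k -> l <> S k -> f l = 0) -> Csum n f = (f k + f (S k))%C :> CC.
Proof.
  induction n as [|n IH]; intros Hk H; [lia|].
  rewrite Csum_S. destruct (Nat.eq_dec (S k) n) as [<-|E].
  - rewrite (Csum_single (S k) f k); [reflexivity | lia |]. intros l Hl Hn; apply H; lia.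
  - rewrite IH, (H n) by (try lia; intros; apply H; lia). ring.
Qed.

(** Column k of A has entries only in rows k and k - 1, so the product reduces to two terms and
    reproduces the recursion of [qq]. Where the eigenvalues at i and k might differ, [chain]
    vanishes. *)
Lemma mat_pow_entry n A x p i k : is_jordan n A -> (i < n)%nat -> (k < n)%nat ->
  mat_pow n (Mscal x A) p i k = ent A (fun lam j => RtoC (x ^ p) * qq lam j p)%C i k :> CC.
Proof.
  intros HJ Hi. revert k. induction p as [|p IH]; intros k Hk.
  - simpl. unfold mat_id, ent. destruct (Nat.eqb_spec i k) as [->|E].
    + rewrite Nat.leb_refl, Nat.sub_diag. simpl. change C1 with (RtoC 1). ring.
    + change C0 with (RtoC 0). destruct (Nat.leb_spec i k) as [H|H]; [|reflexivity].
      destruct (k - i)%nat eqn:E2; [lia|]. simpl qq. ring.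
  - change (Csum n (fun l => mat_pow n (Mscal x A) p i l * Mscal x A l k)%C
            = ent A (fun lam j => RtoC (x ^ S p) * qq lam j (S p))%C i k :> CC).
    assert (HA : forall l, Mscal x A l k = (RtoC x * A l k)%C :> CC).
    { intros l. unfold Mscal. apply C_ext; simpl; ring. }
    assert (HZ : forall l, (l < n)%nat -> l <> k -> S l <> k ->
        (mat_pow n (Mscal x A) p i l * Mscal x A l k)%C = 0).
    { intros l Hl H1 H2. rewrite HA. destruct HJ as [HJ _].
      rewrite (HJ l k) by lia. change C0 with (RtoC 0). ring. }
    destruct k as [|k].
    + rewrite (Csum_single n (fun l => mat_pow n (Mscal x A) p i l * Mscal x A l 0%nat)%C 0%nat Hk)
        by (intros; apply HZ; lia).
      rewrite IH, HA by lia. unfold ent.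
      destruct (Nat.leb_spec i 0) as [H|H]; [|ring].
      replace i with 0%nat by lia. simpl (0 - 0)%nat. rewrite qq_0_S.
      change (x ^ S p) with (x * x ^ p). rewrite RtoC_mult. ring.
    + rewrite (Csum_double n (fun l => mat_pow n (Mscal x A) p i l * Mscal x A l (S k))%C k Hk)
        by (intros; apply HZ; lia).
      rewrite !IH, !HA by lia. unfold ent.
      change (x ^ S p) with (x * x ^ p). rewrite RtoC_mult.
      destruct (Nat.leb_spec i k) as [H|H].
      * destruct (Nat.leb_spec i (S k)) as [H'|H']; [|lia].
        replace (S k - i)%nat with (S (k - i)) by lia. rewrite qq_S_S.
        pose proof (chain_cases n A i (S (k - i)) HJ ltac:(lia)) as HC.
        simpl chain in *. replace (i + S (k - i))%nat with (S k) in HC by lia.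
        replace (i + (k - i))%nat with k in * by lia.
        set (c := chain A i (k - i)) in *.
        destruct HC as [HC|[HC HE]].
        -- transitivity (RtoC x * RtoC (x ^ p) * (c * A k (S k)) * (qq (A i i) (k - i) p + qq (A i i) (S (k - i)) p * A (S k) (S k)))%C;
             [ring | rewrite HC; ring].
        -- rewrite HE. ring.
      * destruct (Nat.leb_spec i (S k)) as [H'|H']; [|ring].
        replace (S k) with i by lia. rewrite Nat.sub_diag, qq_0_S. ring.
Qed.

Lemma Climit_Clim u l : Climit u l -> Clim u l.
Proof. intros [H1 H2]. split; apply is_lim_seq_Reals; assumption. Qed.

Lemma Clim_unique u l1 l2 : Clim u l1 -> Clim u l2 -> l1 = l2.
Proof.
  intros [H1 H2] [H3 H4]. destruct l1, l2; simpl in *. f_equal; eapply UL_sequence; eassumption.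
Qed.

Lemma Clim_ext u v l : (forall n, u n = v n) -> Clim u l -> Clim v l.
Proof.
  intros E [H1 H2]. split; intros eps Heps.
  - destruct (H1 eps Heps) as [N HN]. exists N. intros n Hn. rewrite <- E. apply HN; exact Hn.
  - destruct (H2 eps Heps) as [N HN]. exists N. intros n Hn. rewrite <- E. apply HN; exact Hn.
Qed.

Lemma Clim_const l : Clim (fun _ => l) l.
Proof.
  split; intros eps Heps; exists 0%nat; intros n _; unfold Rdist; rewrite Rminus_diag, Rabs_R0; exact Heps.
Qed.

Lemma MLmat_eq al be n A i k l :
  Clim (fun N => Csum N (fun p => Cscal (/ Gamma (al * INR p + be)) (mat_pow n A p i k))) l ->
  MLmat al be n A i k = l.
Proof.
  intros H. unfold MLmat. eapply Clim_unique; [|exact H]. apply epsilon_spec. exists l; exact H.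
Qed.

Lemma Cscal_RtoC r z : Cscal r z = (RtoC r * z)%C :> CC.
Proof. apply C_ext; simpl; ring. Qed.

Lemma MLmat_jordan al be n A x i k : 0 < al < 1 -> 0 < be -> is_jordan n A -> (i < n)%nat -> (k < n)%nat ->
  MLmat al be n (Mscal x A) i k = ent A (fun lam j => MLs al be lam j x) i k.
Proof.
  intros Hal Hbe HJ Hi Hk. apply MLmat_eq.
  (* Only the values 0 and 1 of the factor [chain] occur, and for these the limit passes through the
     product trivially. *)
  assert (E : forall c : CC, (forall p, mat_pow n (Mscal x A) p i k = (c * (RtoC (x ^ p) * qq (A i i) (k - i) p))%C :> CC) ->
     c = 0 \/ c = 1 -> Clim (fun N => Csum N (fun p => Cscal (/ Gamma (al * INR p + be)) (mat_pow n (Mscal x A) p i k)))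
        (c * MLs al be (A i i) (k - i) x)%C).
  { intros c Hc Hc01.
    apply Clim_ext with (fun N => (c * Csum N (fun p => RtoC (x ^ p / Gamma (al * INR p + be)) * qq (A i i) (k - i) p))%C).
    - intros N. rewrite Csum_scal. apply Csum_ext. intros p _. rewrite Cscal_RtoC, Hc.
      unfold Rdiv. rewrite RtoC_mult. ring.
    - destruct Hc01 as [-> | ->].
      + apply Clim_ext with (fun _ => RtoC 0); [intros; symmetry; apply Cmult_0_l|].
        rewrite Cmult_0_l. apply Clim_const.
      + rewrite Cmult_1_l.
        apply Clim_ext with (fun N => Csum N (fun p => RtoC (x ^ p / Gamma (al * INR p + be)) * qq (A i i) (k - i) p)%C);
          [intros; symmetry; apply Cmult_1_l|].
        apply Climit_Clim, MLs_Climit; assumption. }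
  unfold ent. destruct (Nat.leb_spec i k) as [H|H].
  - apply E.
    + intros p. rewrite mat_pow_entry by assumption. unfold ent.
      destruct (Nat.leb_spec i k); [reflexivity | lia].
    + destruct (chain_cases n A i (k - i) HJ ltac:(lia)) as [->|[-> _]]; auto.
  - rewrite <- (Cmult_0_l (MLs al be (A i i) (k - i) x)). apply E; [|left; reflexivity].
    intros p. rewrite mat_pow_entry by assumption. unfold ent.
    destruct (Nat.leb_spec i k); [lia|]. ring.
Qed.

(** The unit vector at the first index of a block is an eigenvector; from a later index one steps
    back, the diagonal entry being constant along a superdiagonal 1. *)
Lemma jordan_diag_eigenvalue n A i : is_jordan n A -> (i < n)%nat -> eigenvalue n A (A i i).
Proof.
  intros HJ.
  assert (Hcol : forall i, (i < n)%nat -> (i = 0%nat \/ exists k, i = S k /\ A k i = C0) -> eigenvalue n A (A i i)).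
  { clear i. intros i Hi Hc. exists (fun k => if Nat.eqb k i then C1 else C0). split.
    - exists i. split; [exact Hi|]. rewrite Nat.eqb_refl. intros E. apply (f_equal fst) in E. simpl in E. lra.
    - intros k Hk. unfold mat_vec.
      change (Csum n (fun l => A k l * (if Nat.eqb l i then C1 else C0))%C
              = (A i i * (if Nat.eqb k i then C1 else C0))%C :> CC).
      rewrite (Csum_single n (fun l => A k l * (if Nat.eqb l i then C1 else C0))%C i Hi).
      + rewrite Nat.eqb_refl. destruct (Nat.eqb_spec k i) as [->|E]; [reflexivity|].
        replace (A k i) with C0.
        * change C0 with (RtoC 0). ring.
        * destruct (Nat.eq_dec i (S k)) as [E2|E2].
          -- destruct Hc as [Hc|[k' [Hc1 Hc2]]]; [lia|]. assert (k' = k) by lia. subst k'. symmetry; exact Hc2.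
          -- symmetry. apply (proj1 HJ); lia.
      + intros l Hl Hn. destruct (Nat.eqb_spec l i); [lia|]. change C0 with (RtoC 0). ring. }
  induction i as [|i IH]; intros Hi; [apply Hcol; [exact Hi | left; reflexivity]|].
  destruct (proj2 HJ i Hi) as [H|[_ H]].
  - apply Hcol; [exact Hi|]. right. exists i. split; [reflexivity | exact H].
  - rewrite <- H. apply IH; lia.
Qed.


(** * Decoupling of the solution formula along the two diagonal blocks *)

Lemma Csum_app n m (f : nat -> CC) : Csum (n + m) f = (Csum n f + Csum m (fun k => f (n + k)%nat))%C :> CC.
Proof.
  induction m as [|m IH].
  - rewrite Nat.add_0_r. symmetry. apply (Cplus_0_r (Csum n f)).
  - rewrite Nat.add_succ_r, !Csum_S, IH. symmetry. apply Cplus_assoc.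
Qed.

Definition block_diag (ds du : nat) (B : Mat) : Prop :=
  forall i j, (i < ds)%nat -> (ds <= j < ds + du)%nat -> B i j = C0 /\ B j i = C0.

Lemma block_diag_Mscal ds du B x : block_diag ds du B -> block_diag ds du (Mscal x B).
Proof.
  intros H i j Hi Hj. destruct (H i j Hi Hj) as [H1 H2]. unfold Mscal. rewrite H1, H2.
  split; unfold Cscal, C0; simpl; f_equal; ring.
Qed.

Lemma mat_pow_block ds du B p : block_diag ds du B -> forall i j,
  ((i < ds)%nat -> (j < ds)%nat -> mat_pow (ds + du) B p i j = mat_pow ds B p i j) /\
  ((i < du)%nat -> (j < du)%nat -> mat_pow (ds + du) B p (ds + i)%nat (ds + j)%nat = mat_pow du (blk_u ds B) p i j) /\
  ((i < ds)%nat -> (j < du)%nat -> mat_pow (ds + du) B p i (ds + j)%nat = C0 /\ mat_pow (ds + du) B p (ds + j)%nat i = C0).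
Proof.
  intros HB. induction p as [|p IH]; intros i j.
  - simpl. unfold mat_id. split; [reflexivity|]. split.
    + intros _ _. destruct (Nat.eqb_spec i j) as [->|E]; [rewrite Nat.eqb_refl; reflexivity|].
      destruct (Nat.eqb_spec (ds + i) (ds + j)); [lia | reflexivity].
    + intros Hi Hj. split; [destruct (Nat.eqb_spec i (ds + j)) | destruct (Nat.eqb_spec (ds + j) i)]; (lia || reflexivity).
  - assert (E : forall n A a b, mat_pow n A (S p) a b = Csum n (fun k => mat_pow n A p a k * A k b)%C :> CC) by reflexivity.
    split; [|split].
    + intros Hi Hj. rewrite !E, Csum_app.
      rewrite (Csum_0 du).
      * rewrite Cplus_0_r. apply Csum_ext. intros k Hk. rewrite (proj1 (IH i k)) by assumption. reflexivity.
      * intros k Hk. rewrite (proj1 (proj2 (proj2 (IH i k)) Hi Hk)). change C0 with (RtoC 0). ring.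
    + intros Hi Hj. rewrite !E, Csum_app.
      rewrite (Csum_0 ds).
      * rewrite Cplus_0_l. apply Csum_ext. intros k Hk. rewrite (proj1 (proj2 (IH i k))) by assumption. reflexivity.
      * intros k Hk. rewrite (proj2 (proj2 (proj2 (IH k i)) Hk Hi)). change C0 with (RtoC 0). ring.
    + intros Hi Hj. rewrite !E, !Csum_app. split.
      * rewrite (Csum_0 ds), (Csum_0 du); [apply (Cplus_0_r (RtoC 0)) | |].
        -- intros k Hk. rewrite (proj1 (proj2 (proj2 (IH i k)) Hi Hk)). change C0 with (RtoC 0). ring.
        -- intros k Hk. rewrite (proj1 (HB k (ds + j)%nat Hk ltac:(lia))). change C0 with (RtoC 0). ring.
      * rewrite (Csum_0 ds), (Csum_0 du); [apply (Cplus_0_r (RtoC 0)) | |].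
        -- intros k Hk. rewrite (proj2 (HB i (ds + k)%nat Hi ltac:(lia))). change C0 with (RtoC 0). ring.
        -- intros k Hk. rewrite (proj2 (proj2 (proj2 (IH k j)) Hk Hj)). change C0 with (RtoC 0). ring.
Qed.

Lemma MLmat_block al be ds du B : block_diag ds du B -> forall i j,
  ((i < ds)%nat -> (j < ds)%nat -> MLmat al be (ds + du) B i j = MLmat al be ds B i j) /\
  ((i < du)%nat -> (j < du)%nat -> MLmat al be (ds + du) B (ds + i)%nat (ds + j)%nat = MLmat al be du (blk_u ds B) i j) /\
  ((i < ds)%nat -> (j < du)%nat -> MLmat al be (ds + du) B i (ds + j)%nat = C0 /\ MLmat al be (ds + du) B (ds + j)%nat i = C0).
Proof.
  intros HB i j. 
  assert (Z : forall a b, (forall p, mat_pow (ds + du) B p a b = C0) -> MLmat al be (ds + du) B a b = C0).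
  { intros a b H. apply MLmat_eq. apply Clim_ext with (fun _ => C0); [|apply Clim_const].
    intros n. symmetry. apply Csum_0. intros k _. rewrite H, Cscal_RtoC. change C0 with (RtoC 0). ring. }
  split; [|split].
  - intros Hi Hj. unfold MLmat. f_equal. f_equal. apply functional_extensionality. intros N. f_equal.
    apply functional_extensionality. intros p. f_equal. apply (mat_pow_block ds du B p HB i j); assumption.
  - intros Hi Hj. unfold MLmat. f_equal. f_equal. apply functional_extensionality. intros N. f_equal.
    apply functional_extensionality. intros p. f_equal. apply (mat_pow_block ds du B p HB i j); assumption.
  - intros Hi Hj. split; apply Z; intros p; apply (mat_pow_block ds du B p HB i j); assumption.
Qed.

Lemma mat_vec_ext n A A' v v' i :
  (forall k, (k < n)%nat -> A i k = A' i k) -> (forall k, (k < n)%nat -> v k = v' k) ->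
  mat_vec n A v i = mat_vec n A' v' i.
Proof.
  intros HA Hv. apply Csum_ext. intros k Hk. rewrite HA, Hv by exact Hk. reflexivity.
Qed.

Lemma MLmat_vec_block_s al be ds du B v i x : block_diag ds du B -> (i < ds)%nat ->
  mat_vec (ds + du) (MLmat al be (ds + du) (Mscal x B)) v i = mat_vec ds (MLmat al be ds (Mscal x B)) v i.
Proof.
  intros HB Hi. pose proof (MLmat_block al be ds du (Mscal x B) (block_diag_Mscal _ _ _ _ HB)) as HM.
  change (Csum (ds + du) (fun k => MLmat al be (ds + du) (Mscal x B) i k * v k)%C
          = mat_vec ds (MLmat al be ds (Mscal x B)) v i :> CC).
  rewrite Csum_app, (Csum_0 du), Cplus_0_r.
  - apply Csum_ext. intros k Hk. rewrite (proj1 (HM i k)) by assumption. reflexivity.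
  - intros k Hk. rewrite (proj1 (proj2 (proj2 (HM i k)) Hi Hk)). change C0 with (RtoC 0). ring.
Qed.

Lemma MLmat_vec_block_u al be ds du B v i x : block_diag ds du B -> (i < du)%nat ->
  mat_vec (ds + du) (MLmat al be (ds + du) (Mscal x B)) v (ds + i)%nat
  = mat_vec du (MLmat al be du (Mscal x (blk_u ds B))) (fun k => v (ds + k)%nat) i.
Proof.
  intros HB Hi. pose proof (MLmat_block al be ds du (Mscal x B) (block_diag_Mscal _ _ _ _ HB)) as HM.
  change (Csum (ds + du) (fun k => MLmat al be (ds + du) (Mscal x B) (ds + i)%nat k * v k)%C
          = mat_vec du (MLmat al be du (Mscal x (blk_u ds B))) (fun k => v (ds + k)%nat) i :> CC).
  rewrite Csum_app, (Csum_0 ds), Cplus_0_l.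
  - apply Csum_ext. intros k Hk. rewrite (proj1 (proj2 (HM i k))) by assumption. reflexivity.
  - intros k Hk. rewrite (proj2 (proj2 (proj2 (HM k i)) Hk Hi)). change C0 with (RtoC 0). ring.
Qed.

Lemma sol_block_s ds du al B g y0 t i : block_diag ds du B -> (i < ds)%nat ->
  sol (ds + du) al B g y0 t i = sol ds al B g y0 t i.
Proof.
  intros HB Hi. unfold sol. rewrite MLmat_vec_block_s by assumption. f_equal. f_equal.
  apply functional_extensionality. intros s. rewrite MLmat_vec_block_s by assumption. reflexivity.
Qed.

Lemma sol_block_u ds du al B g y0 t i : block_diag ds du B -> (i < du)%nat ->
  sol (ds + du) al B g y0 t (ds + i)%nat
  = sol du al (blk_u ds B) (vec_u ds g) (fun k => y0 (ds + k)%nat) t i.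
Proof.
  intros HB Hi. unfold sol. rewrite MLmat_vec_block_u by assumption. f_equal. f_equal.
  apply functional_extensionality. intros s. rewrite MLmat_vec_block_u by assumption. reflexivity.
Qed.

Lemma sol_ext n al A g y0 y1 t i : (forall k, (k < n)%nat -> y0 k = y1 k) ->
  sol n al A g y0 t i = sol n al A g y1 t i.
Proof. intros H. unfold sol. f_equal. apply mat_vec_ext; auto. Qed.
(** * Convolutions with singular kernels *)

(** An improper integral at the upper end t. Continuity is imposed for all s < t, negative s
    included, so that the integrals over [0, v] exist without one-sided conditions at 0; this is why
    g is later extended to the left. *)
Definition is_cimp (f : R -> CC) (t : R) (l : CC) : Prop :=
  (forall s, s < t -> ccont f s) /\
  forall eps, 0 < eps -> exists del, 0 < del /\
    forall v, t - del < v < t -> 0 < v -> Cmod (CI f 0 v - l)%C < eps.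

Lemma is_impint_unique f a b l1 l2 : a < b -> is_impint f a b l1 -> is_impint f a b l2 -> l1 = l2.
Proof.
  intros Hab H1 H2. apply cond_eq. intros e He.
  destruct (H1 (e / 2)) as [d1 [Hd1 HH1]]; [lra|].
  destruct (H2 (e / 2)) as [d2 [Hd2 HH2]]; [lra|].
  assert (Hm : 0 < Rmin d1 d2) by (apply Rmin_glb_lt; assumption).
  pose proof (Rmin_l d1 d2). pose proof (Rmin_r d1 d2).
  destruct (HH1 (b - Rmin d1 d2 / 2)) as [I1 [E1 B1]]; [lra|].
  destruct (HH2 (b - Rmin d1 d2 / 2)) as [I2 [E2 B2]]; [lra|].
  apply RInt_eq_inv in E1; apply RInt_eq_inv in E2.
  destruct E1 as [_ <-], E2 as [_ <-].
  apply Rabs_def2 in B1; apply Rabs_def2 in B2. apply Rabs_def1; lra.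
Qed.

(** [h] is the literal integrand of the solution formula and [f] its continuous model; they need to
    agree only inside (0, t). Uniqueness of the limit pins down the value chosen by [epsilon]. *)
Lemma Cimpint_eq (f h : R -> CC) t l : 0 < t -> (forall s, 0 < s < t -> h s = f s) ->
  is_cimp f t l -> Cimpint h 0 t = l.
Proof.
  intros Ht Hext [Hc HL].
  assert (Hex : forall v, 0 < v < t -> ex_RInt (fun s => fst (h s)) 0 v /\ ex_RInt (fun s => snd (h s)) 0 v /\ CI h 0 v = CI f 0 v).
  { intros v Hv.
    assert (Hcf : forall x, Rmin 0 v <= x <= Rmax 0 v -> ccont f x).
    { intros x Hx. rewrite Rmax_right in Hx by lra. apply Hc; lra. }
    split; [|split].
    - apply (ex_RInt_ext (V:=R_NormedModule)) with (fun s => fst (f s)).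
      + intros x Hx. rewrite Rmin_left, Rmax_right in Hx by lra. rewrite Hext by lra. reflexivity.
      + apply ccont_ex_RInt_fst; exact Hcf.
    - apply (ex_RInt_ext (V:=R_NormedModule)) with (fun s => snd (f s)).
      + intros x Hx. rewrite Rmin_left, Rmax_right in Hx by lra. rewrite Hext by lra. reflexivity.
      + apply ccont_ex_RInt_snd; exact Hcf.
    - apply CI_ext. intros x Hx. rewrite Rmin_left, Rmax_right in Hx by lra. apply Hext; lra. }
  assert (HI : is_impint (fun s => fst (h s)) 0 t (fst l) /\ is_impint (fun s => snd (h s)) 0 t (snd l)).
  { split; intros eps Heps; destruct (HL eps Heps) as [del [Hdel HD]];
      exists (Rmin del t); (split; [apply Rmin_glb_lt; assumption|]); intros v Hv;
      pose proof (Rmin_l del t); pose proof (Rmin_r del t);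
      specialize (HD v ltac:(lra) ltac:(lra)); destruct (Hex v ltac:(lra)) as [E1 [E2 E3]].
    - exists (RInt (fun s => fst (h s)) 0 v). split; [apply RInt_eq_RInt; exact E1|].
      rewrite <- E3 in HD. eapply Rle_lt_trans; [|exact HD]. apply (abs_fst_le_Cmod (CI h 0 v - l)%C).
    - exists (RInt (fun s => snd (h s)) 0 v). split; [apply RInt_eq_RInt; exact E2|].
      rewrite <- E3 in HD. eapply Rle_lt_trans; [|exact HD]. apply (abs_snd_le_Cmod (CI h 0 v - l)%C). }
  destruct HI as [H1 H2]. unfold Cimpint. apply C_ext; simpl.
  - apply is_impint_unique with (fun s => fst (h s)) 0 t; [exact Ht | | exact H1].
    unfold impint. apply epsilon_spec. eexists; exact H1.
  - apply is_impint_unique with (fun s => snd (h s)) 0 t; [exact Ht | | exact H2].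
    unfold impint. apply epsilon_spec. eexists; exact H2.
Qed.

Lemma is_cimp_ccont f t : 0 < t -> (forall s, ccont f s) -> is_cimp f t (CI f 0 t).
Proof.
  intros Ht Hc. split; [auto|]. intros eps Heps.
  destruct (ccont_bounded f 0 t) as [M [HM HB]]; [lra | auto|].
  exists (eps / (M + 1)). split; [apply Rdiv_lt_0_compat; lra|]. intros v Hv Hv0.
  rewrite <- (CI_Chasles f 0 v t) by auto.
  replace (CI f 0 v - (CI f 0 v + CI f v t))%C with (- CI f v t)%C by ring.
  rewrite Cmod_opp. apply Rle_lt_trans with (M * (t - v)).
  - apply CI_bound_const; [lra | auto | intros; apply HB; lra].
  - assert ((M + 1) * (t - v) < eps).
    { apply Rmult_lt_reg_l with (/ (M + 1)); [apply Rinv_0_lt_compat; lra|].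
      rewrite <- Rmult_assoc, Rinv_l, Rmult_1_l by lra. unfold Rdiv in Hv. lra. }
    nra.
Qed.

Lemma is_cimp_plus f h t l m : is_cimp f t l -> is_cimp h t m ->
  is_cimp (fun s => f s + h s)%C t (l + m)%C.
Proof.
  intros [Hf1 Hf2] [Hh1 Hh2]. split.
  - intros s Hs. apply ccont_plus; auto.
  - intros eps Heps. destruct (Hf2 (eps / 2)) as [d1 [Hd1 H1]]; [lra|].
    destruct (Hh2 (eps / 2)) as [d2 [Hd2 H2]]; [lra|].
    exists (Rmin d1 d2). split; [apply Rmin_glb_lt; assumption|]. intros v Hv Hv0.
    pose proof (Rmin_l d1 d2). pose proof (Rmin_r d1 d2).
    specialize (H1 v ltac:(lra) Hv0). specialize (H2 v ltac:(lra) Hv0).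
    rewrite CI_plus.
    + replace (CI f 0 v + CI h 0 v - (l + m))%C with ((CI f 0 v - l) + (CI h 0 v - m))%C by ring.
      eapply Rle_lt_trans; [apply Cmod_triangle|]. lra.
    + intros x Hx. rewrite Rmax_right in Hx by lra. apply Hf1; lra.
    + intros x Hx. rewrite Rmax_right in Hx by lra. apply Hh1; lra.
Qed.

Lemma is_cimp_Csum n (f : nat -> R -> CC) t (l : nat -> CC) : 0 < t ->
  (forall k, (k < n)%nat -> is_cimp (f k) t (l k)) ->
  is_cimp (fun s => Csum n (fun k => f k s)) t (Csum n l).
Proof.
  intros Ht. induction n as [|n IH]; intros H.
  - pose proof (is_cimp_ccont (fun _ => RtoC 0) t Ht (fun s => ccont_const _ s)) as HC.
    replace (Csum 0 l) with (CI (fun _ => RtoC 0) 0 t); [exact HC|].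
    unfold CI; simpl. rewrite RInt_const. apply C_ext; simpl; unfold scal; simpl; unfold mult; simpl; ring.
  - apply (is_cimp_plus (fun s => Csum n (fun k => f k s)) (f n) t (Csum n l) (l n)).
    + apply IH. intros; apply H; lia.
    + apply H; lia.
Qed.

Lemma Rpower_small al e : 0 < al -> 0 < e -> exists del, 0 < del /\ forall x, 0 < x < del -> Rpower x al < e.
Proof.
  intros Hal He. exists (exp (ln e / al)). split; [apply exp_pos|]. intros x Hx.
  unfold Rpower. rewrite <- (exp_ln e He) at 1. apply exp_increasing.
  destruct Hx as [Hx0 Hx]. apply ln_increasing in Hx; [|exact Hx0]. rewrite ln_exp in Hx.
  apply Rmult_lt_reg_l with (/ al); [apply Rinv_0_lt_compat; lra|].
  rewrite <- Rmult_assoc, Rinv_l, Rmult_1_l by lra. unfold Rdiv in Hx. lra.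
Qed.

Lemma Rpower_large al e : 0 < al -> 0 < e -> exists X, 0 < X /\ forall x, X < x -> Rpower x (- al) < e.
Proof.
  intros Hal He. destruct (Rpower_small al e Hal He) as [del [Hdel H]].
  exists (/ del). split; [apply Rinv_0_lt_compat; exact Hdel|]. intros x Hx.
  assert (0 < / del) by (apply Rinv_0_lt_compat; exact Hdel).
  replace (Rpower x (- al)) with (Rpower (/ x) al).
  - apply H. split; [apply Rinv_0_lt_compat; lra|].
    rewrite <- (Rinv_inv del). apply Rinv_lt_contravar; [|exact Hx]. nra.
  - unfold Rpower. rewrite ln_Rinv by lra. f_equal; ring.
Qed.

(** A primitive of [rho al]. It stays between -1/al and 0, so [rho al] has total mass 1/al on the
    half line. *)
Definition Nf (al x : R) : R := - / (al * (1 + Rpower x al)).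

Lemma is_RInt_rho al t a b : 0 < al -> a <= b < t ->
  is_RInt (fun s => rho al (t - s)) a b (Nf al (t - a) - Nf al (t - b)).
Proof.
  intros Hal Hab.
  replace (Nf al (t - a) - Nf al (t - b)) with (- Nf al (t - b) - - Nf al (t - a)) by ring.
  apply (is_RInt_derive (V:=R_CompleteNormedModule) (fun s => - Nf al (t - s)));
    intros s Hs; rewrite Rmin_left, Rmax_right in Hs by lra.
  - unfold Nf, rho, Rpower. pose proof (exp_pos (al * ln (t - s))) as Hp.
    auto_derive.
    + split; [lra|]. split; [|exact I]. apply Rgt_not_eq. change (0 < al * (1 + exp (al * ln (t - s)))). nra.
    + change (t + - s) with (t - s).
      replace ((al - 1) * ln (t - s)) with (al * ln (t - s) + - ln (t - s)) by ring.
      rewrite exp_plus, (exp_Ropp (ln (t - s))), exp_ln by lra.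
      field. repeat split; lra.
  - unfold rho, Rpower. pose proof (exp_pos (al * ln (t - s))) as Hp.
    apply (ex_derive_continuous (V:=R_NormedModule)). auto_derive.
    split; [lra|]. split; [lra|]. split; [|exact I]. apply Rgt_not_eq.
    change (0 < (1 + exp (al * ln (t - s))) * ((1 + exp (al * ln (t - s))) * 1)). nra.
Qed.

Lemma Nf_bounds al x : 0 < al -> - / al <= Nf al x <= 0 /\ Nf al x + / al <= / al * Rpower x al.
Proof.
  intros Hal. unfold Nf. assert (0 < Rpower x al) by apply exp_pos. set (X := Rpower x al) in *.
  assert (E : / (al * (1 + X)) = / al * / (1 + X)) by (field; lra). rewrite E.
  assert (0 < / al) by (apply Rinv_0_lt_compat; lra).
  assert (0 < / (1 + X)) by (apply Rinv_0_lt_compat; lra).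
  assert (/ (1 + X) <= 1) by (rewrite <- Rinv_1; apply Rinv_le_contravar; lra).
  assert (1 - / (1 + X) <= X).
  { replace (1 - / (1 + X)) with (X * / (1 + X)) by (field; lra). nra. }
  split; [split; nra|]. nra.
Qed.

Lemma conv_piece (Q gx : R -> CC) al K M t a b : 0 < al -> 0 <= K -> a <= b < t ->
  (forall x, 0 < x -> ccont Q x) -> (forall x, 0 < x -> Cmod (Q x) <= K * rho al x) ->
  (forall s, ccont gx s) -> (forall s, a <= s <= b -> Cmod (gx s) <= M) ->
  Cmod (CI (fun s => Q (t - s)%R * gx s)%C a b) <= K * M * (Nf al (t - a) - Nf al (t - b)).
Proof.
  intros Hal HK Hab HQ HQb Hg HM.
  pose proof (is_RInt_rho al t a b Hal Hab) as HR.
  assert (HR2 : RInt (fun s => K * M * rho al (t - s)) a b = K * M * (Nf al (t - a) - Nf al (t - b))).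
  { rewrite (RInt_scal (V:=R_CompleteNormedModule) _ a b (K * M)) by (eexists; exact HR).
    rewrite (is_RInt_unique _ _ _ _ HR). reflexivity. }
  rewrite <- HR2. apply CI_bound; [lra | | |].
  - intros s Hs. apply ccont_mult; [|apply Hg].
    apply (ccont_comp (fun s => t - s) Q); [|apply HQ; lra].
    apply (continuous_minus (V:=R_NormedModule)); [apply continuous_const | apply continuous_id].
  - apply (ex_RInt_scal (V:=R_NormedModule)). eexists; exact HR.
  - intros s Hs. rewrite Cmod_mult.
    replace (K * M * rho al (t - s)) with (K * rho al (t - s) * M) by ring.
    apply Rmult_le_compat; try apply Cmod_ge_0; [apply HQb; lra | apply HM; lra].
Qed.

(** The piece over [a, b] is at most K M (t - a)^al / al, so the integrals up to v satisfy the
    Cauchy criterion as v tends to t. In the last bound the interval is cut at T0: the past before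
    T0 has small kernel mass, and after T0 the data are at most e. *)
Lemma conv_limit (Q gx : R -> CC) al K M t : 0 < al -> 0 <= K -> 0 <= M -> 0 < t ->
  (forall x, 0 < x -> ccont Q x) -> (forall x, 0 < x -> Cmod (Q x) <= K * rho al x) ->
  (forall s, ccont gx s) -> (forall s, Cmod (gx s) <= M) ->
  exists l, is_cimp (fun s => Q (t - s)%R * gx s)%C t l /\ Cmod l <= K * M / al /\
    (forall T0 e, 0 <= T0 < t -> 0 <= e -> (forall s, T0 <= s -> Cmod (gx s) <= e) ->
       Cmod l <= K * M / (al * (1 + Rpower (t - T0) al)) + K * e / al).
Proof.
  intros Hal HK HM Ht HQ HQb Hg HMb.
  set (f := fun s => (Q (t - s)%R * gx s)%C).
  assert (Hf : forall s, s < t -> ccont f s).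
  { intros s Hs. apply ccont_mult; [|apply Hg].
    apply (ccont_comp (fun s => t - s) Q); [|apply HQ; lra].
    apply (continuous_minus (V:=R_NormedModule)); [apply continuous_const | apply continuous_id]. }
  assert (HKM : 0 <= K * M) by (apply Rmult_le_pos; assumption).
  assert (Hia : 0 < / al) by (apply Rinv_0_lt_compat; exact Hal).
  assert (Hpiece : forall a b M', a <= b < t -> (forall s, a <= s <= b -> Cmod (gx s) <= M') ->
      Cmod (CI f a b) <= K * M' * (Nf al (t - a) - Nf al (t - b))).
  { intros a b M' Hab HM'. apply conv_piece; auto. }
  assert (HCh : forall a b, 0 <= a <= b -> b < t -> (CI f 0 b - CI f 0 a)%C = CI f a b).
  { intros a b Hab Hb. rewrite <- (CI_Chasles f 0 a b); [ring| |];
      intros x Hx; rewrite ?Rmax_right in Hx by lra; apply Hf; lra. }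
  assert (Htail : forall a b, 0 <= a <= b -> b < t ->
      Cmod (CI f 0 b - CI f 0 a)%C <= K * M * (/ al * Rpower (t - a) al)).
  { intros a b Hab Hb. rewrite HCh by assumption.
    eapply Rle_trans; [apply (Hpiece a b M); [lra | auto]|].
    apply Rmult_le_compat_l; [exact HKM|].
    destruct (Nf_bounds al (t - a) Hal) as [_ B1]. destruct (Nf_bounds al (t - b) Hal) as [[B2 _] _]. lra. }
  assert (Hsmall : forall e, 0 < e -> exists del, 0 < del /\ forall a b, 0 <= a <= b -> b < t -> t - del < a ->
      Cmod (CI f 0 b - CI f 0 a)%C < e).
  { intros e He. destruct (Rpower_small al (e / (K * M * / al + 1)) Hal) as [del [Hdel HD]].
    { apply Rdiv_lt_0_compat; [exact He|]. nra. }
    exists del. split; [exact Hdel|]. intros a b Hab Hb Ha.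
    eapply Rle_lt_trans; [apply Htail; assumption|].
    specialize (HD (t - a) ltac:(lra)).
    assert (Hp : 0 < Rpower (t - a) al) by apply exp_pos.
    assert (Hc : 0 < K * M * / al + 1) by nra.
    apply Rlt_le_trans with ((K * M * / al + 1) * (e / (K * M * / al + 1))); [|right; field; split; lra].
    apply Rlt_trans with ((K * M * / al + 1) * Rpower (t - a) al); [nra | apply Rmult_lt_compat_l; assumption]. }
  (* An increasing sequence in [0, t) with limit t; the shift by 2 makes it start at t / 2. *)
  set (v := fun n => t - t / (INR n + 2)).
  assert (Hv : forall n, 0 <= v n < t).
  { intros n. pose proof (pos_INR n). unfold v.
    assert (0 < t / (INR n + 2)) by (apply Rdiv_lt_0_compat; lra).
    assert (t / (INR n + 2) <= t).
    { unfold Rdiv. rewrite <- (Rmult_1_r t) at 2. apply Rmult_le_compat_l; [lra|].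
      rewrite <- Rinv_1. apply Rinv_le_contravar; lra. }
    lra. }
  assert (Hvlim : forall del, 0 < del -> exists N, forall n, (N <= n)%nat -> t - del < v n).
  { intros del Hdel. destruct (nfloor_ex (t / del)) as [N HN]; [left; apply Rdiv_lt_0_compat; lra|].
    exists N. intros n Hn. unfold v. apply le_INR in Hn.
    assert (t / (INR n + 2) < del); [|lra].
    pose proof (pos_INR n).
    apply Rmult_lt_reg_r with (INR n + 2); [lra|]. unfold Rdiv. rewrite Rmult_assoc, Rinv_l, Rmult_1_r by lra.
    assert (t / del < INR n + 2) by lra.
    apply (Rmult_lt_compat_r del) in H0; [|lra]. unfold Rdiv in H0. rewrite Rmult_assoc, Rinv_l in H0 by lra. lra. }
  assert (Hvmono : forall n m, (n <= m)%nat -> v n <= v m).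
  { intros n m Hnm. apply le_INR in Hnm. pose proof (pos_INR n). unfold v.
    assert (t / (INR m + 2) <= t / (INR n + 2)); [|lra].
    apply Rmult_le_compat_l; [lra|]. apply Rinv_le_contravar; lra. }
  destruct (C_seq_cauchy (fun n => CI f 0 (v n))) as [l Hl].
  { intros e He. destruct (Hsmall e He) as [del [Hdel HD]]. destruct (Hvlim del Hdel) as [N HN].
    exists N. intros n m Hn Hm. apply HD; [split; [apply Hv | apply Hvmono; exact Hm] | apply Hv | apply HN; exact Hn]. }
  assert (HL : forall eps, 0 < eps -> exists del, 0 < del /\
    forall v, t - del < v < t -> 0 < v -> Cmod (CI f 0 v - l)%C < eps).
  { intros e He. destruct (Hsmall (e / 2)) as [del [Hdel HD]]; [lra|].
    exists del. split; [exact Hdel|]. intros w Hw Hw0.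
    destruct (Hl (e / 2)) as [N1 HN1]; [lra|]. destruct (Hvlim (t - w)) as [N2 HN2]; [lra|].
    specialize (HN1 (max N1 N2) ltac:(lia)). specialize (HN2 (max N1 N2) ltac:(lia)).
    set (n := max N1 N2) in *.
    specialize (HD w (v n) ltac:(split; lra) ltac:(apply Hv) ltac:(lra)).
    replace (CI f 0 w - l)%C with (- (CI f 0 (v n) - CI f 0 w) + (CI f 0 (v n) - l))%C by ring.
    eapply Rle_lt_trans; [apply Cmod_triangle|]. rewrite Cmod_opp. lra. }
  assert (Hbd : forall B v0, 0 <= v0 < t -> (forall v, v0 < v < t -> Cmod (CI f 0 v) <= B) -> Cmod l <= B).
  { intros B v0 Hv0 HB. apply le_epsilon. intros e He. destruct (HL e He) as [del [Hdel HD]].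
    set (w := (Rmax v0 (t - del) + t) / 2).
    assert (Rmax v0 (t - del) < t) by (apply Rmax_lub_lt; lra).
    pose proof (Rmax_l v0 (t - del)). pose proof (Rmax_r v0 (t - del)).
    assert (Hw : v0 < w < t /\ t - del < w) by (unfold w; lra).
    specialize (HD w ltac:(lra) ltac:(lra)). specialize (HB w ltac:(lra)).
    replace l with (CI f 0 w + - (CI f 0 w - l))%C by ring.
    eapply Rle_trans; [apply Cmod_triangle|]. rewrite Cmod_opp. lra. }
  exists l. split; [split; [exact Hf | exact HL]|]. split.
  - apply (Hbd _ 0); [lra|]. intros w Hw.
    eapply Rle_trans; [apply (Hpiece 0 w M); [lra | auto]|].
    unfold Rdiv. apply Rmult_le_compat_l; [exact HKM|].
    destruct (Nf_bounds al (t - 0) Hal) as [[_ B1] _]. destruct (Nf_bounds al (t - w) Hal) as [[B2 _] _]. lra.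
  - intros T0 e HT0 He Hge. apply (Hbd _ T0); [exact HT0|]. intros w Hw.
    replace (CI f 0 w) with (CI f 0 T0 + (CI f 0 w - CI f 0 T0))%C by ring.
    eapply Rle_trans; [apply Cmod_triangle|]. rewrite HCh by lra.
    apply Rplus_le_compat.
    + eapply Rle_trans; [apply (Hpiece 0 T0 M); [lra | auto]|].
      unfold Rdiv. apply Rmult_le_compat_l; [exact HKM|].
      destruct (Nf_bounds al (t - 0) Hal) as [[_ B1] _]. unfold Nf at 2. lra.
    + eapply Rle_trans; [apply (Hpiece T0 w e); [lra | intros; apply Hge; lra]|].
      unfold Rdiv. apply Rmult_le_compat_l; [apply Rmult_le_pos; lra|].
      destruct (Nf_bounds al (t - T0) Hal) as [[_ B1] _]. destruct (Nf_bounds al (t - w) Hal) as [[B2 _] _]. lra.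
Qed.
(** * Bounded solutions *)

(** Restricted to t > 0, where [rpow] is a genuine power and the improper integral has a
    nondegenerate interval; [bounded_on_of_Bd] adds t = 0. *)
Definition Bd (F : R -> CC) : Prop := exists C, forall t, 0 < t -> Cmod (F t) <= C.
Definition Tz (F : R -> CC) : Prop :=
  forall e, 0 < e -> exists T, 0 < T /\ forall t, T <= t -> Cmod (F t) <= e.

Lemma Bd_ext F G : (forall t, 0 < t -> F t = G t) -> Bd F -> Bd G.
Proof. intros E [C H]. exists C. intros t Ht. rewrite <- E by exact Ht. auto. Qed.

Lemma Tz_ext F G : (forall t, 0 < t -> F t = G t) -> Tz F -> Tz G.
Proof.
  intros E H e He. destruct (H e He) as [T [HT HH]]. exists T. split; [exact HT|].
  intros t Ht. rewrite <- E by lra. auto.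
Qed.

Lemma Bd_plus F G : Bd F -> Bd G -> Bd (fun t => F t + G t)%C.
Proof.
  intros [C1 H1] [C2 H2]. exists (C1 + C2). intros t Ht.
  eapply Rle_trans; [apply Cmod_triangle|]. specialize (H1 t Ht). specialize (H2 t Ht). lra.
Qed.

Lemma Tz_plus F G : Tz F -> Tz G -> Tz (fun t => F t + G t)%C.
Proof.
  intros H1 H2 e He. destruct (H1 (e / 2)) as [T1 [HT1 HH1]]; [lra|].
  destruct (H2 (e / 2)) as [T2 [HT2 HH2]]; [lra|].
  exists (Rmax T1 T2). pose proof (Rmax_l T1 T2). pose proof (Rmax_r T1 T2). split; [lra|]. intros t Ht.
  eapply Rle_trans; [apply Cmod_triangle|]. specialize (HH1 t ltac:(lra)). specialize (HH2 t ltac:(lra)). lra.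
Qed.

Lemma Bd_const_mult F c : Bd F -> Bd (fun t => F t * c)%C.
Proof.
  intros [C1 H1]. exists (C1 * Cmod c). intros t Ht. rewrite Cmod_mult.
  apply Rmult_le_compat_r; [apply Cmod_ge_0 | auto].
Qed.

Lemma Tz_const_mult F c : Tz F -> Tz (fun t => F t * c)%C.
Proof.
  intros H e He. pose proof (Cmod_ge_0 c) as Hc.
  destruct (H (e / (Cmod c + 1))) as [T [HT HH]]; [apply Rdiv_lt_0_compat; lra|].
  exists T. split; [exact HT|]. intros t Ht. rewrite Cmod_mult. specialize (HH t Ht).
  pose proof (Cmod_ge_0 (F t)).
  apply Rle_trans with (e / (Cmod c + 1) * (Cmod c + 1)); [apply Rmult_le_compat; lra | right; field; lra].
Qed.

Lemma Bd_Csum n (F : nat -> R -> CC) : (forall k, (k < n)%nat -> Bd (F k)) -> Bd (fun t => Csum n (fun k => F k t)).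
Proof.
  induction n as [|n IH]; intros H.
  - exists 0. intros t _. change (Cmod 0 <= 0). rewrite Cmod_0. lra.
  - apply (Bd_plus (fun t => Csum n (fun k => F k t)) (F n)); [apply IH; intros; apply H; lia | apply H; lia].
Qed.

Lemma Tz_Csum n (F : nat -> R -> CC) : (forall k, (k < n)%nat -> Tz (F k)) -> Tz (fun t => Csum n (fun k => F k t)).
Proof.
  induction n as [|n IH]; intros H.
  - intros e He. exists 1. split; [lra|]. intros t _. change (Cmod 0 <= e). rewrite Cmod_0. lra.
  - apply (Tz_plus (fun t => Csum n (fun k => F k t)) (F n)); [apply IH; intros; apply H; lia | apply H; lia].
Qed.

Lemma finite_bound n (P : nat -> R -> Prop) :
  (forall k C C', C <= C' -> P k C -> P k C') ->
  (forall k, (k < n)%nat -> exists C, P k C) -> exists C, 0 <= C /\ forall k, (k < n)%nat -> P k C.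
Proof.
  intros Hmono. induction n as [|n IH]; intros H.
  - exists 0. split; [lra|]. intros; lia.
  - destruct IH as [C1 [HC1 H1]]; [intros; apply H; lia|]. destruct (H n) as [C2 H2]; [lia|].
    exists (Rmax C1 C2). pose proof (Rmax_l C1 C2). pose proof (Rmax_r C1 C2). split; [lra|].
    intros k Hk. destruct (Nat.eq_dec k n) as [->|E].
    + apply (Hmono n C2); assumption.
    + apply (Hmono k C1); [assumption | apply H1; lia].
Qed.

Lemma ML_part al (lam : CC) j : 0 < al < 1 -> lam <> 0 -> Rabs (Carg lam) <> al * PI / 2 ->
  Bd (fun t => MLs al 1 lam j (Rpower t al) - pp al lam j 0 t)%C /\
  Tz (fun t => MLs al 1 lam j (Rpower t al) - pp al lam j 0 t)%C.
Proof.
  intros Hal Hl Hne. destruct (ML_asym_pp al lam j Hal Hl Hne) as [C [HC HB]]. split.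
  - destruct (ccont_bounded (MLs al 1 lam j) 0 1) as [M1 [HM1 HB1]]; [lra | intros; apply MLs_continuous; lra|].
    destruct (ccont_bounded (fun t => pp al lam j 0 t) 0 1) as [M2 [HM2 HB2]]; [lra | intros; apply pp_continuous|].
    exists (C + M1 + M2). intros t Ht. destruct (Rle_lt_dec t 1) as [H1|H1].
    + assert (HP : 0 < Rpower t al <= 1).
      { split; [apply exp_pos|]. unfold Rpower. rewrite <- exp_0. apply exp_le.
        assert (ln t <= 0) by (rewrite <- ln_1; destruct H1 as [H1|H1]; [left; apply ln_increasing; lra | rewrite H1; lra]). nra. }
      eapply Rle_trans; [apply Cmod_triangle|]. rewrite Cmod_opp.
      specialize (HB1 (Rpower t al) ltac:(lra)). specialize (HB2 t ltac:(lra)). cbv beta in HB2. lra.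
    + assert (HP : Rpower t (- al) <= 1).
      { unfold Rpower. rewrite <- exp_0. apply exp_le.
        assert (0 < ln t) by (rewrite <- ln_1; apply ln_increasing; lra). nra. }
      specialize (HB t Ht). nra.
  - intros e He. destruct (Rpower_large al (e / (C + 1))) as [X [HX HX2]]; [lra | apply Rdiv_lt_0_compat; lra|].
    exists (X + 1). split; [lra|]. intros t Ht. specialize (HX2 t ltac:(lra)). specialize (HB t ltac:(lra)).
    assert (0 < Rpower t (- al)) by apply exp_pos.
    apply Rle_trans with ((C + 1) * (e / (C + 1))); [|right; field; lra].
    eapply Rle_trans; [exact HB|]. apply Rmult_le_compat; lra.
Qed.

(* g is only controlled on [0, oo): extend it to the left by its value at 0 *)
Definition gx (g : R -> vec) (k : nat) (s : R) : CC := g (Rmax 0 s) k.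

Lemma gx_continuous n g k s : continuous_on n g -> (k < n)%nat -> ccont (gx g k) s.
Proof.
  intros Hg Hk.
  assert (H : forall e, 0 < e -> exists d, 0 < d /\ forall y, Rabs (y - s) < d -> Cmod (gx g k y - gx g k s)%C < e).
  { intros e He. destruct (Hg k (Rmax 0 s) Hk (Rmax_l _ _) e He) as [d [Hd H]].
    exists d. split; [exact Hd|]. intros y Hy.
    specialize (H (Rmax 0 y) (Rmax_l _ _)).
    replace (gx g k y - gx g k s)%C with (Cadd (g (Rmax 0 y) k) (Cscal (-1) (g (Rmax 0 s) k))).
    - apply H. eapply Rle_lt_trans; [|exact Hy].
      apply Rabs_le. unfold Rmax. apply Rabs_def2 in Hy.
      pose proof (Rle_abs (y - s)). pose proof (Rle_abs (- (y - s))). rewrite Rabs_Ropp in H1.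
      destruct (Rle_dec 0 y); destruct (Rle_dec 0 s); lra.
    - unfold gx. apply C_ext; simpl; ring. }
  split; apply filterlim_locally; intros eps; destruct (H eps (cond_pos eps)) as [d [Hd HH]];
    exists (mkposreal d Hd); intros y Hy; specialize (HH y Hy); (eapply Rle_lt_trans; [|exact HH]).
  - apply (abs_fst_le_Cmod (gx g k y - gx g k s)%C).
  - apply (abs_snd_le_Cmod (gx g k y - gx g k s)%C).
Qed.

Lemma gx_bounded n g : bounded_on n g -> exists M, 0 <= M /\ forall k s, (k < n)%nat -> Cmod (gx g k s) <= M.
Proof.
  intros [M HM]. exists (Rmax 0 M). split; [apply Rmax_l|]. intros k s Hk.
  eapply Rle_trans; [apply (HM (Rmax 0 s) k); [apply Rmax_l | exact Hk] | apply Rmax_r].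
Qed.

Lemma gx_tends n g e : tends_to_0 n g -> 0 < e -> exists T, 0 <= T /\ forall k s, (k < n)%nat -> T <= s -> Cmod (gx g k s) <= e.
Proof.
  intros H He. destruct (H e He) as [T HT]. exists (Rmax 0 T). split; [apply Rmax_l|]. intros k s Hk Hs.
  pose proof (Rmax_l 0 T). pose proof (Rmax_r 0 T).
  left. unfold gx. apply (HT (Rmax 0 s) k); [rewrite Rmax_right by lra; lra | exact Hk].
Qed.

Lemma conv_part (Q h : R -> CC) al K M : 0 < al -> 0 <= K -> 0 <= M ->
  (forall x, 0 < x -> ccont Q x) -> (forall x, 0 < x -> Cmod (Q x) <= K * rho al x) ->
  (forall s, ccont h s) -> (forall s, Cmod (h s) <= M) ->
  (forall t, 0 < t -> is_cimp (fun s => Q (t - s)%R * h s)%C t (Cimpint (fun s => Q (t - s)%R * h s)%C 0 t)) /\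
  Bd (fun t => Cimpint (fun s => Q (t - s)%R * h s)%C 0 t) /\
  ((forall e, 0 < e -> exists T, 0 <= T /\ forall s, T <= s -> Cmod (h s) <= e) ->
   Tz (fun t => Cimpint (fun s => Q (t - s)%R * h s)%C 0 t)).
Proof.
  intros Hal HK HM HQ HQb Hh HhM.
  assert (HL : forall t, 0 < t -> exists l, Cimpint (fun s => Q (t - s)%R * h s)%C 0 t = l /\
     is_cimp (fun s => Q (t - s)%R * h s)%C t l /\ Cmod l <= K * M / al /\
    (forall T0 e, 0 <= T0 < t -> 0 <= e -> (forall s, T0 <= s -> Cmod (h s) <= e) ->
       Cmod l <= K * M / (al * (1 + Rpower (t - T0) al)) + K * e / al)).
  { intros t Ht. destruct (conv_limit Q h al K M t Hal HK HM Ht HQ HQb Hh HhM) as [l [H1 [H2 H3]]].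
    exists l. split; [|auto]. apply (Cimpint_eq (fun s => Q (t - s)%R * h s)%C); auto. }
  split; [|split].
  - intros t Ht. destruct (HL t Ht) as [l [E [H _]]]. rewrite E. exact H.
  - exists (K * M / al). intros t Ht. destruct (HL t Ht) as [l [E [_ [H _]]]]. rewrite E. exact H.
  - intros Hz e He.
    set (e1 := e / 2 * al / (K + 1)).
    assert (He1 : 0 < e1) by (unfold e1; apply Rdiv_lt_0_compat; [|lra]; apply Rmult_lt_0_compat; lra).
    destruct (Hz e1 He1) as [T0 [HT0 HT]].
    assert (HKM : 0 <= K * M) by (apply Rmult_le_pos; assumption).
    destruct (Rpower_large al (e / 2 * al / (K * M + 1)) Hal) as [X [HX HX2]].
    { apply Rdiv_lt_0_compat; [|lra]; apply Rmult_lt_0_compat; lra. }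
    exists (T0 + X + 1). split; [lra|]. intros t Ht.
    destruct (HL t ltac:(lra)) as [l [E [_ [_ H]]]]. rewrite E.
    eapply Rle_trans; [apply (H T0 e1); [lra | lra | exact HT]|].
    specialize (HX2 (t - T0) ltac:(lra)).
    set (P := Rpower (t - T0) al) in *. assert (HP : 0 < P) by apply exp_pos.
    assert (EP : Rpower (t - T0) (- al) = / P) by (unfold P, Rpower; rewrite <- exp_Ropp; f_equal; ring).
    rewrite EP in HX2.
    assert (HPi : 0 < / P) by (apply Rinv_0_lt_compat; exact HP).
    assert (B1 : K * M / (al * (1 + P)) <= e / 2).
    { apply Rle_trans with ((K * M + 1) * / al * / P).
      - unfold Rdiv. replace ((K * M + 1) * / al * / P) with ((K * M + 1) * / (al * P)) by (field; lra).
        assert (0 < / (al * (1 + P))) by (apply Rinv_0_lt_compat; nra).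
        assert (/ (al * (1 + P)) <= / (al * P)) by (apply Rinv_le_contravar; nra).
        apply Rmult_le_compat; lra.
      - assert (Hc : 0 < (K * M + 1) * / al) by (apply Rmult_lt_0_compat; [lra | apply Rinv_0_lt_compat; lra]).
        apply Rle_trans with ((K * M + 1) * / al * (e / 2 * al / (K * M + 1))); [apply Rmult_le_compat_l; lra|].
        right. field. split; lra. }
    assert (B2 : K * e1 / al <= e / 2).
    { apply Rle_trans with ((K + 1) * e1 / al).
      - apply Rmult_le_compat_r; [left; apply Rinv_0_lt_compat; lra|]. apply Rmult_le_compat_r; lra.
      - right. unfold e1. field. split; lra. }
    lra.
Qed.

Local Notation entS al A t := (ent A (fun lam j => MLs al 1 lam j (Rpower t al))).
Local Notation poleS al A t := (ent A (fun lam j => pp al lam j 0 t)).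
Local Notation poleR al A t := (ent A (fun lam j => pp al lam j (1 - al) t)).

(* The part of the solution produced by the unstable poles; the remainder is always bounded. *)
Definition Brk (n : nat) (al : R) (A : Mat) (g : R -> vec) (y0 : vec) (t : R) (i : nat) : CC :=
  (Csum n (fun k => poleS al A t i k * y0 k)
   + Csum n (fun k => CI (fun s => poleR al A (t - s)%R i k * gx g k s) 0 t))%C.

Lemma ent_continuous A (F : R -> CC -> nat -> CC) i k x :
  (forall lam j, ccont (fun s => F s lam j) x) -> ccont (fun s => ent A (F s) i k) x.
Proof.
  intros H. unfold ent. destruct (i <=? k)%nat; [|apply ccont_const].
  apply ccont_cmult; apply H.
Qed.

Lemma RR_continuous al lam j x : 0 < al < 1 -> 0 < x -> ccont (fun t => RR al lam j t) x.
Proof.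
  intros Hal Hx. unfold RR.
  assert (D : forall a, continuous (fun t => Rpower t a) x).
  { intros a. apply (ex_derive_continuous (V:=R_NormedModule)). unfold Rpower. auto_derive. exact Hx. }
  apply ccont_mult; [apply ccont_RtoC, D|].
  apply (ccont_comp (fun t => Rpower t al) (MLs al al lam j)); [apply D | apply MLs_continuous; lra].
Qed.

Lemma continuous_sub_l t s : continuous (fun s => t - s) s.
Proof. apply (continuous_minus (V:=R_NormedModule)); [apply continuous_const | apply continuous_id]. Qed.

Lemma ent_scal A (c : CC) F i k : (c * ent A F i k = ent A (fun l j => c * F l j) i k)%C.
Proof. unfold ent. destruct (i <=? k)%nat; ring. Qed.

Lemma rpow_pos t a : 0 < t -> rpow t a = Rpower t a.
Proof. intros H. unfold rpow. destruct (Rlt_dec 0 t); [reflexivity | contradiction]. Qed.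

Lemma mat_vec_MLmat_jordan al be n A x v i : 0 < al < 1 -> 0 < be -> is_jordan n A -> (i < n)%nat ->
  mat_vec n (MLmat al be n (Mscal x A)) v i = Csum n (fun k => ent A (fun lam j => MLs al be lam j x) i k * v k)%C :> CC.
Proof.
  intros Hal Hbe HJ Hi. unfold mat_vec. apply Csum_ext. intros k Hk. rewrite MLmat_jordan by assumption. reflexivity.
Qed.

(** Removing the pole parts leaves the remainder of S, of order t^(-al), acting on y0, and a
    convolution of g with a kernel dominated by [rho]. Both are bounded; the first tends to 0
    always, the second whenever g does. *)
Lemma sol_decomp n al A g y0 i : 0 < al < 1 -> is_jordan n A ->
  (forall i, (i < n)%nat -> A i i <> RtoC 0 /\ Rabs (Carg (A i i)) <> al * PI / 2) ->
  continuous_on n g -> bounded_on n g -> (i < n)%nat ->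
  Bd (fun t => sol n al A g y0 t i - Brk n al A g y0 t i)%C /\
  (tends_to_0 n g -> Tz (fun t => sol n al A g y0 t i - Brk n al A g y0 t i)%C).
Proof.
  intros Hal HJ HA Hgc Hgb Hi.
  destruct (HA i Hi) as [Hl Hne].
  destruct (gx_bounded n g Hgb) as [M [HM HgM]].
  set (Q := fun k x => (ent A (fun lam j => RR al lam j x) i k - poleR al A x i k)%C).
  assert (HQc : forall k x, 0 < x -> ccont (Q k) x).
  { intros k x Hx. unfold Q.
    apply ccont_ext_loc with (fun x => ent A (fun lam j => RR al lam j x) i k + (- (1)) * poleR al A x i k)%C.
    - apply filter_forall. intros y. ring.
    - apply ccont_plus; [|apply ccont_mult; [apply ccont_const|]].
      + apply (ent_continuous A (fun x lam j => RR al lam j x)). intros. apply RR_continuous; assumption.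
      + apply (ent_continuous A (fun x lam j => pp al lam j (1 - al) x)). intros. apply pp_continuous. }
  assert (HQb : forall k, (k < n)%nat -> exists K, 0 <= K /\ forall x, 0 < x -> Cmod (Q k x) <= K * rho al x).
  { intros k Hk. destruct (RR_asym al (A i i) (k - i) Hal Hl Hne) as [K [HK HB]].
    exists K. split; [exact HK|]. intros x Hx. unfold Q. rewrite ent_minus.
    eapply Rle_trans; [apply (Cmod_ent_le n); assumption | apply HB; exact Hx]. }
  set (L := fun k t => Cimpint (fun s => Q k (t - s)%R * gx g k s)%C 0 t).
  assert (HL : forall k, (k < n)%nat ->
    (forall t, 0 < t -> is_cimp (fun s => Q k (t - s)%R * gx g k s)%C t (L k t)) /\ Bd (L k) /\ (tends_to_0 n g -> Tz (L k))).
  { intros k Hk. destruct (HQb k Hk) as [K [HK HB]].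
    destruct (conv_part (Q k) (gx g k) al K M) as [H1 [H2 H3]]; auto; try lra.
    - intros s. apply (gx_continuous n); assumption.
    - split; [exact H1|]. split; [exact H2|]. intros Hz. apply H3. intros e He.
      destruct (gx_tends n g e Hz He) as [T [HT0 HT]]. exists T. split; [exact HT0|]. intros s Hs. apply HT; assumption. }
  set (Sp := fun k t => ((entS al A t i k - poleS al A t i k) * y0 k)%C).
  assert (HS : forall k, (k < n)%nat -> Bd (Sp k) /\ Tz (Sp k)).
  { intros k Hk. destruct (ML_part al (A i i) (k - i) Hal Hl Hne) as [HB HT].
    assert (Hle : forall t, Cmod (entS al A t i k - poleS al A t i k)%C
                    <= Cmod (MLs al 1 (A i i) (k - i) (Rpower t al) - pp al (A i i) (k - i) 0 t)%C).
    { intros t. rewrite ent_minus.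
      apply (Cmod_ent_le n A (fun lam j => MLs al 1 lam j (Rpower t al) - pp al lam j 0 t)%C); assumption. }
    split.
    - apply (Bd_const_mult (fun t => (entS al A t i k - poleS al A t i k)%C)).
      destruct HB as [C HC]. exists C. intros t Ht. eapply Rle_trans; [apply Hle | apply HC; exact Ht].
    - apply (Tz_const_mult (fun t => (entS al A t i k - poleS al A t i k)%C)).
      intros e He. destruct (HT e He) as [T [HT0 HT1]]. exists T. split; [exact HT0|]. intros t Ht.
      eapply Rle_trans; [apply Hle | apply HT1; exact Ht]. }
  assert (E : forall t, 0 < t -> (Csum n (fun k => Sp k t) + Csum n (fun k => L k t) = sol n al A g y0 t i - Brk n al A g y0 t i)%C).
  { intros t Ht.
    assert (E1 : mat_vec n (MLmat al 1 n (Mscal (rpow t al) A)) y0 i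
        = (Csum n (fun k => Sp k t) + Csum n (fun k => poleS al A t i k * y0 k))%C :> CC).
    { rewrite mat_vec_MLmat_jordan by (assumption || lra). rewrite rpow_pos by exact Ht.
      rewrite Csum_plus. apply Csum_ext. intros k _. unfold Sp. ring. }
    set (P := fun k s => (poleR al A (t - s)%R i k * gx g k s)%C).
    assert (HPc : forall k s, (k < n)%nat -> ccont (P k) s).
    { intros k s Hk. apply ccont_mult; [|apply (gx_continuous n); assumption].
      apply (ent_continuous A (fun s lam j => pp al lam j (1 - al) (t - s))). intros lam j.
      apply (ccont_comp (fun s => t - s) (fun x => pp al lam j (1 - al) x)); [apply continuous_sub_l | apply pp_continuous]. }
    assert (E2 : Cimpint (fun s => Cscal (rpow (t - s) (al - 1))
                     (mat_vec n (MLmat al al n (Mscal (rpow (t - s) al) A)) (g s) i)) 0 t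
        = Csum n (fun k => L k t + CI (P k) 0 t)%C).
    { apply (Cimpint_eq (fun s => Csum n (fun k => Q k (t - s)%R * gx g k s + P k s)%C)); [exact Ht| |].
      - intros s Hs. rewrite mat_vec_MLmat_jordan by (assumption || lra).
        rewrite !rpow_pos by lra. rewrite Cscal_RtoC, Csum_scal. apply Csum_ext. intros k Hk.
        unfold P, Q.
        assert (Eg : gx g k s = g s k) by (unfold gx; rewrite Rmax_right by lra; reflexivity).
        rewrite <- Eg. rewrite Cmult_assoc, ent_scal.
        change (fun l j => (RtoC (Rpower (t - s) (al - 1)) * MLs al al l j (Rpower (t - s) al))%C)
          with (fun l j => RR al l j (t - s)). ring.
      - apply (is_cimp_Csum n (fun k s => (Q k (t - s)%R * gx g k s + P k s)%C)); [exact Ht|]. intros k Hk.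
        apply (is_cimp_plus (fun s => Q k (t - s)%R * gx g k s)%C (P k)).
        + apply (HL k Hk); exact Ht.
        + apply is_cimp_ccont; [exact Ht|]. intros s. apply HPc; exact Hk. }
    unfold sol. rewrite E1, E2. unfold Brk. fold P.
    change (Cadd ?a ?b) with (Cplus a b).
    change (fun k => CI (fun s => (poleR al A (t - s)%R i k * gx g k s)%C) 0 t)
      with (fun k => CI (P k) 0 t).
    rewrite <- (Csum_plus n (fun k => L k t)). ring. }
  split.
  - apply (Bd_ext _ _ E). apply Bd_plus; apply Bd_Csum; intros k Hk; [apply HS | apply HL]; exact Hk.
  - intros Hz. apply (Tz_ext _ _ E). apply Tz_plus; apply Tz_Csum; intros k Hk; [apply HS | apply HL]; assumption.
Qed.

(** * Unstable blocks: cancelling the growth, and uniqueness of the bounded solution *)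

Lemma Csum_window n i m (f : nat -> CC) : (i + m < n)%nat ->
  (forall l, (l < n)%nat -> (l < i \/ i + m < l)%nat -> f l = 0) ->
  Csum n f = Csum (S m) (fun j => f (i + j)%nat) :> CC.
Proof.
  intros Hm H. replace n with (i + (S m + (n - i - S m)))%nat by lia.
  rewrite Csum_app, Csum_0, Cplus_0_l by (intros; apply H; lia).
  rewrite (Csum_app (S m)).
  rewrite (Csum_0 (n - i - S m)); [apply (Cplus_0_r (Csum (S m) (fun j => f (i + j)%nat)))|].
  intros k Hk. apply H; lia.
Qed.

Definition unstable_diag (n : nat) (al : R) (A : Mat) : Prop :=
  forall i, (i < n)%nat -> A i i <> RtoC 0 /\ Rabs (Carg (A i i)) < al * PI / 2.

Lemma pp_unstable al lam j be t : Rabs (Carg lam) < al * PI / 2 ->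
  pp al lam j be t = (RtoC (/ al) * aa al (wl al lam) j be t)%C.
Proof. intros H. unfold pp. destruct (Rlt_dec _ _); [reflexivity | contradiction]. Qed.

(** Up to the factor 1/al both pole parts are functions of the matrix A, and the Leibniz rule
    [aa_product] says that these multiply. The factor al compensates for the two factors 1/al on the
    right against one on the left. *)
Lemma ent_product n al A i k t s : 0 < al -> is_jordan n A -> unstable_diag n al A ->
  (i < n)%nat -> (k < n)%nat ->
  poleR al A (t + s)%R i k
  = (RtoC al * Csum n (fun l => poleS al A t i l * poleR al A s l k))%C.
Proof.
  intros Hal HJ HU Hi Hk.
  assert (Hal0 : RtoC al <> 0) by (apply RtoC_neq; lra).
  destruct (Nat.leb_spec i k) as [Hik|Hik].
  - set (m := (k - i)%nat).
    rewrite (Csum_window n i m); [|unfold m; lia|].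
    2:{ intros l Hl [H|H]; unfold ent.
        - destruct (Nat.leb_spec i l); [lia | ring].
        - destruct (Nat.leb_spec l k); [unfold m in H; lia | ring]. }
    pose proof (chain_cases n A i m HJ ltac:(unfold m; lia)) as HC.
    assert (E0 : poleR al A (t + s)%R i k = (chain A i m * (RtoC (/ al) * aa al (wl al (A i i)) m (1 - al) (t + s)))%C).
    { unfold ent. destruct (Nat.leb_spec i k); [|lia]. fold m. rewrite pp_unstable by (apply HU; exact Hi). reflexivity. }
    rewrite E0. replace (1 - al) with (0 + (1 - al)) at 1 by ring.
    rewrite aa_product by exact Hal. unfold aasum.
    rewrite !Csum_scal. apply Csum_ext. intros j Hj.
    unfold ent. destruct (Nat.leb_spec i (i + j)) as [_|H]; [|lia]. destruct (Nat.leb_spec (i + j) k) as [_|H]; [|unfold m in Hj; lia].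
    replace (i + j - i)%nat with j by lia. replace (k - (i + j))%nat with (m - j)%nat by (unfold m; lia).
    assert (Ec : chain A i m = (chain A i j * chain A (i + j) (m - j))%C).
    { rewrite <- chain_plus. f_equal. lia. }
    rewrite Ec.
    destruct (chain_cases n A i j HJ ltac:(unfold m in Hj; lia)) as [Z|[Z1 Z2]]; [rewrite Z; ring|].
    rewrite Z2, !pp_unstable by (apply HU; exact Hi). rewrite RtoC_inv by lra. field. exact Hal0.
  - rewrite Csum_0.
    + unfold ent. destruct (Nat.leb_spec i k); [lia|]. ring.
    + intros l Hl. unfold ent. destruct (Nat.leb_spec i l); [|ring]. destruct (Nat.leb_spec l k); [lia|]. ring.
Qed.

Lemma exp_tail_bound (f : R -> CC) K c a b : 0 < c -> 0 <= K -> a <= b ->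
  (forall s, ccont f s) -> (forall s, a <= s <= b -> Cmod (f s) <= K * exp (- c * (s - a))) ->
  Cmod (CI f a b) <= K / c.
Proof.
  intros Hc HK Hab Hf HB.
  assert (HR : is_RInt (fun s => K * exp (- c * (s - a))) a b (- (K / c) * exp (- c * (b - a)) - - (K / c) * exp (- c * (a - a)))).
  { apply (is_RInt_derive (V:=R_CompleteNormedModule) (fun s => - (K / c) * exp (- c * (s - a)))).
    - intros s _. auto_derive; [exact I|]. unfold Rminus. field. lra.
    - intros s _. apply (ex_derive_continuous (V:=R_NormedModule)). auto_derive; exact I. }
  eapply Rle_trans; [apply (CI_bound f (fun s => K * exp (- c * (s - a)))); auto|].
  - eexists; exact HR.
  - intros s Hs. apply HB; lra.
  - rewrite (is_RInt_unique _ _ _ _ HR).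
    replace (- c * (a - a)) with 0 by ring. rewrite exp_0.
    assert (0 <= K / c) by (apply Rmult_le_pos; [exact HK | left; apply Rinv_0_lt_compat; lra]).
    pose proof (exp_pos (- c * (b - a))). nra.
Qed.

Lemma exp_int_limit (f : R -> CC) K c : 0 < c -> 0 <= K -> (forall s, ccont f s) ->
  (forall s, 0 <= s -> Cmod (f s) <= K * exp (- c * s)) ->
  exists L, Tz (fun T => CI f 0 T - L)%C.
Proof.
  intros Hc HK Hf HB.
  assert (HT : forall a b, 0 <= a <= b -> Cmod (CI f 0 b - CI f 0 a)%C <= K * exp (- c * a) / c).
  { intros a b Hab. rewrite <- (CI_Chasles f 0 a b) by auto.
    replace (CI f 0 a + CI f a b - CI f 0 a)%C with (CI f a b) by ring.
    apply (exp_tail_bound f (K * exp (- c * a)) c a b); auto; try lra.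
    - apply Rmult_le_pos; [exact HK | left; apply exp_pos].
    - intros s Hs. eapply Rle_trans; [apply HB; lra|]. right. rewrite Rmult_assoc, <- exp_plus. do 2 f_equal. ring. }
  assert (HS : forall e, 0 < e -> exists X, 0 < X /\ forall a b, X <= a -> a <= b -> Cmod (CI f 0 b - CI f 0 a)%C < e).
  { intros e He. destruct (exp_neg_lt_eps c (e * c / (K + 1))) as [X [HX HX2]];
      [exact Hc | apply Rdiv_lt_0_compat; nra|].
    exists X. split; [exact HX|]. intros a b Ha Hab.
    eapply Rle_lt_trans; [apply HT; lra|]. specialize (HX2 a Ha).
    pose proof (exp_pos (- c * a)).
    apply Rmult_lt_reg_r with c; [exact Hc|]. unfold Rdiv at 1. rewrite Rmult_assoc, Rinv_l, Rmult_1_r by lra.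
    apply Rle_lt_trans with ((K + 1) * exp (- c * a)); [nra|].
    apply Rlt_le_trans with ((K + 1) * (e * c / (K + 1))); [apply Rmult_lt_compat_l; lra | right; field; lra]. }
  destruct (C_seq_cauchy (fun n => CI f 0 (INR n))) as [L HL].
  { intros e He. destruct (HS e He) as [X [HX HX2]]. destruct (nfloor_ex X) as [N HN]; [lra|].
    exists (S N). intros n m Hn Hm. apply le_INR in Hn, Hm. rewrite S_INR in Hn. apply HX2; lra. }
  exists L. intros e He. destruct (HS (e / 2)) as [X [HX HX2]]; [lra|].
  exists X. split; [exact HX|]. intros T HTX.
  destruct (HL (e / 2)) as [N1 HN1]; [lra|]. destruct (nfloor_ex T) as [N2 HN2]; [lra|].
  set (n := max N1 (S N2)). specialize (HN1 n ltac:(unfold n; lia)).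
  assert (Hn : T <= INR n).
  { assert (INR (S N2) <= INR n) by (apply le_INR; unfold n; lia). rewrite S_INR in H. lra. }
  specialize (HX2 T (INR n) HTX Hn).
  replace (CI f 0 T - L)%C with (- (CI f 0 (INR n) - CI f 0 T) + (CI f 0 (INR n) - L))%C by ring.
  eapply Rle_trans; [apply Cmod_triangle|]. rewrite Cmod_opp. lra.
Qed.

Lemma growth_rate_pos al (lam : CC) : 0 < al < 1 -> Rabs (Carg lam) < al * PI / 2 -> 0 < fst (Cexp (wl al lam)).
Proof.
  intros Hal H. unfold Cexp, wl; simpl. apply Rmult_lt_0_compat; [apply exp_pos|].
  apply Rabs_def2 in H. apply cos_gt_0.
  - apply Rmult_lt_reg_l with al; [lra|]. replace (al * (Carg lam / al)) with (Carg lam) by (field; lra). lra.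
  - apply Rmult_lt_reg_l with al; [lra|]. replace (al * (Carg lam / al)) with (Carg lam) by (field; lra). lra.
Qed.

Lemma ent_pp_decay n al A i : 0 < al < 1 -> is_jordan n A -> unstable_diag n al A -> (i < n)%nat ->
  exists K c, 0 <= K /\ 0 < c /\ forall k s, (k < n)%nat -> 0 <= s ->
    Cmod (poleR al A (- s)%R i k) <= K * exp (- c * s).
Proof.
  intros Hal HJ HU Hi. destruct (HU i Hi) as [Hl Hu].
  pose proof (growth_rate_pos al (A i i) Hal Hu) as Hg.
  set (c := fst (Cexp (wl al (A i i))) / 2).
  destruct (finite_bound n (fun k K => forall s, 0 <= s ->
     Cmod (poleR al A (- s)%R i k) <= K * exp (- c * s))) as [K [HK HB]].
  - intros k C C' HCC H s Hs. eapply Rle_trans; [apply H; exact Hs|].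
    apply Rmult_le_compat_r; [left; apply exp_pos | exact HCC].
  - intros k Hk. destruct (aa_decay al (wl al (A i i)) (k - i) (1 - al) c) as [K [HK HB]]; [lra | unfold c; lra|].
    exists (/ al * K). intros s Hs. eapply Rle_trans; [apply (Cmod_ent_le n); assumption|].
    assert (0 < / al) by (apply Rinv_0_lt_compat; lra).
    cbv beta. rewrite pp_unstable, Cmod_mult, Cmod_R, Rabs_right, Rmult_assoc by (exact Hu || lra).
    apply Rmult_le_compat_l; [lra | apply HB; exact Hs].
  - exists K, c. split; [exact HK|]. split; [unfold c; lra|]. intros k s Hk Hs. apply HB; assumption.
Qed.

(** The integrand of the pole part of the convolution. It is meaningful for s > t as well, and at t
    = 0 it is the integrand of the initial value that cancels the growth. *)
Definition forced (n : nat) (al : R) (A : Mat) (g : R -> vec) (t : R) (i : nat) (s : R) : CC :=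
  Csum n (fun k => poleR al A (t - s)%R i k * gx g k s)%C.

Lemma forced_continuous n al A g t i s : continuous_on n g -> ccont (forced n al A g t i) s.
Proof.
  intros Hg. unfold forced.
  assert (H : forall m, (m <= n)%nat ->
    ccont (fun s => Csum m (fun k => poleR al A (t - s)%R i k * gx g k s)%C) s).
  { induction m as [|m IH]; intros Hm; [apply ccont_const|].
    apply (ccont_plus (fun s => Csum m (fun k => poleR al A (t - s)%R i k * gx g k s)%C)); [apply IH; lia|].
    apply ccont_mult; [|apply (gx_continuous n); [exact Hg | lia]].
    apply (ent_continuous A (fun s lam j => pp al lam j (1 - al) (t - s))). intros lam j.
    apply (ccont_comp (fun s => t - s) (fun x => pp al lam j (1 - al) x)); [apply continuous_sub_l | apply pp_continuous]. }
  apply H; lia.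
Qed.

Lemma Cmod_Csum_le n (f : nat -> CC) B : (forall k, (k < n)%nat -> Cmod (f k) <= B) -> Cmod (Csum n f) <= INR n * B.
Proof.
  induction n as [|n IH]; intros H.
  - change (Cmod 0 <= 0 * B). rewrite Cmod_0. lra.
  - rewrite Csum_S, S_INR. eapply Rle_trans; [apply Cmod_triangle|].
    specialize (IH ltac:(intros; apply H; lia)). specialize (H n ltac:(lia)). lra.
Qed.

Lemma forced_bound n al A g i K c M t s :
  (forall k s, (k < n)%nat -> 0 <= s -> Cmod (poleR al A (- s)%R i k) <= K * exp (- c * s)) ->
  0 <= K -> t <= s -> (forall k, (k < n)%nat -> Cmod (gx g k s) <= M) ->
  Cmod (forced n al A g t i s) <= INR n * (K * M) * exp (- c * (s - t)).
Proof.
  intros HB HK Hts HM. unfold forced. rewrite Rmult_assoc. apply Cmod_Csum_le. intros k Hk. rewrite Cmod_mult.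
  replace (t - s) with (- (s - t)) by ring.
  replace (K * M * exp (- c * (s - t))) with (K * exp (- c * (s - t)) * M) by ring.
  apply Rmult_le_compat; try apply Cmod_ge_0; [apply HB; [exact Hk | lra] | apply HM; exact Hk].
Qed.

(* The initial value y0 = - al * int_0^oo (residue kernel)(-s) g(s) ds cancels the exponential growth. *)
Lemma unstable_initial_value n al A g : 0 < al < 1 -> is_jordan n A -> unstable_diag n al A ->
  continuous_on n g -> bounded_on n g ->
  exists y0 : vec, forall i, (i < n)%nat ->
    Bd (fun t => Brk n al A g y0 t i) /\ (tends_to_0 n g -> Tz (fun t => Brk n al A g y0 t i)).
Proof.
  intros Hal HJ HU Hgc Hgb.
  destruct (gx_bounded n g Hgb) as [M [HM HgM]].
  assert (HL : forall k, (k < n)%nat -> exists L, Tz (fun T => CI (forced n al A g 0 k) 0 T - L)%C).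
  { intros k Hk. destruct (ent_pp_decay n al A k Hal HJ HU Hk) as [K [c [HK [Hc HB]]]].
    apply (exp_int_limit _ (INR n * (K * M)) c Hc).
    - apply Rmult_le_pos; [apply pos_INR | apply Rmult_le_pos; assumption].
    - intros s. apply forced_continuous; exact Hgc.
    - intros s Hs. replace (- c * s) with (- c * (s - 0)) by ring.
      apply forced_bound; auto. }
  set (L := fun k => epsilon (inhabits (RtoC 0)) (fun L => Tz (fun T => CI (forced n al A g 0 k) 0 T - L)%C)).
  assert (HLs : forall k, (k < n)%nat -> Tz (fun T => CI (forced n al A g 0 k) 0 T - L k)%C).
  { intros k Hk. unfold L. apply epsilon_spec. apply HL; exact Hk. }
  exists (fun k => RtoC (- al) * L k)%C. intros i Hi.
  set (y0 := (fun k => RtoC (- al) * L k)%C : vec).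
  assert (Hal0 : RtoC al <> 0) by (apply RtoC_neq; lra).
  (* By [ent_product] at the times t and -s the factor depending on t leaves the integral over s;
     the two finite sums are exchanged. *)
  assert (HF : forall t s, forced n al A g t i s =
     Csum n (fun l => (RtoC al * poleS al A t i l) * forced n al A g 0 l s)%C).
  { intros t s. unfold forced.
    transitivity (Csum n (fun k => Csum n (fun l => (RtoC al * poleS al A t i l)
        * (poleR al A (0 - s)%R l k * gx g k s))%C)).
    - apply Csum_ext. intros k Hk.
      replace (t - s) with (t + (0 - s)) by ring.
      rewrite (ent_product n al A i k t (0 - s)) by (assumption || lra).
      rewrite Csum_scal. rewrite Cmult_comm, Csum_scal. apply Csum_ext. intros l _. ring.
    - assert (Sw : forall (F : nat -> nat -> CC) a b, Csum a (fun k => Csum b (fun l => F k l)) = Csum b (fun l => Csum a (fun k => F k l)) :> CC).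
      { intros F a b. induction a as [|a IHa].
        - symmetry. apply Csum_0. intros; reflexivity.
        - rewrite Csum_S, IHa, Csum_plus. reflexivity. }
      rewrite Sw. apply Csum_ext. intros l _. rewrite Csum_scal. reflexivity. }
  assert (HE : forall t, 0 < t -> Brk n al A g y0 t i
     = Csum n (fun l => (RtoC al * poleS al A t i l) * (CI (forced n al A g 0 l) 0 t - L l))%C).
  { intros t Ht. unfold Brk.
    assert (Cf : forall k x, (k < n)%nat -> ccont (fun s => poleR al A (t - s)%R i k * gx g k s)%C x).
    { intros k x Hk. apply ccont_mult; [|apply (gx_continuous n); assumption].
      apply (ent_continuous A (fun s lam j => pp al lam j (1 - al) (t - s))). intros lam j.
      apply (ccont_comp (fun s => t - s) (fun x => pp al lam j (1 - al) x)); [apply continuous_sub_l | apply pp_continuous]. }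
    rewrite <- (proj1 (CI_Csum n (fun k s => poleR al A (t - s)%R i k * gx g k s)%C 0 t Cf)).
    change (fun x => Csum n (fun k => (poleR al A (t - x)%R i k * gx g k x)%C))
      with (forced n al A g t i).
    rewrite (CI_ext (forced n al A g t i) (fun s => Csum n (fun l => (RtoC al * poleS al A t i l) * forced n al A g 0 l s)%C)) by (intros; apply HF).
    rewrite (proj1 (CI_Csum n (fun l s => (RtoC al * poleS al A t i l) * forced n al A g 0 l s)%C 0 t
       (fun l x _ => ccont_mult _ _ _ (ccont_const _ x) (forced_continuous n al A g 0 l x Hgc)))).
    rewrite Csum_plus. apply Csum_ext. intros l Hl.
    rewrite CI_scal by (intros; apply forced_continuous; exact Hgc).
    unfold y0. rewrite RtoC_opp. ring. }
  destruct (ent_pp_decay n al A i Hal HJ HU Hi) as [K [c [HK [Hc HB]]]].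
  (* M' has to bound g on [t, oo) only, so the same estimate yields boundedness and, for decaying g,
     decay. *)
  assert (Key : forall t M', 0 < t -> 0 <= M' -> (forall k s, (k < n)%nat -> t <= s -> Cmod (gx g k s) <= M') ->
     Cmod (Brk n al A g y0 t i) <= INR n * (K * M') / c).
  { intros t M' Ht HM' HgM'. apply le_epsilon. intros e He.
    assert (HZ : Tz (fun T => Csum n (fun l => (CI (forced n al A g 0 l) 0 T - L l) * (RtoC al * poleS al A t i l))%C)).
    { apply (Tz_Csum n (fun l T => (CI (forced n al A g 0 l) 0 T - L l) * (RtoC al * poleS al A t i l))%C).
      intros l Hl. apply (Tz_const_mult (fun T => CI (forced n al A g 0 l) 0 T - L l)%C). apply HLs; exact Hl. }
    destruct (HZ e He) as [T0 [HT0 HT]].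
    (* The growing part at time t is split as minus the integral of [forced] over [t, T], which
       decays exponentially in s - t, plus the truncation error of the infinite integrals at T. For
       fixed t the latter is at most e once T >= T0. *)
    set (T := Rmax t T0). assert (HTt : t <= T) by apply Rmax_l. specialize (HT T (Rmax_r _ _)).
    assert (ED : (Brk n al A g y0 t i = - CI (forced n al A g t i) t T +
      Csum n (fun l => (CI (forced n al A g 0 l) 0 T - L l) * (RtoC al * poleS al A t i l))%C)%C).
    { rewrite HE by exact Ht.
      rewrite (CI_ext (forced n al A g t i) (fun s => Csum n (fun l => (RtoC al * poleS al A t i l) * forced n al A g 0 l s)%C)) by (intros; apply HF).
      rewrite (proj1 (CI_Csum n (fun l s => (RtoC al * poleS al A t i l) * forced n al A g 0 l s)%C t T
         (fun l x _ => ccont_mult _ _ _ (ccont_const _ x) (forced_continuous n al A g 0 l x Hgc)))).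
      replace (- Csum n (fun k => CI (fun s => (RtoC al * poleS al A t i k) * forced n al A g 0 k s) t T))%C
        with (- (1) * Csum n (fun k => CI (fun s => (RtoC al * poleS al A t i k) * forced n al A g 0 k s) t T))%C by ring.
      rewrite Csum_scal, Csum_plus. apply Csum_ext. intros l Hl.
      rewrite CI_scal by (intros; apply forced_continuous; exact Hgc).
      rewrite <- (CI_Chasles (forced n al A g 0 l) 0 t T) by (intros; apply forced_continuous; exact Hgc).
      ring. }
    rewrite ED. eapply Rle_trans; [apply Cmod_triangle|]. rewrite Cmod_opp.
    apply Rplus_le_compat; [|exact HT].
    apply exp_tail_bound with (a := t); auto.
    - apply Rmult_le_pos; [apply pos_INR | apply Rmult_le_pos; assumption].
    - intros s. apply forced_continuous; exact Hgc.
    - intros s Hs. apply forced_bound; auto; try lra. intros k Hk. apply HgM'; [exact Hk | lra]. }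
  split.
  - exists (INR n * (K * M) / c). intros t Ht. apply Key; auto.
  - intros Hz e He.
    pose proof (pos_INR n) as Hn.
    set (e1 := e * c / (INR n * K + 1)).
    assert (HnK : 0 <= INR n * K) by (apply Rmult_le_pos; assumption).
    assert (He1 : 0 < e1) by (unfold e1; apply Rdiv_lt_0_compat; nra).
    destruct (gx_tends n g e1 Hz He1) as [T [HT0 HT]].
    exists (T + 1). split; [lra|]. intros t Ht.
    eapply Rle_trans; [apply (Key t e1); [lra | lra | intros; apply HT; [assumption | lra]]|].
    apply Rle_trans with ((INR n * K + 1) * e1 / c).
    + apply Rmult_le_compat_r; [left; apply Rinv_0_lt_compat; exact Hc|]. nra.
    + right. unfold e1. field. split; lra.
Qed.

(** The matrix is upper triangular, so one works from the last index downwards. Once all later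
    components vanish, row i is the scalar Mittag-Leffler function times z i, and that function
    grows exponentially. *)
Lemma unstable_unique n al A (z : nat -> CC) : 0 < al < 1 -> is_jordan n A -> unstable_diag n al A ->
  (forall i, (i < n)%nat -> Bd (fun t => Csum n (fun k => entS al A t i k * z k)%C)) ->
  forall k, (k < n)%nat -> z k = 0.
Proof.
  intros Hal HJ HU HB.
  assert (Hm : forall m, (m <= n)%nat -> forall k, (n - m <= k < n)%nat -> z k = 0).
  { induction m as [|m IH]; intros Hm k Hk; [lia|].
    destruct (Nat.eq_dec k (n - S m)) as [->|E]; [|apply IH; lia].
    set (i := (n - S m)%nat) in *. assert (Hi : (i < n)%nat) by (unfold i; lia).
    destruct (HU i Hi) as [Hl Hu].
    assert (HB1 : Bd (fun t => (MLs al 1 (A i i) 0 (Rpower t al) * z i)%C)).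
    { eapply Bd_ext; [|apply (HB i Hi)]. intros t Ht. cbv beta.
      rewrite (Csum_single n (fun k => entS al A t i k * z k)%C i Hi).
      - unfold ent. rewrite Nat.leb_refl, Nat.sub_diag. simpl chain. ring.
      - intros l Hl' Hne. unfold ent. destruct (Nat.leb_spec i l) as [H|H]; [|ring].
        rewrite (IH ltac:(lia) l ltac:(unfold i in *; lia)). ring. }
    destruct (excluded_middle_informative (z i = 0)) as [E|E]; [exact E|]. exfalso.
    assert (HB2 : Bd (fun t => pp al (A i i) 0 0 t)).
    { destruct (ML_part al (A i i) 0 Hal Hl ltac:(lra)) as [HP _].
      apply (Bd_ext (fun t => (MLs al 1 (A i i) 0 (Rpower t al) * z i) * / z i
                 + (MLs al 1 (A i i) 0 (Rpower t al) - pp al (A i i) 0 0 t) * (- (1)))%C).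
      - intros t Ht. field. exact E.
      - apply Bd_plus; [apply (Bd_const_mult (fun t => (MLs al 1 (A i i) 0 (Rpower t al) * z i)%C)); exact HB1|].
        apply (Bd_const_mult (fun t => (MLs al 1 (A i i) 0 (Rpower t al) - pp al (A i i) 0 0 t)%C)); exact HP. }
    destruct HB2 as [C HC].
    pose proof (growth_rate_pos al (A i i) Hal Hu) as Hg.
    set (mu := fst (Cexp (wl al (A i i)))) in *.
    assert (Ha : 0 < / al) by (apply Rinv_0_lt_compat; lra).
    (* Then e^(t mu) >= 1 + t mu = 2 + al |C|, so the pole part e^(t mu) / al exceeds its supposed
       bound C. *)
    set (t := (Rabs C * al + 1) / mu).
    assert (Ht : 0 < t) by (apply Rdiv_lt_0_compat; [pose proof (Rabs_pos C); nra | exact Hg]).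
    specialize (HC t Ht). rewrite pp_unstable, Cmod_mult, Cmod_R, Rabs_right in HC by (exact Hu || lra).
    cbn [aa] in HC. rewrite Cmod_Cexp in HC.
    assert (EX : fst (RtoC t * Cexp (wl al (A i i)) + RtoC 0 * wl al (A i i))%C = t * mu).
    { unfold mu. simpl. ring. }
    rewrite EX in HC. pose proof (exp_ineq1_le (t * mu)) as HX.
    assert (Etm : t * mu = Rabs C * al + 1) by (unfold t; field; lra).
    rewrite Etm in *. pose proof (Rle_abs C).
    assert (/ al * (1 + (Rabs C * al + 1)) <= / al * exp (Rabs C * al + 1)) by (apply Rmult_le_compat_l; lra).
    replace (/ al * (1 + (Rabs C * al + 1))) with (Rabs C + 2 * / al) in H0 by (field; lra). lra. }
  intros k Hk. apply (Hm n); lia.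
Qed.

(** * Solutions on the stable and on the unstable block, and their combination *)

Lemma bounded_on_of_Bd n y : (forall i, (i < n)%nat -> Bd (fun t => y t i)) -> bounded_on n y.
Proof.
  intros H.
  destruct (finite_bound n (fun i C => forall t, 0 <= t -> Cmod (y t i) <= C)) as [C [_ HC]].
  - intros k C C' HCC HB t Ht. eapply Rle_trans; [apply HB; exact Ht | exact HCC].
  (* The single time t = 0 is not covered by [Bd]; its value enters the maximum, whatever it is. *)
  - intros i Hi. destruct (H i Hi) as [C HC]. exists (Rmax C (Cmod (y 0 i))). intros t [Ht|<-].
    + eapply Rle_trans; [apply HC; exact Ht | apply Rmax_l].
    + apply Rmax_r.
  - exists C. intros t i Ht Hi. apply (HC i Hi t Ht).
Qed.

Lemma Bd_of_bounded_on n y i : bounded_on n y -> (i < n)%nat -> Bd (fun t => y t i).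
Proof. intros [M HM] Hi. exists M. intros t Ht. apply (HM t i); [lra | exact Hi]. Qed.

Lemma tends_to_0_of_Tz n y : (forall i, (i < n)%nat -> Tz (fun t => y t i)) -> tends_to_0 n y.
Proof.
  intros H eps Heps.
  destruct (finite_bound n (fun i T => forall t, T <= t -> Cmod (y t i) < eps)) as [T [_ HT]].
  - intros k C C' HCC HB t Ht. apply HB; lra.
  - intros i Hi. destruct (H i Hi (eps / 2)) as [T [_ HT]]; [lra|]. exists T. intros t Ht.
    specialize (HT t Ht). cbv beta in HT. lra.
  - exists T. intros t i Ht Hi. apply (HT i Hi t Ht).
Qed.

Lemma stable_solutions n al A g y0 : 0 < al < 1 -> is_jordan n A ->
  (forall lam, eigenvalue n A lam -> Lambda_s al lam) ->
  continuous_on n g -> bounded_on n g ->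
  bounded_on n (sol n al A g y0) /\ (tends_to_0 n g -> tends_to_0 n (sol n al A g y0)).
Proof.
  intros Hal HJ HE Hgc Hgb.
  assert (HA : forall i, (i < n)%nat -> A i i <> RtoC 0 /\ Rabs (Carg (A i i)) > al * PI / 2).
  { intros i Hi. apply HE. apply jordan_diag_eigenvalue; assumption. }
  assert (HA' : forall i, (i < n)%nat -> A i i <> RtoC 0 /\ Rabs (Carg (A i i)) <> al * PI / 2).
  { intros i Hi. destruct (HA i Hi). split; [assumption | lra]. }
  assert (HB0 : forall t i, (i < n)%nat -> Brk n al A g y0 t i = 0).
  { intros t i Hi. destruct (HA i Hi) as [_ Hs].
    assert (Z : forall k be s, ent A (fun lam j => pp al lam j be s) i k = 0).
    { intros k be s. unfold ent, pp. destruct (Rlt_dec _ _); [lra|]. destruct (i <=? k)%nat; ring. }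
    unfold Brk. rewrite !Csum_0; [ring| |].
    - intros k Hk. rewrite (CI_ext _ (fun _ => RtoC 0)) by (intros; rewrite Z; ring).
      unfold CI; simpl. rewrite RInt_const. apply C_ext; simpl; unfold scal; simpl; unfold mult; simpl; ring.
    - intros k Hk. rewrite Z. ring. }
  split; [apply bounded_on_of_Bd | intros Hz; apply tends_to_0_of_Tz]; intros i Hi;
    destruct (sol_decomp n al A g y0 i Hal HJ HA' Hgc Hgb Hi) as [HB HT].
  - eapply Bd_ext; [|exact HB]. intros t Ht. cbv beta. rewrite HB0 by exact Hi. ring.
  - eapply Tz_ext; [|exact (HT Hz)]. intros t Ht. cbv beta. rewrite HB0 by exact Hi. ring.
Qed.

(** The convolution terms are literally the same and cancel without any convergence argument. *)
Lemma sol_diff n al A g y0 z0 t i : 0 < al < 1 -> is_jordan n A -> (i < n)%nat -> 0 < t ->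
  (sol n al A g y0 t i - sol n al A g z0 t i
   = Csum n (fun k => entS al A t i k * (y0 k - z0 k)))%C.
Proof.
  intros Hal HJ Hi Ht. unfold sol. change (Cadd ?a ?b) with (Cplus a b).
  rewrite !(mat_vec_MLmat_jordan al 1) by (assumption || lra). rewrite rpow_pos by exact Ht.
  set (J := Cimpint _ 0 t).
  transitivity (Csum n (fun k => entS al A t i k * y0 k)
     + (- (1)) * Csum n (fun k => entS al A t i k * z0 k))%C; [ring|].
  rewrite Csum_scal, Csum_plus. apply Csum_ext. intros k _. ring.
Qed.

Lemma unstable_solutions n al A g : 0 < al < 1 -> is_jordan n A ->
  (forall lam, eigenvalue n A lam -> Lambda_u al lam) ->
  continuous_on n g -> bounded_on n g ->
  exists y0, bounded_on n (sol n al A g y0) /\ (tends_to_0 n g -> tends_to_0 n (sol n al A g y0)) /\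
    forall z0, bounded_on n (sol n al A g z0) ->
      forall t i, sol n al A g z0 t i = sol n al A g y0 t i.
Proof.
  intros Hal HJ HE Hgc Hgb.
  assert (HU : unstable_diag n al A).
  { intros i Hi. apply HE. apply jordan_diag_eigenvalue; assumption. }
  assert (HA' : forall i, (i < n)%nat -> A i i <> RtoC 0 /\ Rabs (Carg (A i i)) <> al * PI / 2).
  { intros i Hi. destruct (HU i Hi). split; [assumption | lra]. }
  destruct (unstable_initial_value n al A g Hal HJ HU Hgc Hgb) as [y0 Hy].
  assert (HB : bounded_on n (sol n al A g y0)).
  { apply bounded_on_of_Bd. intros i Hi.
    destruct (sol_decomp n al A g y0 i Hal HJ HA' Hgc Hgb Hi) as [HB _].
    eapply Bd_ext; [|apply Bd_plus; [exact HB | apply (Hy i Hi)]]. intros t Ht. cbv beta. ring. }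
  exists y0. split; [exact HB|]. split.
  - intros Hz. apply tends_to_0_of_Tz. intros i Hi.
    destruct (sol_decomp n al A g y0 i Hal HJ HA' Hgc Hgb Hi) as [_ HT].
    eapply Tz_ext; [|apply Tz_plus; [exact (HT Hz) | apply (Hy i Hi); exact Hz]]. intros t Ht. cbv beta. ring.
  - intros z0 Hz0 t i. apply sol_ext. intros k Hk.
    assert (Z : (z0 k - y0 k)%C = 0).
    { apply (unstable_unique n al A (fun k => z0 k - y0 k)%C Hal HJ HU); [|exact Hk].
      intros l Hl. eapply Bd_ext; [intros s Hs; apply (sol_diff n al A g z0 y0 s l Hal HJ Hl Hs)|].
      apply (Bd_ext (fun s => sol n al A g z0 s l + sol n al A g y0 s l * (- (1)))%C); [intros; ring|].
      apply Bd_plus; [apply (Bd_of_bounded_on n _ l Hz0 Hl)|].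
      apply (Bd_const_mult (fun s => sol n al A g y0 s l)). apply (Bd_of_bounded_on n _ l HB Hl). }
    replace (z0 k) with ((z0 k - y0 k) + y0 k)%C by ring. rewrite Z. apply Cplus_0_l.
Qed.

Theorem mainTheorem8 (al : R) (ds du : nat) (B : Mat) (g : R -> vec) :
  0 < al < 1 ->
  (* B = diag(B^s, B^u) in Jordan normal form *)
  is_jordan ds B ->
  is_jordan du (blk_u ds B) ->
  (forall i j, (i < ds)%nat -> (ds <= j < ds + du)%nat -> B i j = C0 /\ B j i = C0) ->
  (forall lam, eigenvalue ds B lam -> Lambda_s al lam) ->
  (forall lam, eigenvalue du (blk_u ds B) lam -> Lambda_u al lam) ->
  (forall lam, eigenvalue (ds + du) B lam -> Lambda_u al lam \/ Lambda_s al lam) ->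
  (* g continuous with bounded components on [0, oo) *)
  continuous_on (ds + du) g ->
  bounded_on (ds + du) g ->
  exists y0u : vec,
    (* (1) phibar := sol du al B^u g^u y0u is the unique bounded solution *)
    bounded_on du (sol du al (blk_u ds B) (vec_u ds g) y0u) /\
    (forall z0 : vec, bounded_on du (sol du al (blk_u ds B) (vec_u ds g) z0) ->
       forall t i, 0 <= t -> (i < du)%nat ->
         sol du al (blk_u ds B) (vec_u ds g) z0 t i =
         sol du al (blk_u ds B) (vec_u ds g) y0u t i) /\
    (* (2) stable part bounded for every initial value *)
    (forall y0s : vec, bounded_on ds (sol ds al B g y0s)) /\
    (* (3) bounded solutions of the full system = {(phi(.;0,y0s), phibar)} *)
    (forall y0 : vec, bounded_on (ds + du) (sol (ds + du) al B g y0) ->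
       exists y0s : vec, forall t i, 0 <= t -> (i < ds + du)%nat ->
         sol (ds + du) al B g y0 t i =
         (if Nat.ltb i ds then sol ds al B g y0s t i
          else sol du al (blk_u ds B) (vec_u ds g) y0u t (i - ds)%nat)) /\
    (forall y0s : vec, exists y0 : vec,
       bounded_on (ds + du) (sol (ds + du) al B g y0) /\
       forall t i, 0 <= t -> (i < ds + du)%nat ->
         sol (ds + du) al B g y0 t i =
         (if Nat.ltb i ds then sol ds al B g y0s t i
          else sol du al (blk_u ds B) (vec_u ds g) y0u t (i - ds)%nat)) /\
    (* decay *)
    (tends_to_0 (ds + du) g ->
       forall y0 : vec, bounded_on (ds + du) (sol (ds + du) al B g y0) ->
         tends_to_0 (ds + du) (sol (ds + du) al B g y0)).
Proof.
  intros Hal HJs HJu Hblk HEs HEu _ Hgc Hgb.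
  assert (Hgcs : continuous_on ds g) by (intros i t Hi; apply Hgc; lia).
  assert (Hgbs : bounded_on ds g) by (destruct Hgb as [M HM]; exists M; intros; apply HM; [assumption | lia]).
  assert (Hgcu : continuous_on du (vec_u ds g)) by (intros i t Hi; apply (Hgc (ds + i)%nat t); lia).
  assert (Hgbu : bounded_on du (vec_u ds g)).
  { destruct Hgb as [M HM]; exists M; intros t i Ht Hi. apply (HM t (ds + i)%nat Ht); lia. }
  assert (Hst := fun y0 => stable_solutions ds al B g y0 Hal HJs HEs Hgcs Hgbs).
  destruct (unstable_solutions du al (blk_u ds B) (vec_u ds g) Hal HJu HEu Hgcu Hgbu) as [y0u [HB [HT Huniq]]].
  (* A bounded solution of the full system restricts to a bounded solution on the unstable block,
     where uniqueness identifies it; its stable part is left as it is. *)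
  assert (Hres : forall y0, bounded_on (ds + du) (sol (ds + du) al B g y0) ->
     forall t i, (i < ds + du)%nat -> sol (ds + du) al B g y0 t i =
       (if Nat.ltb i ds then sol ds al B g y0 t i
        else sol du al (blk_u ds B) (vec_u ds g) y0u t (i - ds)%nat)).
  { intros y0 [M HM] t i Hi. destruct (Nat.ltb_spec i ds) as [H|H].
    - apply sol_block_s; assumption.
    - replace i with (ds + (i - ds))%nat at 1 by lia. rewrite sol_block_u by (assumption || lia).
      apply Huniq. exists M. intros s k Hs Hk.
      rewrite <- (sol_block_u ds du al B g y0 s k Hblk Hk). apply HM; [exact Hs | lia]. }
  exists y0u. split; [exact HB|]. split; [intros z0 Hz0 t i _ _; apply Huniq; exact Hz0|].
  split; [intros y0s; apply Hst|]. split; [|split].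
  - intros y0 Hy0. exists y0. intros t i _ Hi. apply Hres; assumption.
  (* Any stable initial value is glued to the distinguished unstable one. *)
  - intros y0s. set (y0 := (fun k => if Nat.ltb k ds then y0s k else y0u (k - ds)%nat) : vec).
    assert (E : forall t i, (i < ds + du)%nat -> sol (ds + du) al B g y0 t i =
         (if Nat.ltb i ds then sol ds al B g y0s t i
          else sol du al (blk_u ds B) (vec_u ds g) y0u t (i - ds)%nat)).
    { intros t i Hi. destruct (Nat.ltb_spec i ds) as [H|H].
      - rewrite sol_block_s by assumption. apply sol_ext. intros k Hk. unfold y0.
        destruct (Nat.ltb_spec k ds); [reflexivity | lia].
      - replace i with (ds + (i - ds))%nat at 1 by lia. rewrite sol_block_u by (assumption || lia).
        apply sol_ext. intros k Hk. unfold y0.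
        destruct (Nat.ltb_spec (ds + k) ds); [lia|]. f_equal; lia. }
    exists y0. split; [|intros t i _ Hi; apply E; exact Hi].
    destruct (Hst y0s) as [[M1 HM1] _]. destruct HB as [M2 HM2].
    exists (Rmax M1 M2). intros t i Ht Hi. rewrite E by exact Hi.
    destruct (Nat.ltb_spec i ds) as [H|H].
    + eapply Rle_trans; [apply HM1; assumption | apply Rmax_l].
    + eapply Rle_trans; [apply HM2; [assumption | lia] | apply Rmax_r].
  - intros Hz y0 Hy0 eps Heps.
    destruct (proj2 (Hst y0)) with eps as [T1 HT1]; [|exact Heps|].
    { intros e He. destruct (Hz e He) as [T HTT]. exists T. intros; apply HTT; [assumption | lia]. }
    destruct HT with eps as [T2 HT2]; [|exact Heps|].
    { intros e He. destruct (Hz e He) as [T HTT]. exists T. intros t i Ht Hi. apply (HTT t (ds + i)%nat); [assumption | lia]. }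
    exists (Rmax T1 T2). intros t i Ht Hi. rewrite Hres by assumption.
    pose proof (Rmax_l T1 T2). pose proof (Rmax_r T1 T2).
    destruct (Nat.ltb_spec i ds) as [H'|H'].
    + apply HT1; [lra | assumption].
    + apply HT2; [lra | lia].
Qed.
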